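(* Let $\lambda\in\,]0,1]$, $\theta\in\,]0,1[$ with $1/\theta\ge1+\lambda$, and let $(J_t)_{t\ge0}$, $J_t=PY_tQY_t^\star P$, be a free Jacobi process with parameters $(\lambda,\theta)$ started at $J_0=PY_0QY_0^\star P$ with $0<J_0<P$, i.e. $J_0$ and $P-J_0$ are invertible in $P\mathscr{A}P$. Let $\mu_t$ be the law of $J_t$ in $(P\mathscr{A}P,\tilde\Phi)$ and $G_t(z)=\int_0^1\frac{\mu_t(dx)}{z-x}$, $z\in\mathbb{C}^+$, its Cauchy transform. Then for all $t\ge0$ and $z\in\mathbb{C}^+$, $$\begin{aligned}G_t(z)&=G_0(z)+(1-2\lambda\theta)\int_0^tG_s(z)\,ds+\lambda\theta(2z-1)\int_0^tG_s^2(z)\,ds\\&\quad+\big((1-2\lambda\theta)z-\theta(1-\lambda)\big)\int_0^tG'_s(z)\,ds+2\lambda\theta\,z(z-1)\int_0^tG_s(z)G'_s(z)\,ds,\end{aligned}$$ where $G'_s$ denotes the derivative of $G_s$ with respect to $z$.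
   Context: $(\mathscr{A},(\mathscr{A}_t)_{t\ge0},\Phi)$ is a filtered $W^\star$ non-commutative probability space: $\mathscr{A}$ is a von Neumann algebra, $\Phi$ a faithful normal tracial state, $(\mathscr{A}_t)$ an increasing family of unital weakly closed $\star$-subalgebras. An $(\mathscr{A}_t)$-free (additive) Brownian motion is a self-adjoint process $X$ with $X_0=0$, $X_t\in\mathscr{A}_t$, and, for $s<t$, $X_t-X_s$ free from $\mathscr{A}_s$ and semicircular of mean $0$ and variance $t-s$. Free Jacobi process: $P,Q\in\mathscr{A}$ are projections with $\Phi(P)=\lambda\theta$, $\Phi(Q)=\theta$ and (here $\lambda\le1$) $PQ=QP=P$. $Y$ is a free multiplicative Brownian motion started at a unitary $Y_0$, i.e. the unitary solution of $dY_t=i\,dX_t\,Y_t-\frac12Y_t\,dt$ with $X$ an $(\mathscr{A}_t)$-free Brownian motion; equivalently $Y_t=Y^0_tY_0$ with $Y^0$ the solution started at $1$. $\{Y^0_t,(Y^0_t)^\star:t\ge0\}$ is free from $\{P,Q\}$, and $Y_0$ is free from $Y^0$ and from $\{P,Q\}$; $P,Q,Y_0\in\mathscr{A}_0$. $J_t=PY_tQY_t^\star P$ is considered in $(P\mathscr{A}P,\tilde\Phi)$, $\tilde\Phi=\frac1{\lambda\theta}\Phi|_{P\mathscr{A}P}$, with unit $P$; $0\le J_t\le P$, so $\mu_t$ is supported in $[0,1]$. $\mathbb{C}^+$ is the open upper half-plane. *)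

(* Defs.v *)
From HB Require Import structures.
From mathcomp Require Import all_boot all_order all_algebra.
From mathcomp Require Import sesquilinear complex.
From mathcomp Require Import all_classical all_reals all_analysis.
Set Implicit Arguments.
Unset Strict Implicit.
Unset Printing Implicit Defensive.
Import Order.TTheory GRing.Theory Num.Theory.
Import numFieldNormedType.Exports.
Local Open Scope classical_set_scope.
Local Open Scope ring_scope.
Local Open Scope complex_scope.

Section Operators.
Variables (R : realType) (H : lmodType R[i]) (dot : {dot H for @conjc R}).

Definition dot_complete :=
  forall u : nat -> H,
    (forall e : R, 0 < e -> exists N : nat, forall m n : nat,
       (N <= m)%N -> (N <= n)%N ->
       dot (u m - u n) (u m - u n) < e%:C) ->
    exists l : H, forall e : R, 0 < e -> exists N : nat, forall n : nat,
       (N <= n)%N -> dot (u n - l) (u n - l) < e%:C.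

Definition bounded_op (T : {linear H -> H}) :=
  exists M : R, forall x, dot (T x) (T x) <= M%:C * dot x x.

Definition adjoint_ops (T U : {linear H -> H}) :=
  forall x y, dot (T x) y = dot x (U y).

(* T is adherent to the set of operators S in the weak operator topology. *)
Definition wot_adherent (S : set {linear H -> H}) (T : {linear H -> H}) :=
  forall (n : nat) (x y : 'I_n -> H) (e : R), 0 < e ->
    exists2 U : {linear H -> H}, S U &
      forall k, `|dot (T (x k) - U (x k)) (y k)| < e%:C.

End Operators.

(* A von Neumann algebra is a unital *-algebra together with a faithful
   unital *-representation by bounded operators on a complex Hilbert space,
   whose image is closed in the weak operator topology.  Since [vna_rep] is
   injective, the algebraic laws of [star] follow from [vna_rep_star]. *)
Record vonNeumannAlgebra (R : realType) := VonNeumannAlgebra {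
  vna_carrier :> algType R[i];
  star : vna_carrier -> vna_carrier;
  vna_space : lmodType R[i];
  vna_dot : {dot vna_space for @conjc R};
  vna_rep : vna_carrier -> {linear vna_space -> vna_space};
  vna_complete : dot_complete vna_dot;
  vna_rep_bounded : forall a, bounded_op vna_dot (vna_rep a);
  vna_rep_lin : forall (c : R[i]) a b x,
    vna_rep (c *: a + b) x = c *: vna_rep a x + vna_rep b x;
  vna_rep1 : forall x, vna_rep 1 x = x;
  vna_repM : forall a b x, vna_rep (a * b) x = vna_rep a (vna_rep b x);
  vna_rep_star : forall a, adjoint_ops vna_dot (vna_rep a) (vna_rep (star a));
  vna_rep_inj : forall a b, vna_rep a =1 vna_rep b -> a = b;
  vna_weakly_closed : forall T : {linear vna_space -> vna_space},
    bounded_op vna_dot T -> wot_adherent vna_dot (range vna_rep) T ->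
    exists a, vna_rep a =1 T
}.

Section Algebra.
Variables (R : realType) (A : vonNeumannAlgebra R).
Implicit Types (a b : A) (S : set A).

Definition selfadjoint a := star a = a.
Definition unitary a := star a * a = 1 /\ a * star a = 1.
Definition projection a := star a = a /\ a * a = a.

(* [a] is invertible in the corner e A e, whose unit is [e]. *)
Definition corner_invertible (e a : A) :=
  exists b, [/\ b = e * b * e, a * b = e & b * a = e].

Definition op_le a b := exists c, b - a = star c * c.

Definition weakly_closed S :=
  forall T : {linear vna_space A -> vna_space A},
    bounded_op (vna_dot A) T -> wot_adherent (vna_dot A) (@vna_rep R A @` S) T ->
    exists2 a, S a & vna_rep a =1 T.

Record unital_star_subalgebra S : Prop := UnitalStarSubalgebra {
  usa_1 : S 1;
  usa_lin : forall (c : R[i]) a b, S a -> S b -> S (c *: a + b);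
  usa_mul : forall a b, S a -> S b -> S (a * b);
  usa_star : forall a, S a -> S (star a)
}.

Definition generated_star_algebra S : set A :=
  \bigcap_(B in [set B | unital_star_subalgebra B /\ S `<=` B]) B.

End Algebra.

Section Probability.
Variables (R : realType) (A : vonNeumannAlgebra R) (Phi : {scalar A}).
Implicit Types (a b : A) (S : set A).

(* Phi preserves suprema of upward directed families of self-adjoint elements. *)
Definition normal_functional :=
  forall (D : set A) (a : A),
    D !=set0 -> (forall b, D b -> selfadjoint b) -> selfadjoint a ->
    (forall b c, D b -> D c -> exists d, [/\ D d, op_le b d & op_le c d]) ->
    (forall b, D b -> op_le b a) ->
    (forall c, selfadjoint c -> (forall b, D b -> op_le b c) -> op_le a c) ->
    complex.Re (Phi a) = sup [set complex.Re (Phi b) | b in D].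

Record faithful_normal_tracial_state : Prop := FaithfulNormalTracialState {
  state_unit : Phi 1 = 1;
  state_pos : forall a, 0 <= Phi (star a * a);
  state_faithful : forall a, Phi (star a * a) = 0 -> a = 0;
  state_normal : normal_functional;
  state_trace : forall a b, Phi (a * b) = Phi (b * a)
}.

Definition l2sq a : R := complex.Re (Phi (star a * a)).

(* [m] is the law of the bounded self-adjoint element [a] of the corner e A e
   endowed with the normalized functional c^-1 Phi: the compactly supported
   probability measure with the moments of [a].  Note e * a ^+ 0 = e. *)
Definition law_in_corner (c : R) (e a : A)
    (m : probability (measurableTypeR R) R) :=
  (exists M : R, m `[- M, M]%classic = 1%E) /\
  forall n : nat,
    Phi (e * a ^+ n) / c%:C = (\int[m]_(x in setT) (x ^+ n))%:C.

(* Semicircle distribution of mean 0 and variance v: density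
   sqrt (4 v - x^2) / (2 pi v) on [-2 sqrt v, 2 sqrt v]. *)
Definition semicircular (v : R) a :=
  selfadjoint a /\
  forall n : nat,
    Phi (a ^+ n) =
    (\int[lebesgue_measure]_(x in `[- (2 * Num.sqrt v), 2 * Num.sqrt v])
       (x ^+ n * (Num.sqrt (4 * v - x ^+ 2) / (2 * pi * v))))%:C.

(* Freeness of a family of subsets: in the unital *-algebras they generate,
   alternating products of centred elements are centred. *)
Definition free_family (I : eqType) (S : I -> set A) :=
  forall w : seq (I * A),
    w != [::] ->
    sorted (fun p q => p.1 != q.1) w ->
    (forall p, p \in w -> generated_star_algebra (S p.1) p.2 /\ Phi p.2 = 0) ->
    Phi (\prod_(p <- w) p.2) = 0.

Definition free_from S S' := free_family (fun b : bool => if b then S else S').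

End Probability.

Section StochasticCalculus.
Variables (R : realType) (A : vonNeumannAlgebra R) (Phi : {scalar A}).
Variable F : R -> set A.

Record filtration : Prop := Filtration {
  filt_algebra : forall t, 0 <= t -> unital_star_subalgebra (F t);
  filt_closed : forall t, 0 <= t -> weakly_closed (F t);
  filt_mono : forall s t, 0 <= s -> s <= t -> F s `<=` F t
}.

Definition adapted (Y : R -> A) := forall t, 0 <= t -> F t (Y t).

Record free_brownian_motion (X : R -> A) : Prop := FreeBrownianMotion {
  fbm_selfadjoint : forall t, 0 <= t -> selfadjoint (X t);
  fbm_start : X 0 = 0;
  fbm_adapted : adapted X;
  fbm_free : forall s t, 0 <= s -> s < t ->
    free_from Phi [set X t - X s] (F s);
  fbm_semicircular : forall s t, 0 <= s -> s < t ->
    semicircular Phi (t - s) (X t - X s)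
}.

(* Step processes on [0, t[ with values in A: [step_val i] on
   [step_knot i, step_knot i.+1[ for i < step_size. *)
Record step_process (t : R) := StepProcess {
  step_size : nat;
  step_knot : nat -> R;
  step_val : nat -> A;
  step_knot0 : step_knot 0 = 0;
  step_knot_le : forall i, (i < step_size)%N -> step_knot i <= step_knot i.+1;
  step_knot_last : step_knot step_size = t
}.

Definition step_eval t (V : step_process t) (s : R) : A :=
  \sum_(i < step_size V | step_knot V i <= s < step_knot V i.+1) step_val V i.

Definition step_adapted t (V : step_process t) :=
  forall i, (i < step_size V)%N -> F (step_knot V i) (step_val V i).

Definition step_dX_integral (X : R -> A) t (V : step_process t) : A :=
  \sum_(i < step_size V)
    (X (step_knot V i.+1) - X (step_knot V i)) * step_val V i.

Definition step_time_integral t (V : step_process t) : A :=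
  \sum_(i < step_size V)
    (step_knot V i.+1 - step_knot V i)%:C *: step_val V i.

(* I = int_0^t dX_s Y_s: the extension, by the isometry
   |int dX V|_2^2 = int |V_s|_2^2 ds, of the integral of adapted step
   processes. *)
Definition is_dX_integral (X Y : R -> A) (t : R) (I : A) :=
  exists V : nat -> step_process t,
    [/\ forall n, step_adapted (V n),
        forall n, measurable_fun (`[0, t] : set (measurableTypeR R))
          (fun s => l2sq Phi (step_eval (V n) s - Y s)),
        (\int[lebesgue_measure]_(s in `[0%R, t])
           (l2sq Phi (step_eval (V n) s - Y s))%:E)%E @[n --> \oo] --> 0%E
      & l2sq Phi (step_dX_integral X (V n) - I) @[n --> \oo] --> (0 : R)].

(* D = int_0^t Y_s ds, a Bochner integral in L^2(A, Phi). *)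
Definition is_time_integral (Y : R -> A) (t : R) (D : A) :=
  exists V : nat -> step_process t,
    [/\ forall n, measurable_fun (`[0, t] : set (measurableTypeR R))
          (fun s => Num.sqrt (l2sq Phi (step_eval (V n) s - Y s))),
        (\int[lebesgue_measure]_(s in `[0%R, t])
           (Num.sqrt (l2sq Phi (step_eval (V n) s - Y s)))%:E)%E
           @[n --> \oo] --> 0%E
      & l2sq Phi (step_time_integral (V n) - D) @[n --> \oo] --> (0 : R)].

(* The unitary solution of dY = i dX Y - (1/2) Y dt with initial value Y 0. *)
Record free_multiplicative_brownian_motion (X Y : R -> A) : Prop :=
  FreeMultiplicativeBrownianMotion {
  fmbm_adapted : adapted Y;
  fmbm_unitary : forall t, 0 <= t -> unitary (Y t);
  fmbm_sde : forall t, 0 <= t -> exists I D : A,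
    [/\ is_dX_integral X Y t I, is_time_integral Y t D
      & Y t = Y 0 + (0 +i* 1) *: I - (2^-1 : R[i]) *: D]
}.

End StochasticCalculus.

Section Jacobi.
Variables (R : realType) (A : vonNeumannAlgebra R) (Phi : {scalar A}).

(* Y^0_t = Y_t Y_0^*, so that Y_t = Y^0_t Y_0. *)
Definition from_one (Y : R -> A) (t : R) : A := Y t * star (Y 0).

Definition jacobi (Y : R -> A) (P Q : A) (t : R) : A :=
  P * Y t * Q * star (Y t) * P.

Record free_jacobi_setting (F : R -> set A) (X Y : R -> A) (P Q : A)
    (lambda theta : R) : Prop := FreeJacobiSetting {
  fj_state : faithful_normal_tracial_state Phi;
  fj_filtration : filtration F;
  fj_bm : free_brownian_motion Phi F X;
  fj_mbm : free_multiplicative_brownian_motion Phi F X Y;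
  fj_projP : projection P;
  fj_projQ : projection Q;
  fj_P0 : F 0 P;
  fj_Q0 : F 0 Q;
  fj_traceP : Phi P = (lambda * theta)%:C;
  fj_traceQ : Phi Q = theta%:C;
  fj_PQ : P * Q = P;
  fj_QP : Q * P = P;
  fj_free_Y : free_from Phi [set from_one Y t | t in [set t | 0 <= t]] [set P; Q];
  fj_free_Y0_Y : free_from Phi [set Y 0] [set from_one Y t | t in [set t | 0 <= t]];
  fj_free_Y0_PQ : free_from Phi [set Y 0] [set P; Q]
}.

End Jacobi.

Definition cintegral (R : realType) (m : {measure set (measurableTypeR R) -> \bar R})
    (D : set (measurableTypeR R)) (f : R -> R[i]) : R[i] :=
  (\int[m]_(x in D) complex.Re (f x)) +i* (\int[m]_(x in D) complex.Im (f x)).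

Definition cauchy_transform (R : realType)
    (m : probability (measurableTypeR R) R) (z : R[i]) : R[i] :=
  cintegral m `[0, 1]%classic (fun x => (z - x%:C)^-1).

(* Derivative with respect to the complex variable; R[i]^o is R[i] seen as a
   normed module over itself. *)
Definition cderive (R : realType) (f : R[i] -> R[i]) (z : R[i]) : R[i] :=
  derive1 (f : (R[i] : numFieldType) -> (R[i] : numFieldType)^o) z.

(* Main.v *)
(* Write q_t = Y_t Q Y_t^* , so that J_t = P q_t P, and let R_t be the resolvent
   (z - J_t)^-1. For s < t and h = t - s, the stochastic equation and freeness of
   x = X_t - X_s from A_s give q_t - q_s = i [x, q_s] + O(h) in L^2, with
   Phi ((q_t - q_s) b) = h (theta Phi b - Phi (q_s b)) + O(h^(3/2)) for b in A_s and
   Phi (x a x b) = h Phi a Phi b for a, b in A_s. The resolvent expansion to third order in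
   J_t - J_s then yields
     Phi (P R_t) - Phi (P R_s) = h H_s + O(h^(3/2)),
   where H_s is a polynomial in the traces of P R, P R^2, J R and J R^2, that is, in
   G_s(z) and G'_s(z). Hence G_t - int_0^t H is a function of t with increments
   O(h^(3/2)), so it is constant.

   To remain inside polynomials in J_t, whose traces are moments of mu_t, R_t is
   replaced by partial sums of its Neumann series around a point 1/2 - iM; since
   |J_t - (1/2 - iM)| <= sqrt (1/4 + M^2) < |z - (1/2 - iM)| for M large, they
   converge geometrically, uniformly in t. *)
Require Import Defs.
From mathcomp Require Import all_boot all_order all_algebra.
From mathcomp Require Import complex ring lra.
From mathcomp Require Import all_classical all_reals all_analysis.
From mathcomp Require Import measurable_realfun.
Import Order.TTheory GRing.Theory Num.Theory.
Import numFieldNormedType.Exports.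
Import ComplexField.
Set Implicit Arguments.
Unset Strict Implicit.
Unset Printing Implicit Defensive.
Local Open Scope classical_set_scope.
Local Open Scope ring_scope.
Local Open Scope complex_scope.

(** The stochastic equation controls $Y_t-Y_s$ only in $L^2$, and the $L^2$ norm is not
    submultiplicative. In the trace of a product, Cauchy-Schwarz can place two factors in $L^2$;
    every other factor needs an operator bound, and for the increment of $q$ that bound is a mere
    constant. At third order one increment is therefore first replaced by its linear part
    $i[x,q_s]$, which is of order $\sqrt h$ in operator norm because a semicircular element of
    variance $h$ is bounded by $2\sqrt h$. That bound is extracted from moments, so that no spectral
    theory enters.

    The truncation error of the Neumann sums is not proportional to $h$. The limit in the number of
    terms is therefore taken for fixed $s\le t$, before the time interval is subdivided. In the
    limit $G_t$ and $G_t'$ are $\frac12$-Hölder in $t$, which makes the time integrals of the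
    statement exist and gives them increments $hH_s+O(h^{3/2})$ as well. *)

Section ZmoduleReflection.
Variable V : zmodType.

Inductive zexpr := ZVar of nat | ZZero | ZAdd of zexpr & zexpr | ZOpp of zexpr.

Fixpoint zeval (v : seq V) e : V :=
  match e with
  | ZVar n => v`_n
  | ZZero => 0
  | ZAdd a b => zeval v a + zeval v b
  | ZOpp a => - zeval v a
  end.

Fixpoint zcoef e (i : nat) : int :=
  match e with
  | ZVar n => (n == i)%:R
  | ZZero => 0
  | ZAdd a b => zcoef a i + zcoef b i
  | ZOpp a => - zcoef a i
  end.

Fixpoint zbounded n e : bool :=
  match e with
  | ZVar m => (m < n)%N
  | ZZero => true
  | ZAdd a b => zbounded n a && zbounded n b
  | ZOpp a => zbounded n a
  end.

Lemma zevalE v e : zbounded (size v) e ->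
  zeval v e = \sum_(i < size v) v`_i *~ zcoef e i.
Proof.
elim: e => [n|_|a IHa b IHb|a IH] /=.
- move=> nv; rewrite (bigD1 (Ordinal nv))//= eqxx big1 ?addr0//.
  by move=> i /negbTE; rewrite -val_eqE eq_sym /= => ->.
- by rewrite big1.
- by move=> /andP[/IHa-> /IHb->]; rewrite -big_split; apply: eq_bigr => i _; rewrite mulrzDr.
- by move=> /IH->; rewrite -sumrN; apply: eq_bigr => i _; rewrite mulrNz.
Qed.

Lemma zmodule_eq v e1 e2 :
  [&& zbounded (size v) e1, zbounded (size v) e2 &
    all (fun i => zcoef e1 i == zcoef e2 i) (iota 0 (size v))] ->
  zeval v e1 = zeval v e2.
Proof.
move=> /and3P[b1 b2 /allP e12]; rewrite !zevalE//; apply: eq_bigr => i _.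
by congr (_ *~ _); apply/eqP/e12; rewrite mem_iota add0n /= ltn_ord.
Qed.

End ZmoduleReflection.

(** Atoms are compared up to unification. The vacuous [match] runs [unify] for its success or
    failure while the tactic still returns a term. *)
Ltac zlookup x v :=
  match v with
  | cons ?y _ => let _ := match constr:(O) with _ => unify x y end in constr:(O)
  | cons _ ?w => let n := zlookup x w in constr:(S n)
  end.

Ltac zatoms t v :=
  lazymatch t with
  | Algebra.add ?a ?b => let v1 := zatoms a v in zatoms b v1
  | Algebra.opp ?a => zatoms a v
  | Algebra.zero => v
  | _ => match v with
         | _ => let n := zlookup t v in v
         | _ => constr:(cons t v)
         end
  end.

Ltac zreify t v :=
  lazymatch t with
  | Algebra.add ?a ?b => let ea := zreify a v in let eb := zreify b v in constr:(ZAdd ea eb)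
  | Algebra.opp ?a => let ea := zreify a v in constr:(ZOpp ea)
  | Algebra.zero => constr:(ZZero)
  | _ => let n := zlookup t v in constr:(ZVar n)
  end.

(* [ring] needs commutativity; this decides the additive identities left once
   products in [A] have been expanded. *)
Ltac zmodule :=
  lazymatch goal with
  | |- @eq ?T ?l ?r =>
    let v0 := zatoms l (@nil T) in
    let v := zatoms r v0 in
    let el := zreify l v in
    let er := zreify r v in
    refine (@zmodule_eq _ v el er _); vm_compute; reflexivity
  end.

(** * The L2 space of a tracial state *)

Section StarAlgebra.
Variables (R : realType) (A : vonNeumannAlgebra R).
Implicit Types (a b : A) (c : R[i]).

Local Notation dot := (vna_dot A).
Local Notation rep := (@vna_rep R A).

Lemma dot_conj x y : dot x y = (dot y x)^*.
Proof. by have := hermC dot x y; rewrite expr0 mul1r. Qed.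

(** The difference of the two candidate vectors is orthogonal to everything, itself included;
    faithfulness of the representation concludes. The laws of [star] below rest on this. *)
Lemma star_uniq a b :
  (forall x y, dot (rep a x) y = dot x (rep b y)) -> star a = b.
Proof.
move=> ab; apply: vna_rep_inj => y; apply/eqP; rewrite -subr_eq0.
rewrite -(dnorm_eq0 dot); set d := (X in dot X X).
have e : dot d (rep (star a) y) = dot d (rep b y) by rewrite -vna_rep_star ab.
by rewrite /d linearBr -/d subr_eq0; apply/eqP.
Qed.

Lemma starK a : star (star a) = a.
Proof.
apply: star_uniq => x y.
by rewrite dot_conj -vna_rep_star -dot_conj.
Qed.

Lemma starM a b : star (a * b) = star b * star a.
Proof.
apply: star_uniq => x y.
by rewrite !vna_repM !vna_rep_star.
Qed.

Lemma star_lin c a b : star (c *: a + b) = c^* *: star a + star b.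
Proof.
apply: star_uniq => x y; rewrite !vna_rep_lin.
rewrite linearDl linearZl_LR linearDr linearZr_LR /= conjcK.
by congr (_ * _ + _); exact: vna_rep_star.
Qed.

Lemma star1 : star 1 = 1 :> A.
Proof. by apply: star_uniq => x y; rewrite !vna_rep1. Qed.

Lemma starD : {morph @star R A : a b / a + b}.
Proof. move=> a b; have := star_lin 1 a b; rewrite !scale1r => ->; congr (_ + _).
by rewrite -[RHS]scale1r; congr (_ *: _); exact: conjc1. Qed.

Lemma star0 : star 0 = 0 :> A.
Proof. by apply: (addIr (star 0)); rewrite -starD !add0r. Qed.

Lemma starZ c a : star (c *: a) = c^* *: star a.
Proof. by rewrite -[c *: a]addr0 star_lin star0 addr0. Qed.

Lemma starN : {morph @star R A : a / - a}.
Proof. by move=> a; apply: (addIr (star a)); rewrite -starD !addNr star0. Qed.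

Lemma starB : {morph @star R A : a b / a - b}.
Proof. by move=> a b; rewrite starD starN. Qed.

Lemma starX a n : star (a ^+ n) = star a ^+ n.
Proof. by elim: n => [|n IH]; rewrite ?expr0 ?star1// exprS starM IH -exprSr. Qed.

End StarAlgebra.

(** * Real-valued modulus of complex numbers *)

Section ComplexModulus.
Variable R : realType.
Implicit Types z w : R[i].

(** The norm of [R[i]] takes its values in [R[i]]; a modulus in [R] can be compared with square
    roots and handed to [lra]. *)
Definition cmod z : R := Num.sqrt (complex.Re z ^+ 2 + complex.Im z ^+ 2).

Lemma cmodE z : `|z| = (cmod z)%:C.
Proof. exact: normc_def. Qed.

Lemma cmod_ge0 z : 0 <= cmod z.
Proof. exact: sqrtr_ge0. Qed.

Lemma cmodM z w : cmod (z * w) = cmod z * cmod w.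
Proof. by apply: complexI; rewrite rmorphM /= -!cmodE normrM. Qed.

Lemma cmodX z n : cmod (z ^+ n) = cmod z ^+ n.
Proof. by apply: complexI; rewrite rmorphXn /= -!cmodE normrX. Qed.

Lemma cmodN z : cmod (- z) = cmod z.
Proof. by apply: complexI; rewrite -!cmodE normrN. Qed.

Lemma cmodD z w : cmod (z + w) <= cmod z + cmod w.
Proof. by rewrite -lecR rmorphD /= -!cmodE ler_normD. Qed.

Lemma cmodB z w : cmod (z - w) <= cmod z + cmod w.
Proof. by rewrite -(cmodN w) cmodD. Qed.

Lemma cmodJ z : cmod z^* = cmod z.
Proof. by case: z => a b; rewrite /cmod /= sqrrN. Qed.

Lemma cmodR (x : R) : cmod x%:C = `|x|.
Proof. by rewrite /cmod /= expr0n /= addr0 sqrtr_sqr. Qed.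

Lemma cmod0 : cmod 0 = 0.
Proof. by rewrite cmodR normr0. Qed.

Lemma cmod1 : cmod 1 = 1.
Proof. by rewrite cmodR normr1. Qed.

Lemma cmodi : cmod 'i = 1.
Proof. by rewrite /cmod /= expr0n expr1n add0r sqrtr1. Qed.

Lemma cmodV z : cmod z^-1 = (cmod z)^-1.
Proof. by apply: complexI; rewrite fmorphV /= -!cmodE normfV. Qed.

Lemma cmod_eq0 z : cmod z = 0 -> z = 0.
Proof. by move=> z0; apply/eqP; rewrite -normr_eq0 cmodE z0. Qed.

Lemma cmod_sqr z : (cmod z ^+ 2)%:C = z^* * z.
Proof. by rewrite rmorphXn /= -cmodE sqr_normc mulrC. Qed.

Lemma Re_le_cmod z : `|complex.Re z| <= cmod z.
Proof. by rewrite -lecR -cmodE normc_ge_Re. Qed.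

Lemma Im_le_cmod z : `|complex.Im z| <= cmod z.
Proof.
case: z => a b; rewrite /cmod /= -sqrtr_sqr ler_wsqrtr//.
by rewrite lerDr sqr_ge0.
Qed.

Lemma cmod_le_ReIm z : cmod z <= `|complex.Re z| + `|complex.Im z|.
Proof.
case: z => a b; rewrite [X in cmod X](_ : _ = a%:C + 'i * b%:C); last by simpc.
by rewrite (le_trans (cmodD _ _))//= cmodM cmodi mul1r !cmodR.
Qed.

Lemma ReD z w : complex.Re (z + w) = complex.Re z + complex.Re w.
Proof. by case: z => ? ?; case: w. Qed.

Lemma ReN z : complex.Re (- z) = - complex.Re z.
Proof. by case: z. Qed.

Lemma ReB z w : complex.Re (z - w) = complex.Re z - complex.Re w.
Proof. by rewrite ReD ReN. Qed.

Lemma ReJ z : complex.Re z^* = complex.Re z.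
Proof. by case: z. Qed.

Lemma ReZ (x : R) z : complex.Re (x%:C * z) = x * complex.Re z.
Proof. by case: z => a b /=; rewrite mul0r subr0. Qed.

Lemma ImD z w : complex.Im (z + w) = complex.Im z + complex.Im w.
Proof. by case: z => ? ?; case: w. Qed.

Lemma ImN z : complex.Im (- z) = - complex.Im z.
Proof. by case: z. Qed.

Lemma ImZ (x : R) z : complex.Im (x%:C * z) = x * complex.Im z.
Proof. by case: z => a b /=; rewrite mul0r addr0. Qed.

End ComplexModulus.

Section Trace.
Variables (R : realType) (A : vonNeumannAlgebra R) (Phi : {scalar A}).
Hypothesis st : faithful_normal_tracial_state Phi.
Implicit Types (a b c : A) (z : R[i]) (x K L : R).

Definition tr a : R[i] := Phi a.

Lemma trD a b : tr (a + b) = tr a + tr b.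
Proof. exact: raddfD. Qed.

Lemma trN a : tr (- a) = - tr a.
Proof. exact: raddfN. Qed.

Lemma trB a b : tr (a - b) = tr a - tr b.
Proof. exact: raddfB. Qed.

Lemma tr0 : tr 0 = 0.
Proof. exact: raddf0. Qed.

Lemma trZ z a : tr (z *: a) = z * tr a.
Proof. exact: linearZ. Qed.

Lemma tr1 : tr 1 = 1.
Proof. exact: state_unit. Qed.

Lemma trC a b : tr (a * b) = tr (b * a).
Proof. exact: state_trace. Qed.

(** Positivity forces this: $\Phi((1+za)^\star(1+za))$ is real, and $z=1$, $z=i$ give the two real
    equations required. *)
Lemma tr_star a : tr (star a) = (tr a)^*.
Proof.
have im c : complex.Im (tr (star c * c)) = 0.
  exact/ger0_Im/state_pos.
have e (z : R[i]) : complex.Im (tr (star (1 + z *: a) * (1 + z *: a))) = 0 by [].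
have {}e z : complex.Im (z * tr a + z^* * tr (star a)) = 0.
  have := e z; rewrite starD star1 starZ mulrDl mul1r mulrDr mulr1.
  rewrite -scalerAl -scalerAr !trD !trZ !ImD tr1 /= add0r.
  have -> : complex.Im (z^* * (z * tr (star a * a))) = 0.
    rewrite mulrA -cmod_sqr ImZ; apply/eqP; rewrite mulf_eq0; apply/orP; right.
    by apply/eqP/im.
  by rewrite addr0.
have := e 1; have := e 'i; rewrite !ImD.
case: (tr a) => a1 a2; case: (tr (star a)) => b1 b2 /=.
by simpc => e1 e2; congr (_ +i* _); lra.
Qed.

Notation l2 := (l2sq Phi).
Definition nrm a : R := Num.sqrt (l2 a).
(** The real part is a symmetric bilinear form over [R], enough for the Hilbert space estimates;
    [tr_le] recovers the complex modulus by a rotation. *)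
Definition ip a b : R := complex.Re (tr (star a * b)).

Lemma l2E a : l2 a = ip a a.
Proof. by []. Qed.

Lemma l2_ge0 a : 0 <= l2 a.
Proof. by have := state_pos st a; rewrite lecE => /andP[]. Qed.

Lemma tr_l2 a : tr (star a * a) = (l2 a)%:C.
Proof.
rewrite /l2sq -/(tr _).
have := ger0_Im (state_pos st a); rewrite -/(tr _).
by case: (tr _) => ? ? /= ->.
Qed.

Lemma nrm_ge0 a : 0 <= nrm a.
Proof. exact: sqrtr_ge0. Qed.

Lemma nrm_sqr a : nrm a ^+ 2 = l2 a.
Proof. by rewrite sqr_sqrtr// l2_ge0. Qed.

Lemma l2_eq0 a : l2 a = 0 -> a = 0.
Proof. by move=> a0; apply: (state_faithful st); rewrite -/(tr _) tr_l2 a0. Qed.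

Lemma nrm_eq0 a : nrm a = 0 -> a = 0.
Proof. by move=> a0; apply: l2_eq0; rewrite -nrm_sqr a0 expr0n. Qed.

Lemma ipC a b : ip a b = ip b a.
Proof. by rewrite /ip -ReJ -tr_star starM starK. Qed.

Lemma ipDr a b c : ip a (b + c) = ip a b + ip a c.
Proof. by rewrite /ip mulrDr trD ReD. Qed.

Lemma ipDl a b c : ip (b + c) a = ip b a + ip c a.
Proof. by rewrite !(ipC _ a) ipDr. Qed.

Lemma ipZr x a b : ip a (x%:C *: b) = x * ip a b.
Proof. by rewrite /ip -scalerAr trZ ReZ. Qed.

Lemma ipZl x a b : ip (x%:C *: a) b = x * ip a b.
Proof. by rewrite ipC ipZr ipC. Qed.

Lemma ipNr a b : ip a (- b) = - ip a b.
Proof. by rewrite /ip mulrN trN ReN. Qed.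

Lemma ipNl a b : ip (- a) b = - ip a b.
Proof. by rewrite ipC ipNr ipC. Qed.

Lemma ip0r a : ip a 0 = 0.
Proof. by rewrite /ip mulr0 tr0. Qed.

Lemma ip0l a : ip 0 a = 0.
Proof. by rewrite ipC ip0r. Qed.

Lemma l2D a b : l2 (a + b) = l2 a + 2 * ip a b + l2 b.
Proof. by rewrite !l2E !ipDl !ipDr (ipC b a); ring. Qed.

Lemma l2Z z a : l2 (z *: a) = cmod z ^+ 2 * l2 a.
Proof.
apply: complexI; rewrite rmorphM /= -!tr_l2 starZ -scalerAl -scalerAr !trZ.
by rewrite mulrA cmod_sqr.
Qed.

Lemma l2N a : l2 (- a) = l2 a.
Proof. by rewrite !l2E ipNl ipNr opprK. Qed.

Lemma l2_star a : l2 (star a) = l2 a.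
Proof. by rewrite /l2sq starK -/(tr _) trC. Qed.

Lemma nrmZ z a : nrm (z *: a) = cmod z * nrm a.
Proof.
by rewrite /nrm l2Z sqrtrM ?sqr_ge0// sqrtr_sqr ger0_norm// cmod_ge0.
Qed.

Lemma nrmN a : nrm (- a) = nrm a.
Proof. by rewrite /nrm l2N. Qed.

Lemma nrm_star a : nrm (star a) = nrm a.
Proof. by rewrite /nrm l2_star. Qed.

Lemma nrm0 : nrm 0 = 0.
Proof. by rewrite /nrm l2E ip0r sqrtr0. Qed.

Lemma nrm1 : nrm 1 = 1.
Proof. by rewrite /nrm l2E /ip mulr1 star1 tr1 sqrtr1. Qed.

Lemma ip_le a b : ip a b <= nrm a * nrm b.
Proof.
have [a0|a_gt0] := leP (nrm a) 0.
  rewrite (@nrm_eq0 a) ?ip0l ?nrm0 ?mul0r//.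
  by apply/eqP; rewrite eq_le a0 nrm_ge0.
have [b0|b_gt0] := leP (nrm b) 0.
  rewrite (@nrm_eq0 b) ?ip0r ?nrm0 ?mulr0//.
  by apply/eqP; rewrite eq_le b0 nrm_ge0.
(* The squared norm of this vector is $2\|a\|\|b\|(\|a\|\|b\|-\langle a,b\rangle)$. *)
have := l2_ge0 ((nrm b)%:C *: a + (- nrm a)%:C *: b).
rewrite l2D ipZl ipZr !l2Z !cmodR normrN !ger0_norm ?nrm_ge0// -!nrm_sqr.
move=> h; have : 0 <= 2 * (nrm a * nrm b) * (nrm a * nrm b - ip a b).
  by move: h; rewrite [leRHS](_ : _ = 2 * (nrm a * nrm b) * (nrm a * nrm b - ip a b)); last by ring.
by rewrite pmulr_rge0 ?subr_ge0// !mulr_gt0.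
Qed.

Lemma ip_abs_le a b : `|ip a b| <= nrm a * nrm b.
Proof.
by rewrite ler_norml ip_le andbT lerNl -ipNr -(nrmN b) ip_le.
Qed.

Lemma tr_le a b : cmod (tr (a * b)) <= nrm a * nrm b.
Proof.
set u := tr _; have [u0|u_gt0] := leP (cmod u) 0.
  by rewrite (le_trans u0)// mulr_ge0 ?nrm_ge0.
(* The factor $\bar u$ turns the trace into the real number $|u|^2$. *)
have := ip_le (star a) (u^* *: b).
rewrite /ip starK -scalerAr trZ -/u -cmod_sqr /= nrmZ nrm_star cmodJ mulrCA.
by rewrite expr2 => h; rewrite -(ler_pM2l u_gt0).
Qed.

Lemma tr_le1 a : cmod (tr a) <= nrm a.
Proof. by have := tr_le a 1; rewrite mulr1 nrm1 mulr1. Qed.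

Lemma nrmD a b : nrm (a + b) <= nrm a + nrm b.
Proof.
rewrite -(@ler_pXn2r _ 2) ?nnegrE ?addr_ge0 ?nrm_ge0//.
rewrite nrm_sqr l2D sqrrD -!nrm_sqr lerD2r lerD2l -[leRHS]mulr_natl ler_pM2l//.
exact: ip_le.
Qed.

Lemma nrmB a b : nrm (a - b) <= nrm a + nrm b.
Proof. by rewrite -(nrmN b) nrmD. Qed.

(* [|a| <= K] for the operator norm, read off left and right multiplication on
   L^2(A, Phi), so that the norm of the representation is never needed. *)
Definition opb K a := 0 <= K /\
  forall b, nrm (a * b) <= K * nrm b /\ nrm (b * a) <= K * nrm b.

Lemma opb_ge0 K a : opb K a -> 0 <= K.
Proof. by case. Qed.

Lemma opbl K a b : opb K a -> nrm (a * b) <= K * nrm b.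
Proof. by move=> [_ /(_ b)[]]. Qed.

Lemma opbr K a b : opb K a -> nrm (b * a) <= K * nrm b.
Proof. by move=> [_ /(_ b)[]]. Qed.

Lemma opb_nrm K a : opb K a -> nrm a <= K.
Proof. by move=> /(opbl 1); rewrite mulr1 nrm1 mulr1. Qed.

Lemma opbW K L a : K <= L -> opb K a -> opb L a.
Proof.
move=> KL [K0 h]; split=> [|b]; first exact: le_trans KL.
by split; [case: (h b) => + _ | case: (h b) => _ +] => /le_trans; apply;
  rewrite ler_wpM2r// nrm_ge0.
Qed.

Lemma opb1 : opb 1 1.
Proof. by split=> // b; rewrite mul1r mulr1 mul1r. Qed.

Lemma opb0 : opb 0 0.
Proof. by split=> // b; rewrite !mul0r mulr0 nrm0. Qed.

Lemma opbM K L a b : opb K a -> opb L b -> opb (K * L) (a * b).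
Proof.
move=> ha hb; split=> [|c]; first by rewrite mulr_ge0 ?(opb_ge0 ha) ?(opb_ge0 hb).
split.
  rewrite -mulrA (le_trans (opbl _ ha))// -mulrA ler_wpM2l ?(opb_ge0 ha)//.
  exact: opbl.
rewrite mulrA (le_trans (opbr _ hb))// mulrAC [K * _ * _]mulrC.
by rewrite ler_wpM2l ?(opb_ge0 hb)//; exact: opbr.
Qed.

Lemma opbD K L a b : opb K a -> opb L b -> opb (K + L) (a + b).
Proof.
move=> ha hb; split=> [|c]; first by rewrite addr_ge0 ?(opb_ge0 ha) ?(opb_ge0 hb).
by rewrite mulrDl mulrDr mulrDl; split; rewrite (le_trans (nrmD _ _))// lerD//;
  (exact: opbl || exact: opbr).
Qed.

Lemma opbZ K z a : opb K a -> opb (cmod z * K) (z *: a).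
Proof.
move=> ha; split=> [|c]; first by rewrite mulr_ge0 ?(opb_ge0 ha) ?cmod_ge0.
rewrite -scalerAl -scalerAr !nrmZ -mulrA.
by split; rewrite ler_wpM2l ?cmod_ge0//; (exact: opbl || exact: opbr).
Qed.

Lemma opbN K a : opb K a -> opb K (- a).
Proof. by move=> [K0 h]; split=> // b; rewrite mulNr mulrN !nrmN. Qed.

Lemma opbB K L a b : opb K a -> opb L b -> opb (K + L) (a - b).
Proof. by move=> ha hb; apply: opbD => //; exact: opbN. Qed.

Lemma opbX K a n : opb K a -> opb (K ^+ n) (a ^+ n).
Proof.
move=> ha; elim: n => [|n IH]; first by rewrite !expr0; exact: opb1.
by rewrite !exprS; exact: opbM.
Qed.

Lemma opb_star K a : opb K a -> opb K (star a).
Proof.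
move=> [K0 h]; split=> // b.
rewrite -(nrm_star (star a * b)) -(nrm_star (b * star a)) !starM starK.
by rewrite -(nrm_star b); case: (h (star b)).
Qed.

Lemma opbP K a : 0 <= K ->
  (forall b, l2 (a * b) <= K ^+ 2 * l2 b) ->
  (forall b, l2 (b * a) <= K ^+ 2 * l2 b) -> opb K a.
Proof.
move=> K0 h1 h2; split=> // b; split.
all: rewrite -(ger0_norm K0) -sqrtr_sqr -sqrtrM ?sqr_ge0// ler_wsqrtr//.
Qed.

Lemma opb_unitary a : unitary a -> opb 1 a.
Proof.
move=> [u1 u2]; apply: opbP => // b; rewrite expr1n mul1r le_eqVlt; apply/orP; left.
  by rewrite !l2E /ip starM -mulrA [_ * (a * b)]mulrA u1 mul1r.
by rewrite -l2_star starM -[X in _ == X]l2_star !l2E /ip starM !starK -mulrA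
  (mulrA a) u2 mul1r.
Qed.

End Trace.

(** * Operator bounds obtained from high powers *)

Section RealPowers.
Variable R : realType.
Implicit Types r e u v : R.

Lemma geometric_small r e : 0 <= r -> r < 1 -> 0 < e ->
  exists N : nat, forall n, (N <= n)%N -> r ^+ n < e.
Proof.
move=> r0 r1 e0.
have /cvgrPdist_lt/(_ _ e0) := @cvg_expr R r (ltac:(by rewrite ger0_norm)).
move=> -[N _ h]; exists N => n /h /=.
by rewrite sub0r normrN ger0_norm// exprn_ge0.
Qed.

(** If $v<u$, then $(v/u)^{2^k}$ tends to 0 and cannot stay above a positive constant. The factors
    [e] and [D] are lost in the $2^k$-th root. *)
Lemma le_of_powers u v e D : 0 <= u -> 0 <= v -> 0 < e ->
  (forall k, u ^+ (2 ^ k) * e <= v ^+ (2 ^ k) * D) -> u <= v.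
Proof.
move=> u0 v0 e0 h; rewrite leNgt; apply/negP => vu.
have u_gt0 : 0 < u by exact: le_lt_trans vu.
have D0 : 0 <= `|D| + 1 by rewrite addr_ge0.
have Dgt : 0 < `|D| + 1 by rewrite ltr_wpDl.
have [N hN] := @geometric_small (v / u) (e / (`|D| + 1))
  (divr_ge0 v0 u0) (ltac:(by rewrite ltr_pdivrMr// mul1r)) (divr_gt0 e0 Dgt).
have /hN : (N <= 2 ^ N)%N by rewrite ltnW// ltn_expl.
rewrite expr_div_n ltr_pdivlMr// mulrAC ltr_pdivrMr ?exprn_gt0//.
rewrite [e * _]mulrC ltNge => /negP; apply; apply: (le_trans (h N)).
rewrite ler_wpM2l ?exprn_ge0//.
by rewrite (le_trans (ler_norm _))// lerDl.
Qed.

End RealPowers.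

Section Bounds.
Variables (R : realType) (A : vonNeumannAlgebra R) (Phi : {scalar A}).
Hypothesis st : faithful_normal_tracial_state Phi.
Implicit Types (a b c x : A) (z : R[i]) (K L : R).
Local Notation tr := (tr Phi).
Local Notation nrm := (nrm Phi).
Local Notation opb := (opb Phi).

(** Right multiplication by [a] is left multiplication by [star a] conjugated by the isometry
    [star]. *)
Lemma opb_lr K a : 0 <= K -> (forall b, nrm (a * b) <= K * nrm b) ->
  (forall b, nrm (star a * b) <= K * nrm b) -> opb K a.
Proof.
move=> K0 h1 h2; split=> // b; split=> //.
by rewrite -(nrm_star st (b * a)) starM -(nrm_star st b).
Qed.

Lemma opb_projection p : projection p -> opb 1 p.
Proof.
move=> [sp pp]; have h b : nrm (p * b) <= 1 * nrm b.
  rewrite mul1r; have [|pb] := leP (nrm (p * b)) 0.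
    by move=> /le_trans; apply; exact: nrm_ge0.
  rewrite -(ler_pM2r pb) -expr2 nrm_sqr// l2E.
  have -> : ip Phi (p * b) (p * b) = ip Phi b (p * b).
    by rewrite /ip starM sp -!mulrA (mulrA p p) pp.
  exact: ip_le.
by apply: opb_lr => //; rewrite sp.
Qed.

(* Iterating Cauchy-Schwarz, |x b|^(2^k) |b| <= |b|^(2^k) |x^(2^k) b|, while the
   last factor is controlled by the trace of a power of [x]. *)
Lemma opb_moments K x : 0 <= K -> selfadjoint x ->
  (forall n, complex.Re (tr (x ^+ (2 * n))) <= K ^+ (2 * n)) -> opb K x.
Proof.
move=> K0 sx hx.
suff h b : nrm (x * b) <= K * nrm b by apply: opb_lr => //; rewrite sx.
have sxn n : star (x ^+ n) = x ^+ n by rewrite starX sx.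
have nx n : nrm (x ^+ n) <= K ^+ n.
  rewrite -(@ler_pXn2r _ 2) ?nnegrE ?nrm_ge0 ?exprn_ge0// nrm_sqr// l2E.
  by rewrite /ip sxn -exprD addnn -mul2n (le_trans (hx n))// -exprM mulnC.
(* By traciality $\|x^nb\|_2^2=\Phi(x^{2n}bb^\star)\le\|x^{2n}\|_2\|bb^\star\|_2$, hence this
   constant, which [le_of_powers] removes. *)
pose C := Num.sqrt (nrm (b * star b)).
have ipx n : nrm (x ^+ n * b) ^+ 2 = ip Phi b (x ^+ (2 * n) * b).
  by rewrite nrm_sqr// l2E /ip starM sxn -!mulrA (mulrA (x ^+ n)) -exprD addnn mul2n.
have f1 n : nrm (x ^+ n * b) <= K ^+ n * C.
  rewrite -(@ler_pXn2r _ 2) ?nnegrE ?nrm_ge0 ?mulr_ge0 ?exprn_ge0 ?sqrtr_ge0//.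
  rewrite ipx exprMn sqr_sqrtr ?nrm_ge0// /ip trC// -mulrA.
  rewrite (le_trans (ler_norm _))// (le_trans (Re_le_cmod _))//.
  rewrite (le_trans (tr_le st _ _))// ler_wpM2r ?nrm_ge0//.
  by rewrite (le_trans (nx _))// -exprM mulnC.
have f2 k : nrm (x * b) ^+ (2 ^ k) * nrm b <= nrm b ^+ (2 ^ k) * nrm (x ^+ (2 ^ k) * b).
  elim: k => [|k IH]; first by rewrite !expn0 !expr1 mulrC.
  have [|b0] := leP (nrm b) 0.
    move=> b0; rewrite (@nrm_eq0 _ _ _ st b) ?mulr0 ?nrm0// ?mulr0//.
    by apply/eqP; rewrite eq_le b0 nrm_ge0.
  rewrite expnSr !exprM -(ler_pM2r b0) -mulrA -expr2 -exprMn.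
  apply: (@le_trans _ _ ((nrm b ^+ (2 ^ k) * nrm (x ^+ (2 ^ k) * b)) ^+ 2)).
    by rewrite ler_pXn2r// nnegrE mulr_ge0 ?exprn_ge0 ?nrm_ge0.
  rewrite exprMn -[leRHS]mulrA ler_wpM2l ?exprn_ge0 ?nrm_ge0// ipx [leRHS]mulrC.
  by rewrite -exprM (mulnC (2 ^ k)%N 2); exact: ip_le.
have [|b0] := leP (nrm b) 0.
  move=> b0; rewrite (@nrm_eq0 _ _ _ st b) ?mulr0 ?nrm0 ?mulr0//.
  by apply/eqP; rewrite eq_le b0 nrm_ge0.
apply: (@le_of_powers _ _ _ (nrm b) C) => [|||k]; rewrite ?mulr_ge0 ?nrm_ge0//.
rewrite (le_trans (f2 k))// exprMn [K ^+ _ * _]mulrC -mulrA.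
by rewrite ler_wpM2l ?exprn_ge0 ?nrm_ge0.
Qed.

End Bounds.

(** * Subalgebras and freeness *)

Section Subalgebras.
Variables (R : realType) (A : vonNeumannAlgebra R) (S : set A).
Hypothesis hS : unital_star_subalgebra S.

Lemma usa_add a b : S a -> S b -> S (a + b).
Proof. by move=> ha hb; rewrite -[a]scale1r; exact: usa_lin. Qed.

Lemma usa_0 : S 0.
Proof.
have := usa_lin hS (-1) (usa_1 hS) (usa_1 hS).
by rewrite scaleN1r addNr.
Qed.

Lemma usa_scale z a : S a -> S (z *: a).
Proof. by move=> ha; rewrite -[_ *: _]addr0; apply: usa_lin => //; exact: usa_0. Qed.

Lemma usa_opp a : S a -> S (- a).
Proof. by move=> ha; rewrite -scaleN1r; exact: usa_scale. Qed.

Lemma usa_sub a b : S a -> S b -> S (a - b).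
Proof. by move=> ha hb; apply: usa_add => //; exact: usa_opp. Qed.

End Subalgebras.

Section Freeness.
Variables (R : realType) (A : vonNeumannAlgebra R) (Phi : {scalar A}).
Hypothesis st : faithful_normal_tracial_state Phi.
Local Notation tr := (tr Phi).

Lemma sub_generated (S : set A) a : S a -> generated_star_algebra S a.
Proof. by move=> Sa B [_ SB]; exact: SB. Qed.

Lemma generated_usa (S : set A) : unital_star_subalgebra (generated_star_algebra S).
Proof.
split.
- by move=> B [hB _]; exact: usa_1.
- by move=> c a b ha hb B hB; apply: (usa_lin hB.1); [exact: ha|exact: hb].
- by move=> a b ha hb B hB; apply: (usa_mul hB.1); [exact: ha|exact: hb].
- by move=> a ha B hB; apply: (usa_star hB.1); exact: ha.
Qed.

Variables (x : A) (S : set A).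
Hypothesis hS : unital_star_subalgebra S.
Hypothesis hfree : free_from Phi [set x] S.
Local Notation gen := (generated_star_algebra [set x]).

Let genx : gen x. Proof. exact: sub_generated. Qed.

Lemma free_word2 g f : gen g -> S f -> tr g = 0 -> tr f = 0 -> tr (g * f) = 0.
Proof.
move=> hg hf g0 f0; have := hfree (w := [:: (true, g); (false, f)]).
rewrite big_cons big_seq1; apply=> // p.
rewrite !inE => /orP[/eqP->|/eqP->] //=; split=> //.
exact: sub_generated.
Qed.

Lemma free_word4 g f g' f' : gen g -> S f -> gen g' -> S f' ->
  tr g = 0 -> tr f = 0 -> tr g' = 0 -> tr f' = 0 ->
  tr (g * f * g' * f') = 0.
Proof.
move=> hg hf hg' hf' g0 f0 g'0 f'0.
have := hfree (w := [:: (true, g); (false, f); (true, g'); (false, f')]).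
rewrite !big_cons big_nil mulr1 !mulrA; apply=> // p.
by rewrite !inE => /or4P[] /eqP-> /=; split=> //; exact: sub_generated.
Qed.

Lemma tr_center a : tr (a - (tr a) *: 1) = 0.
Proof. by rewrite trB trZ tr1// mulr1 subrr. Qed.

(** Freeness speaks of centred words only: centre both factors and expand. *)
Lemma free_mul g f : gen g -> S f -> tr (g * f) = tr g * tr f.
Proof.
move=> hg hf.
have e : tr ((g - tr g *: 1) * (f - tr f *: 1)) = 0.
  apply: free_word2; rewrite ?tr_center//.
    by apply: (usa_sub (@generated_usa _)) => //; apply: (usa_scale (@generated_usa _)); exact: usa_1 (generated_usa _).
  by apply: (usa_sub hS) => //; apply: (usa_scale hS); exact: usa_1.
move: e; rewrite mulrBl !mulrBr -!scalerAl -!scalerAr !mul1r !mulr1.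
rewrite !trB !trZ tr1// => e.
by apply/eqP; rewrite -subr_eq0; apply/eqP; rewrite -[RHS]e; ring.
Qed.

(** The source of the second order terms. Centring [a] and [b] makes the word alternating and
    centred; each correction brings the two copies of [x] together, up to cyclicity, and is
    evaluated by [free_mul]. *)
Lemma free_sandwich a b : tr x = 0 -> S a -> S b ->
  tr (x * a * x * b) = tr (x * x) * tr a * tr b.
Proof.
move=> x0 ha hb.
have hc c : S c -> S (c - tr c *: 1).
  by move=> hc; apply: (usa_sub hS) => //; apply: (usa_scale hS); exact: usa_1.
have e := free_word4 genx (hc _ ha) genx (hc _ hb) x0 (tr_center _) x0 (tr_center _).
have gxx : gen (x * x) by apply: (usa_mul (@generated_usa _)).
have e1 : tr (x * a * x) = tr (x * x) * tr a by rewrite trC// mulrA free_mul.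
have e2 : tr (x * x * b) = tr (x * x) * tr b by exact: free_mul.
rewrite !(mulrBl, mulrBr) -?scalerAr -?scalerAl !mulr1 -?scalerAr -?scalerAl in e.
rewrite !trB !trZ e1 e2 in e.
by apply/eqP; rewrite -subr_eq0; apply/eqP; rewrite -[RHS]e; ring.
Qed.

End Freeness.

(** * Moments of the semicircle density *)

Section Calculus.
Variable R : realType.
Implicit Types (f F : R -> R) (a b v : R).
Local Notation leb := (@lebesgue_measure R).

Lemma continuous_itv_integrable f a b : continuous f ->
  leb.-integrable `[a, b] (EFin \o f).
Proof.
move=> cf; apply: continuous_compact_integrable; first exact: segment_compact.
exact: continuous_subspaceT.
Qed.

(** The derivative is requested in the open interval only, since the square root is not
    differentiable at the edges of the semicircle. *)
Lemma Rintegral_FTC f F a b : a < b -> continuous f -> continuous F ->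
  (forall x, a < x < b -> is_derive x 1 F (f x)) ->
  \int[leb]_(x in `[a, b]) f x = F b - F a.
Proof.
move=> ab cf cF dF; rewrite /Rintegral (@continuous_FTC2 _ f F)//.
- exact: continuous_subspaceT.
- split.
  + by move=> x; rewrite in_itv /= => /dF[].
  + by apply: cvg_at_right_filter; exact: cF.
  + by apply: cvg_at_left_filter; exact: cF.
- move=> x; rewrite in_itv /= => /dF[dx <-].
  by rewrite derive1E.
Qed.

Definition sc_density v x : R := Num.sqrt (4 * v - x ^+ 2) / (2 * pi * v).
Definition sc_moment v n : R :=
  \int[leb]_(x in `[- (2 * Num.sqrt v), 2 * Num.sqrt v]) (x ^+ n * sc_density v x).

Lemma sc_sqrt_continuous v : continuous (fun x : R => Num.sqrt (4 * v - x ^+ 2)).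
Proof.
move=> x; apply: (continuous_comp (f := fun x : R => 4 * v - x ^+ 2)); last exact: sqrt_continuous.
by apply: cvgB; [exact: cvg_cst|exact: exprn_continuous].
Qed.

Lemma sc_integrand_continuous v n : continuous (fun x : R => x ^+ n * sc_density v x).
Proof.
move=> x; apply: cvgM; first exact: exprn_continuous.
by apply: cvgM; [exact: sc_sqrt_continuous|exact: cvg_cst].
Qed.

Lemma is_derive_congr f F (x a b : R) : is_derive x 1 f a -> f =1 F -> a = b ->
  is_derive x 1 F b.
Proof. by move=> fa /funext <- <-. Qed.

(** Up to a constant the function is $(4v-x^2)^{3/2}$, written without a fractional power. It
    supplies the antiderivatives for the first two moments. *)
Lemma sc_density_derive v x : 0 < v -> - (2 * Num.sqrt v) < x < 2 * Num.sqrt v ->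
  is_derive x 1 (fun y : R => (4 * v - y ^+ 2) * sc_density v y)
    (- 3 * (x * sc_density v x)).
Proof.
move=> v0 /andP[x1 x2].
have u0 : 0 < 4 * v - x ^+ 2.
  have sv : Num.sqrt v ^+ 2 = v by rewrite sqr_sqrtr// ltW.
  rewrite -{1}sv (_ : _ - _ = (2 * Num.sqrt v - x) * (2 * Num.sqrt v + x)); last by ring.
  by rewrite mulr_gt0//; lra.
have du := is_deriveB (is_derive_cst (4 * v) x 1) (is_deriveX 2 (is_derive_id x 1)).
have ds := @is_derive1_comp R Num.sqrt (cst (4 * v) - (@id R) ^+ 2) x _ _ (is_derive1_sqrt u0) du.
have q0 : Num.sqrt (4 * v - x ^+ 2) != 0 by rewrite sqrtr_eq0 -ltNge.
have sq : Num.sqrt (4 * v - x ^+ 2) ^+ 2 = 4 * v - x ^+ 2 by rewrite sqr_sqrtr// ltW.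
have p0 := @pi_gt0 R.
apply: (is_derive_congr (is_deriveM du (is_deriveM ds (is_derive_cst (2 * pi * v)^-1 x 1)))) => //=.
rewrite /sc_density /GRing.scale /=.
move: q0 sq; set S := Num.sqrt (4 * v - x ^+ 2); set c := (2 * pi * v)^-1 => q0 sq.
(* Replacing $4v-x^2$ by $S^2$ leaves a rational identity in [S]. *)
transitivity (S ^+ 2 * (S * 0 + c * ((2 * S)^-1 * (0 - 2 * x * 1)))
  + S * c * (0 - 2 * x * 1)); first by rewrite sq.
by field.
Qed.

Lemma sc_moment1 v : 0 < v -> sc_moment v 1 = 0.
Proof.
move=> v0; have s0 : 0 < Num.sqrt v by rewrite sqrtr_gt0.
(* Antiderivative of $x$ times the density, by [sc_density_derive]; it takes the same value at both
   edges. *)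
pose F x := - (3^-1) * ((4 * v - x ^+ 2) * sc_density v x).
have cF : continuous F.
  move=> x; apply: cvgM; first exact: cvg_cst.
  apply: cvgM; first by apply: cvgB; [exact: cvg_cst|exact: exprn_continuous].
  by apply: cvgM; [exact: sc_sqrt_continuous|exact: cvg_cst].
transitivity (F (2 * Num.sqrt v) - F (- (2 * Num.sqrt v))); last first.
  by rewrite /F sqrrN exprMn sqr_sqrtr ?ltW//; ring.
apply: Rintegral_FTC; [by lra|exact: sc_integrand_continuous|exact: cF|].
move=> x hx.
apply: (is_derive_congr (is_deriveZ (- (3^-1)) (sc_density_derive v0 hx))) => //.
by rewrite /GRing.scale /=; field.
Qed.

(* Integrates the derivative of [x (4 v - x^2)^(3/2)]. *)
Lemma sc_moment2 v : 0 < v -> sc_moment v 2 = v * sc_moment v 0.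
Proof.
move=> v0; have s0 : 0 < Num.sqrt v by rewrite sqrtr_gt0.
have aux (x y : R) : 4 * v * x - 4 * y = 0 -> y = v * x by lra.
pose F x := x * ((4 * v - x ^+ 2) * sc_density v x).
have cF : continuous F.
  move=> x; apply: cvgM; first exact: cvg_id.
  apply: cvgM; first by apply: cvgB; [exact: cvg_cst|exact: exprn_continuous].
  by apply: cvgM; [exact: sc_sqrt_continuous|exact: cvg_cst].
pose r := 2 * Num.sqrt v.
have ci n c : leb.-integrable `[- r, r] (EFin \o (fun x : R => c * (x ^+ n * sc_density v x))).
  apply: continuous_itv_integrable => x.
  by apply: cvgM; [exact: cvg_cst|exact: sc_integrand_continuous].
have ci1 n : leb.-integrable `[- r, r] (EFin \o (fun x : R => x ^+ n * sc_density v x)).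
  by apply: continuous_itv_integrable; exact: sc_integrand_continuous.
(* With $\rho$ the density, the derivative of [F] is $(4v-x^2)\rho-3x^2\rho$, and [F] vanishes at
   both edges. *)
have : \int[leb]_(x in `[- r, r]) (4 * v * (x ^+ 0 * sc_density v x)
    - 4 * (x ^+ 2 * sc_density v x)) = 0.
  transitivity (F r - F (- r)); last first.
    by rewrite /F /r sqrrN exprMn sqr_sqrtr ?ltW//; ring.
  apply: Rintegral_FTC; [by rewrite /r; lra| |exact: cF|].
    move=> x; apply: cvgB; (apply: cvgM; first exact: cvg_cst);
      exact: sc_integrand_continuous.
  move=> x hx.
  apply: (is_derive_congr (is_deriveM (is_derive_id x 1) (sc_density_derive v0 hx))) => //.
  by rewrite /GRing.scale /=; ring.
rewrite (RintegralB _ (ci 0%N (4 * v)) (ci 2%N 4))//.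
rewrite (@RintegralZl _ _ _ leb _ _ (4 * v) _ (ci1 0%N))//.
rewrite (@RintegralZl _ _ _ leb _ _ 4 _ (ci1 2%N))//.
exact: aux.
Qed.

(** On the support $x^2\le4v$. This crude estimate already yields the sharp operator bound $2\sqrt
    v$ through [opb_moments]. *)
Lemma sc_moment_even v n : 0 < v -> sc_moment v (2 * n) <= (4 * v) ^+ n * sc_moment v 0.
Proof.
move=> v0; pose r := 2 * Num.sqrt v.
have ci m : leb.-integrable `[- r, r] (EFin \o (fun x : R => x ^+ m * sc_density v x)).
  by apply: continuous_itv_integrable; exact: sc_integrand_continuous.
rewrite -(@RintegralZl _ _ _ leb _ _ ((4 * v) ^+ n) _ (ci 0%N))//.
apply: le_Rintegral => //.
  apply: continuous_itv_integrable => x.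
  by apply: cvgM; [exact: cvg_cst|exact: sc_integrand_continuous].
move=> x /=; rewrite in_itv /= => /andP[x1 x2].
have p0 := @pi_gt0 R.
rewrite expr0 mul1r ler_wpM2r//.
  by rewrite /sc_density divr_ge0 ?sqrtr_ge0// !mulr_ge0// ltW.
rewrite exprM; apply: lerXn2r; rewrite ?nnegrE ?sqr_ge0 ?mulr_ge0 ?(ltW v0)//.
have sv : Num.sqrt v ^+ 2 = v by rewrite sqr_sqrtr// ltW.
rewrite -subr_ge0 -{1}sv (_ : _ - _ = (2 * Num.sqrt v - x) * (2 * Num.sqrt v + x)); last by ring.
by rewrite mulr_ge0//; lra.
Qed.

End Calculus.

(** * Semicircular elements *)

Section Semicircular.
Variables (R : realType) (A : vonNeumannAlgebra R) (Phi : {scalar A}).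
Hypothesis st : faithful_normal_tracial_state Phi.
Variables (v : R) (a : A).
Hypotheses (v0 : 0 < v) (ha : semicircular Phi v a).

Lemma sc_tr n : tr Phi (a ^+ n) = (sc_moment v n)%:C.
Proof. exact: ha.2. Qed.

(** The area under the semicircle is never computed: it is the moment of order 0, that is $\Phi(1)$.
    The other moments are therefore related to this one only. *)
Lemma sc_mass : sc_moment v 0 = 1.
Proof. by apply: complexI; rewrite -sc_tr expr0 tr1. Qed.

Lemma sc_mean : tr Phi a = 0.
Proof. by rewrite -[a]expr1 sc_tr sc_moment1. Qed.

Lemma sc_variance : tr Phi (a * a) = v%:C.
Proof. by rewrite -expr2 sc_tr sc_moment2// sc_mass mulr1. Qed.

Lemma sc_opb : opb Phi (2 * Num.sqrt v) a.
Proof.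
apply: opb_moments => //; [exact: ha.1|] => n.
rewrite sc_tr /= (le_trans (sc_moment_even n v0))// sc_mass mulr1 exprM.
by rewrite (_ : (2 * Num.sqrt v) ^+ 2 = 4 * v)// exprMn sqr_sqrtr ?ltW//; ring.
Qed.

End Semicircular.

(** * Stochastic and time integrals *)

Section StepFunctions.
Variable R : realType.
Implicit Types (a b c s T : R) (L : seq (R * R * R)).
Local Notation leb := (@lebesgue_measure R).

Definition ind a b s : R := (a <= s < b)%R%:R.

Lemma indM a b c d s :
  ind a b s * ind c d s = ind (Order.max a c) (Order.min b d) s.
Proof.
by rewrite /ind -natrM mulnb ge_max lt_min; congr (_%:R); do 4 case: (_ <= _) || case: (_ < _).
Qed.

Definition steps L s : R := \sum_(p <- L) p.2 * ind p.1.1 p.1.2 s.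
(** The maximum with 0 handles reversed endpoints, which [indM] produces for disjoint intervals. *)
Definition steps_mass L : R := \sum_(p <- L) p.2 * Order.max 0 (p.1.2 - p.1.1).

Lemma indE a b : ind a b = \1_(`[a, b[%classic).
Proof.
by apply/funext => s; rewrite /ind indicE mem_setE in_itv.
Qed.

Lemma measurable_ind (D : set (measurableTypeR R)) a b :
  measurable_fun D (ind a b : measurableTypeR R -> R).
Proof. by rewrite indE; exact: measurable_indic. Qed.

Lemma steps_integral T L : (forall p, p \in L -> 0 <= p.1.1 /\ p.1.2 <= T) ->
  leb.-integrable `[0, T] (EFin \o steps L) /\
  (\int[leb]_(s in `[0%R, T]) (steps L s)%:E = (steps_mass L)%:E)%E.
Proof.
elim: L => [|[[a b] c] L IH] hL.
  rewrite (_ : steps [::] = cst 0); last by apply/funext => s; rewrite /steps big_nil.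
  split; first exact: integrable0.
  by rewrite integral0_eq// /steps_mass big_nil.
have [i1 e1] : leb.-integrable `[0, T] (EFin \o steps L) /\
  (\int[leb]_(s in `[0%R, T]) (steps L s)%:E = (steps_mass L)%:E)%E.
  by apply: IH => p pL; apply: hL; rewrite inE pL orbT.
have [/= a0 bT] := hL (a, b, c) (mem_head _ _).
have ifin : leb.-integrable `[0, T] (EFin \o ind a b).
  apply: measurable_bounded_integrable => //.
  - by rewrite /= lebesgue_measure_itv /=; case: ifP => // _; rewrite -EFinD ltry.
  - exact: measurable_ind.
  - exists 1; split=> // M M1 x _ /=; rewrite /ind ger0_norm// ltW//.
    by rewrite (le_lt_trans _ M1)// lern1 leq_b1.
have ie : (\int[leb]_(s in `[0%R, T]) (ind a b s)%:E = (Order.max 0 (b - a))%:E)%E.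
  under eq_integral do rewrite indE.
  rewrite integral_indic//= (_ : _ `&` _ = `[a, b[%classic).
    rewrite lebesgue_measure_itv /= lte_fin; case: ifP => ab.
      by rewrite -EFinB max_r// subr_ge0 ltW.
    by rewrite max_l// subr_le0 leNgt ab.
  apply/seteqP; split=> x /=; rewrite !in_itv /=; first by case.
  move=> /andP[ax xb]; split; first exact/andP.
  by rewrite (le_trans a0 ax) (le_trans (ltW xb)).
have E : EFin \o steps ((a, b, c) :: L) = ((fun s => c%:E * (ind a b s)%:E) \+ (EFin \o steps L))%E.
  by apply/funext => s /=; rewrite /steps big_cons /= EFinD EFinM.
have ic : leb.-integrable `[0, T] (fun s => c%:E * (ind a b s)%:E)%E by exact: integrableZl.
split; first by rewrite E; apply: integrableD.
rewrite (_ : (fun s => _) = EFin \o steps ((a, b, c) :: L))// E integralD//=.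
by rewrite e1 integralZl// ie /steps_mass big_cons /= -EFinM -EFinD.
Qed.

End StepFunctions.

Section Elementary.
Variables (R : realType) (A : vonNeumannAlgebra R) (Phi : {scalar A}).
Hypothesis st : faithful_normal_tracial_state Phi.
Implicit Types (E : seq (R * R * A)) (T : R).
Local Notation tr := (tr Phi).
Local Notation nrm := (nrm Phi).
Local Notation ip := (ip Phi).
Local Notation l2 := (l2sq Phi).
Local Notation leb := (@lebesgue_measure R).

(** Intervals in the list may overlap, so sums and differences of step processes on different
    partitions are concatenations, without a common refinement. *)
Definition elem_eval E (s : R) : A := \sum_(p <- E) (ind p.1.1 p.1.2 s)%:C *: p.2.
Definition elem_dt E : A := \sum_(p <- E) (p.1.2 - p.1.1)%:C *: p.2.
Definition elem_dX (X : R -> A) E : A := \sum_(p <- E) (X p.1.2 - X p.1.1) * p.2.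
Definition elem_in T E :=
  forall p, p \in E -> [/\ 0 <= p.1.1, p.1.1 <= p.1.2 & p.1.2 <= T].

Lemma ip_sumr (I : Type) (s : seq I) (f : I -> A) a :
  ip a (\sum_(i <- s) f i) = \sum_(i <- s) ip a (f i).
Proof. by elim/big_ind2: _ => [|x ? y ? <- <-|//]; rewrite ?ip0r ?ipDr. Qed.

Lemma ip_suml (I : Type) (s : seq I) (f : I -> A) a :
  ip (\sum_(i <- s) f i) a = \sum_(i <- s) ip (f i) a.
Proof. by rewrite ipC// ip_sumr; apply: eq_bigr => i _; rewrite ipC. Qed.

(** The squared $L^2$ norm of an elementary process is again a step function, with the pairwise
    intersections as intervals and the inner products as values. *)
Definition gram E : seq (R * R * R) :=
  [seq (Order.max p.1.1 q.1.1, Order.min p.1.2 q.1.2, ip p.2 q.2) | p <- E, q <- E].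

Lemma l2_elem_eval E s : l2 (elem_eval E s) = steps (gram E) s.
Proof.
rewrite l2E ip_suml /steps big_allpairs_dep; apply: eq_bigr => p _.
rewrite ip_sumr; apply: eq_bigr => q _ /=.
by rewrite ipZl// ipZr mulrA indM mulrC.
Qed.

Lemma gram_in T E : elem_in T E ->
  forall p, p \in gram E -> 0 <= p.1.1 /\ p.1.2 <= T.
Proof.
move=> hE _ /allpairsP[[p q] [/= /hE[p0 _ pT] /hE[q0 _ qT] ->]] /=.
by split; [rewrite le_max p0|rewrite ge_min pT].
Qed.

(* Duality replaces a common refinement of the intervals: pair the integral
   with itself. *)
Lemma nrm_elem_dt T E (g : R -> R) : elem_in T E ->
  measurable_fun (`[0, T] : set (measurableTypeR R)) g ->
  (forall s, 0 <= s <= T -> nrm (elem_eval E s) <= g s) ->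
  ((nrm (elem_dt E))%:E <= \int[leb]_(s in `[0%R, T]) (g s)%:E)%E.
Proof.
move=> hE mg hg; set z := elem_dt E.
(* [steps L] is $s\mapsto\langle z,E(s)\rangle$ and has integral $\|z\|^2$; Cauchy-Schwarz under the
   integral and division by $\|z\|$ conclude. *)
pose L := [seq (p.1.1, p.1.2, ip z p.2) | p <- E].
have hL p : p \in L -> 0 <= p.1.1 /\ p.1.2 <= T.
  by move=> /mapP[q /hE[? ? ?] ->].
have [iL eL] := steps_integral hL.
have g0 s : `[0, T]%classic s -> 0 <= g s.
  by rewrite /= in_itv => /hg; apply: le_trans; exact: nrm_ge0.
have [z0|z0] := leP (nrm z) 0.
  rewrite (@le_trans _ _ 0%E)//.
  by apply: integral_ge0 => s /g0.
have ez : steps_mass L = nrm z * nrm z.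
  rewrite -expr2 nrm_sqr// l2E {2}/z ip_sumr /steps_mass big_map big_seq [RHS]big_seq.
  apply: eq_bigr => p /hE[? ? ?] /=.
  by rewrite ipZr mulrC max_r// subr_ge0.
rewrite -(@lee_pmul2l _ (nrm z)%:E) ?lte_fin//.
rewrite -EFinM -ez -ge0_integralZl//=; last 2 first.
- exact/measurable_EFinP.
- by rewrite lee_fin ltW.
rewrite -eL (le_trans (lee_abs _))//.
have mL : measurable_fun (`[0, T] : set (measurableTypeR R)) (EFin \o steps L).
  exact: measurable_int iL.
rewrite (le_trans (le_abse_integral _ _ mL))//.
apply: ge0_le_integral => //.
- exact: measurableT_comp.
- by apply/measurable_EFinP; exact: measurable_funM.
move=> s; rewrite /= in_itv /= => hs; rewrite lee_fin.
apply: (@le_trans _ _ (nrm z * nrm (elem_eval E s))); last first.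
  by rewrite ler_wpM2l ?nrm_ge0// hg.
rewrite (_ : steps L s = ip z (elem_eval E s)); first exact: ip_abs_le.
by rewrite /steps big_map ip_sumr; apply: eq_bigr => p _; rewrite /= ipZr mulrC.
Qed.

Variables (F : R -> set A) (X : R -> A).
Hypothesis hF : filtration F.
Hypothesis hX : free_brownian_motion Phi F X.

Let Fusa t : 0 <= t -> unital_star_subalgebra (F t).
Proof. exact: filt_algebra. Qed.

Lemma bm_incr_selfadjoint a b : 0 <= a -> a <= b -> star (X b - X a) = X b - X a.
Proof.
move=> a0 ab; rewrite starB !(fbm_selfadjoint hX)//; exact: le_trans ab.
Qed.

Lemma bm_incr_adapted a b : 0 <= a -> a <= b -> F b (X b - X a).
Proof.
move=> a0 ab; have b0 := le_trans a0 ab; apply: (usa_sub (Fusa b0)).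
  exact: (fbm_adapted hX).
by apply: (filt_mono hF a0 ab); exact: (fbm_adapted hX).
Qed.

Lemma bm_mean a b u : 0 <= a -> a <= b -> F a u -> tr ((X b - X a) * u) = 0.
Proof.
move=> a0; rewrite le_eqVlt => /predU1P[->|ab] Fu; first by rewrite subrr mul0r tr0.
have hfr := fbm_free hX a0 ab.
have sc := fbm_semicircular hX a0 ab.
have ba : 0 < b - a by rewrite subr_gt0.
have gX := @sub_generated _ _ [set X b - X a] (X b - X a) erefl.
by rewrite (free_mul st (Fusa a0) hfr)// (sc_mean ba sc) mul0r.
Qed.

Lemma bm_variance a b u : 0 <= a -> a <= b -> F a u ->
  tr ((X b - X a) * (X b - X a) * u) = (b - a)%:C * tr u.
Proof.
move=> a0; rewrite le_eqVlt => /predU1P[->|ab] Fu.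
  by rewrite !subrr rmorph0 !mul0r tr0.
have hfr := fbm_free hX a0 ab.
have gX := @sub_generated _ _ [set X b - X a] (X b - X a) erefl.
rewrite (free_mul st (Fusa a0) hfr)//; last by apply: (usa_mul (@generated_usa _ _ _)).
have sc := fbm_semicircular hX a0 ab.
have ba : 0 < b - a by rewrite subr_gt0.
by rewrite (sc_variance st ba sc).
Qed.

Lemma bm_sandwich a b u w : 0 <= a -> a <= b -> F a u -> F a w ->
  tr ((X b - X a) * u * (X b - X a) * w) = (b - a)%:C * tr u * tr w.
Proof.
move=> a0; rewrite le_eqVlt => /predU1P[->|ab] Fu Fw.
  by rewrite !subrr rmorph0 !mul0r tr0.
have hfr := fbm_free hX a0 ab.
have sc := fbm_semicircular hX a0 ab.
have ba : 0 < b - a by rewrite subr_gt0.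
rewrite (free_sandwich st (Fusa a0) hfr)//; last exact: (sc_mean ba sc).
by rewrite (sc_variance st ba sc).
Qed.

Lemma bm_opb a b : 0 <= a -> a <= b -> opb Phi (2 * Num.sqrt (b - a)) (X b - X a).
Proof.
move=> a0; rewrite le_eqVlt => /predU1P[->|ab].
  by rewrite !subrr sqrtr0 mulr0; exact: opb0.
have ba : 0 < b - a by rewrite subr_gt0.
exact: (sc_opb st ba (fbm_semicircular hX a0 ab)).
Qed.

(** Itô isometry for two increments. By symmetry let $a\le c$ and cut at $c$ and at the earlier of
    $b,d$: a piece lying after all the other factors has mean zero by freeness, and the common piece
    contributes its length. *)
Lemma bm_overlap a b c d v w : 0 <= a -> a <= b -> 0 <= c -> c <= d ->
  F a v -> F c w ->
  ip ((X b - X a) * v) ((X d - X c) * w) =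
  Order.max 0 (Order.min b d - Order.max a c) * ip v w.
Proof.
wlog ac : a b c d v w / a <= c.
  move=> h a0 ab c0 cd Fv Fw; have [ac|] := boolP (a <= c); first by apply: h.
  by rewrite -ltNge => /ltW ca; rewrite ipC// h// (ipC st w) (minC d) (maxC c).
move=> a0 ab c0 cd Fv Fw.
have Fcv : F c v by exact: (filt_mono hF a0 ac).
have Fwv : F c (w * star v) by apply: (usa_mul (Fusa c0)) => //; exact: (usa_star (Fusa c0)).
rewrite (max_r ac) /ip starM bm_incr_selfadjoint//.
(* An increment over $[p,q]$ with $q\le c$ belongs to $\mathscr A_c$, from which $X_d-X_c$ is
   free. *)
have orth p q : 0 <= p -> p <= q -> q <= c ->
    tr (star v * (X q - X p) * ((X d - X c) * w)) = 0.
  move=> p0 pq qc; rewrite trC// -!mulrA bm_mean// mulrA.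
  apply: (usa_mul (Fusa c0)) => //.
  by apply: (filt_mono hF (le_trans p0 pq) qc); exact: bm_incr_adapted.
have [bc|/ltW cb] := leP b c.
  rewrite orth// max_l ?mul0r// subr_le0 (le_trans _ bc)//.
  by rewrite ge_min lexx.
rewrite (_ : X b - X a = (X c - X a) + (X b - X c)); last by rewrite [RHS]addrC subrKA.
rewrite mulrDr mulrDl trD orth// add0r max_r; last by rewrite subr_ge0 le_min cb.
have sq p : c <= p ->
    tr (star v * (X p - X c) * ((X p - X c) * w)) = (p - c)%:C * tr (star v * w).
  move=> cp; rewrite -!mulrA trC// -!mulrA [w * star v]lock.
  by rewrite mulrA -lock bm_variance// (trC st w).
have [bd|/ltW db] := leP b d.
  have b0 := le_trans c0 cb.
  rewrite (_ : X d - X c = (X b - X c) + (X d - X b)); last by rewrite [RHS]addrC subrKA.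
  rewrite (mulrDl _ _ w) mulrDr trD sq//.
  rewrite (trC st _ ((X d - X b) * w)) -mulrA bm_mean// ?addr0 ?ReZ//.
  rewrite mulrA; apply: (usa_mul (Fusa b0)); last exact: bm_incr_adapted.
  exact: (filt_mono hF c0 cb).
have d0 := le_trans c0 cd.
rewrite (_ : X b - X c = (X d - X c) + (X b - X d)); last by rewrite [RHS]addrC subrKA.
rewrite (mulrDr (star v)) mulrDl trD sq// -(mulrA (star v)).
rewrite (trC st (star v) ((X b - X d) * _)) -mulrA bm_mean// ?addr0 ?ReZ//.
rewrite -mulrA; apply: (usa_mul (Fusa d0)); first exact: bm_incr_adapted.
exact: (filt_mono hF c0 cd).
Qed.

End Elementary.

(** * Isometry and martingale property for elementary processes *)

Section StepProcesses.
Variables (R : realType) (A : vonNeumannAlgebra R) (Phi : {scalar A}).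
Hypothesis st : faithful_normal_tracial_state Phi.
Variables (F : R -> set A) (X : R -> A).
Hypothesis hF : filtration F.
Hypothesis hX : free_brownian_motion Phi F X.
Implicit Types (E : seq (R * R * A)) (T : R).
Local Notation tr := (tr Phi).
Local Notation nrm := (nrm Phi).
Local Notation ip := (ip Phi).
Local Notation l2 := (l2sq Phi).
Local Notation leb := (@lebesgue_measure R).

Definition elem_adapted E := forall p, p \in E -> F p.1.1 p.2.

(** Pair by pair, [bm_overlap] produces exactly the length of the intersection recorded in
    [gram]. *)
Lemma l2_elem_dX T E : elem_in T E -> elem_adapted E ->
  l2 (elem_dX X E) = steps_mass (gram Phi E).
Proof.
move=> hE aE; rewrite l2E ip_suml// /steps_mass big_allpairs_dep.
rewrite big_seq [RHS]big_seq; apply: eq_bigr => p pE.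
rewrite ip_sumr// big_seq [RHS]big_seq; apply: eq_bigr => q qE /=.
have [p0 pp pT] := hE _ pE; have [q0 qq qT] := hE _ qE.
by rewrite (bm_overlap st hF hX)//; [exact: mulrC|exact: aE|exact: aE].
Qed.

(** A measurable majorant [g] appears because later bounds involve the limit process $Y$, through
    distances whose measurability is part of the definition of the integrals. *)
Lemma l2_elem_dX_le T E (g : R -> R) : elem_in T E -> elem_adapted E ->
  measurable_fun (`[0, T] : set (measurableTypeR R)) g ->
  (forall s, 0 <= s <= T -> l2 (elem_eval E s) <= g s) ->
  ((l2 (elem_dX X E))%:E <= \int[leb]_(s in `[0%R, T]) (g s)%:E)%E.
Proof.
move=> hE aE mg hg; rewrite (l2_elem_dX hE aE).
have [iL <-] := steps_integral (gram_in (Phi := Phi) hE).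
apply: ge0_le_integral => //.
- by move=> s _; rewrite lee_fin -l2_elem_eval// l2_ge0.
- exact: measurable_int iL.
- exact/measurable_EFinP.
- by move=> s; rewrite /= in_itv /= => hs; rewrite lee_fin -l2_elem_eval// hg.
Qed.

Definition elem_opp E : seq (R * R * A) := [seq (p.1.1, p.1.2, - p.2) | p <- E].
Definition elem_after (s : R) E : seq (R * R * A) :=
  [seq (Order.max p.1.1 s, Order.max p.1.2 s, p.2) | p <- E].

Lemma elem_eval_cat E1 E2 u : elem_eval (E1 ++ E2) u = elem_eval E1 u + elem_eval E2 u.
Proof. by rewrite /elem_eval big_cat. Qed.

Lemma elem_dX_cat E1 E2 : elem_dX X (E1 ++ E2) = elem_dX X E1 + elem_dX X E2.
Proof. by rewrite /elem_dX big_cat. Qed.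

Lemma elem_dt_cat E1 E2 : elem_dt (E1 ++ E2) = elem_dt E1 + elem_dt E2.
Proof. by rewrite /elem_dt big_cat. Qed.

Lemma elem_eval_opp E u : elem_eval (elem_opp E) u = - elem_eval E u.
Proof. by rewrite /elem_eval big_map -sumrN; apply: eq_bigr => p _; rewrite scalerN. Qed.

Lemma elem_dX_opp E : elem_dX X (elem_opp E) = - elem_dX X E.
Proof. by rewrite /elem_dX big_map -sumrN; apply: eq_bigr => p _; rewrite mulrN. Qed.

Lemma elem_dt_opp E : elem_dt (elem_opp E) = - elem_dt E.
Proof. by rewrite /elem_dt big_map -sumrN; apply: eq_bigr => p _; rewrite scalerN. Qed.

Lemma elem_eval_after s E u :
  elem_eval (elem_after s E) u = if s <= u then elem_eval E u else 0.
Proof.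
rewrite /elem_eval big_map; case: ifPn => su.
  apply: eq_bigr => p _ /=; congr (_%:C *: _).
  by rewrite /ind ge_max lt_max su andbT (ltNge u s) su orbF.
by apply: big1 => p _ /=; rewrite /ind ge_max (negbTE su) andbF scale0r.
Qed.

Lemma elem_eval_out T E u : elem_in T E -> T <= u -> elem_eval E u = 0.
Proof.
move=> hE Tu; rewrite /elem_eval big_seq big1// => p /hE[_ _ pT].
by rewrite /ind (ltNge u) (le_trans pT Tu) andbF scale0r.
Qed.

Lemma elem_in_opp T E : elem_in T E -> elem_in T (elem_opp E).
Proof. by move=> hE p /mapP[q /hE[? ? ?] ->]. Qed.

Lemma elem_in_cat T E1 E2 : elem_in T E1 -> elem_in T E2 -> elem_in T (E1 ++ E2).
Proof. by move=> h1 h2 p; rewrite mem_cat => /orP[/h1|/h2]. Qed.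

Lemma elem_in_after T s E : 0 <= s -> s <= T -> elem_in T E -> elem_in T (elem_after s E).
Proof.
move=> s0 sT hE p /mapP[q /hE[q0 qq qT] ->] /=.
split; first by rewrite le_max q0.
  by rewrite ge_max !le_max qq lexx orbT.
by rewrite ge_max qT.
Qed.

Lemma elem_inW S T E : S <= T -> elem_in S E -> elem_in T E.
Proof. by move=> ST hE p /hE[? ? pS]; split=> //; exact: le_trans ST. Qed.

Lemma elem_adapted_opp T E : elem_in T E -> elem_adapted E -> elem_adapted (elem_opp E).
Proof.
move=> hE aE p /mapP[q qE ->] /=; apply: usa_opp; last exact: aE.
by apply: filt_algebra => //; case: (hE _ qE).
Qed.

Lemma elem_adapted_cat E1 E2 : elem_adapted E1 -> elem_adapted E2 -> elem_adapted (E1 ++ E2).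
Proof. by move=> h1 h2 p; rewrite mem_cat => /orP[/h1|/h2]. Qed.

Lemma elem_adapted_after T s E : elem_in T E -> elem_adapted E -> elem_adapted (elem_after s E).
Proof.
move=> hE aE p /mapP[q qE ->] /=; have [q0 _ _] := hE _ qE.
by apply: (filt_mono hF q0) (aE _ qE); rewrite le_max lexx.
Qed.

(** After truncation each increment starts at a time that is at least $s$, where both its
    coefficient and [B] are adapted; [bm_mean] kills every term. *)
Lemma elem_dX_martingale T s E B : 0 <= s -> elem_in T E -> elem_adapted E -> F s B ->
  tr (elem_dX X (elem_after s E) * B) = 0.
Proof.
move=> s0 hE aE FB; rewrite /elem_dX big_map mulr_suml -[tr _]/(Phi _) raddf_sum big_seq.
apply: big1 => p pE /=; have [p0 pp _] := hE _ pE.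
rewrite -mulrA -/(tr _) (bm_mean st hF hX)//.
- by rewrite le_max p0.
- by rewrite ge_max !le_max pp lexx orbT.
have m0 : 0 <= Order.max p.1.1 s by rewrite le_max p0.
apply: (usa_mul (filt_algebra hF m0)).
  by apply: (filt_mono hF p0) (aE _ pE); rewrite le_max lexx.
by apply: (filt_mono hF s0) FB; rewrite le_max lexx orbT.
Qed.

Section OfStepProcess.
Variables (t : R) (V : step_process A t).

Definition elem_of : seq (R * R * A) :=
  [seq (step_knot V i, step_knot V i.+1, step_val V i) | i <- iota 0 (step_size V)].

Lemma elem_of_eval u : elem_eval elem_of u = step_eval V u.
Proof.
rewrite /elem_eval big_map /step_eval [RHS]big_mkcond /=.
rewrite -(big_mkord xpredT (fun i => if step_knot V i <= u < step_knot V i.+1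
  then step_val V i else 0)) /index_iota subn0.
by apply: eq_bigr => i _; rewrite /ind; case: ifP; rewrite ?scale1r ?scale0r.
Qed.

Lemma elem_of_dX : elem_dX X elem_of = step_dX_integral X V.
Proof.
rewrite /elem_dX big_map /step_dX_integral.
by rewrite -(big_mkord xpredT (fun i => (X (step_knot V i.+1) - X (step_knot V i))
  * step_val V i)) /index_iota subn0.
Qed.

Lemma elem_of_dt : elem_dt elem_of = step_time_integral V.
Proof.
rewrite /elem_dt big_map /step_time_integral.
by rewrite -(big_mkord xpredT (fun i => (step_knot V i.+1 - step_knot V i)%:C
  *: step_val V i)) /index_iota subn0.
Qed.

Lemma step_knot_homo i j : (i <= j)%N -> (j <= step_size V)%N ->
  step_knot V i <= step_knot V j.
Proof.
elim: j => [|j IH]; first by rewrite leqn0 => /eqP->.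
rewrite leq_eqVlt => /predU1P[->//|]; rewrite ltnS => ij jn.
by rewrite (le_trans (IH ij (ltnW jn)))// step_knot_le.
Qed.

Lemma elem_of_in : elem_in t elem_of.
Proof.
move=> p /mapP[i + ->]; rewrite mem_iota add0n => /= ni; split=> /=.
- by rewrite -(step_knot0 V) step_knot_homo// ltnW.
- exact: step_knot_le.
- by rewrite -{2}(step_knot_last V) step_knot_homo.
Qed.

Lemma elem_of_adapted : step_adapted F V -> elem_adapted elem_of.
Proof.
move=> aV p /mapP[i + ->]; rewrite mem_iota add0n => /= ni; exact: aV.
Qed.

End OfStepProcess.

End StepProcesses.

(** * A majorant assembled from estimates on both sides of a time *)

Section Gluing.
Variable R : realType.
Local Notation leb := (@lebesgue_measure R).

(** The integrals up to $t$ and up to $s$ come with unrelated approximations. Before $s$ both errors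
    [f1] and [f2] count; after $s$ there remain [f1] and a constant [k]. *)
Lemma glue_bound (s t k : R) (f1 f2 : R -> R) : 0 <= s -> s <= t -> 0 <= k ->
  (forall u, 0 <= f1 u) -> (forall u, 0 <= f2 u) ->
  measurable_fun (`[0, t] : set (measurableTypeR R)) f1 ->
  measurable_fun (`[0, s] : set (measurableTypeR R)) f2 ->
  exists g, [/\ measurable_fun (`[0, t] : set (measurableTypeR R)) g,
    forall u, 0 <= u -> u < s -> f1 u + f2 u <= g u,
    forall u, s <= u -> u <= t -> f1 u + k <= g u &
    (\int[leb]_(u in `[0%R, t]) (g u)%:E <=
     \int[leb]_(u in `[0%R, t]) (f1 u)%:E + \int[leb]_(u in `[0%R, s]) (f2 u)%:E
     + (k * (t - s))%:E)%E].
Proof.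
move=> s0 st k0 f10 f20 mf1 mf2.
pose f2' : R -> R := f2 \_ `[0, s].
pose k' : R -> R := fun u => k * \1_(`[s, t]%classic : set R) u.
have f2'0 u : 0 <= f2' u by rewrite /f2' patchE; case: ifP.
have k'0 u : 0 <= k' u by rewrite mulr_ge0.
have sub : `[0, t]%classic `&` `[0, s]%classic = `[0, s]%classic :> set R.
  apply/setIidPr; apply: subset_itvl; by rewrite bnd_simp.
have mf2' : measurable_fun (`[0, t] : set (measurableTypeR R)) f2'.
  by apply/measurable_restrict => //; rewrite sub.
have mk' : measurable_fun (`[0, t] : set (measurableTypeR R)) k'.
  by apply: measurable_funM => //; exact: measurable_indic.
exists (fun u => f1 u + f2' u + k' u); split.
- by apply: measurable_funD => //; exact: measurable_funD.
- move=> u u0 us; rewrite /f2' patchE mem_set; last by rewrite /= in_itv /= u0 ltW.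
  by rewrite lerDl.
- move=> u su ut; rewrite /k' indicE mem_set; last by rewrite /= in_itv /= su.
  by rewrite mulr1 lerD2r lerDl.
under eq_integral do rewrite !EFinD.
rewrite ge0_integralD//=; last 4 first.
- by move=> u _; rewrite -EFinD lee_fin addr_ge0.
- by apply/measurable_EFinP; exact: measurable_funD.
- by move=> u _; rewrite lee_fin.
- exact/measurable_EFinP.
rewrite ge0_integralD//=; last 4 first.
- by move=> u _; rewrite lee_fin.
- exact/measurable_EFinP.
- by move=> u _; rewrite lee_fin.
- exact/measurable_EFinP.
have e2 : (\int[leb]_(u in `[0%R, s]) (f2 u)%:E = \int[leb]_(u in `[0%R, t]) (f2' u)%:E)%E.
  rewrite -[in LHS]sub integral_mkcondr.
  by apply: eq_integral => u _; rewrite restrict_EFin.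
have ek : (\int[leb]_(u in `[0%R, t]) (k' u)%:E = (k * (t - s))%:E)%E.
  under eq_integral do rewrite EFinM.
  rewrite ge0_integralZl//=; last first.
    by apply/measurable_EFinP; exact: measurable_indic.
  rewrite integral_indic//= (_ : _ `&` _ = `[s, t]%classic).
    rewrite lebesgue_measure_itv /= lte_fin; case: ifPn => [_|]; first by rewrite -EFinB -EFinM.
    rewrite -leNgt => ts; have -> : t = s by apply/eqP; rewrite eq_le ts.
    by rewrite subrr mulr0 mule0.
  apply/setIidPl; apply: subset_itvr; by rewrite bnd_simp.
by rewrite e2 ek.
Qed.

End Gluing.

(** * Increments of the stochastic and time integrals *)

Section Increments.
Variables (R : realType) (A : vonNeumannAlgebra R) (Phi : {scalar A}).
Hypothesis st : faithful_normal_tracial_state Phi.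
Variables (F : R -> set A) (X Y : R -> A).
Hypothesis hF : filtration F.
Hypothesis hX : free_brownian_motion Phi F X.
Hypothesis hY : free_multiplicative_brownian_motion Phi F X Y.
Local Notation tr := (tr Phi).
Local Notation nrm := (nrm Phi).
Local Notation ip := (ip Phi).
Local Notation l2 := (l2sq Phi).
Local Notation leb := (@lebesgue_measure R).

Lemma cvge0_le (f : nat -> \bar R) (e : R) : 0 < e ->
  f n @[n --> \oo] --> 0%E -> \forall n \near \oo, (f n <= e%:E)%E.
Proof.
move=> e0 hf; have : \forall n \near \oo, (f n < e%:E)%E.
  have h : nbhs (0%E : \bar R) [set x | (x < e%:E)%E].
    by apply: open_ereal_lt'; rewrite lte_fin.
  exact: (hf _ h).
by apply: filterS => n /ltW.
Qed.

Lemma cvg0_le (f : nat -> R) (e : R) : 0 < e -> f n @[n --> \oo] --> (0 : R) ->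
  \forall n \near \oo, f n <= e.
Proof.
move=> e0 /cvgrPdist_le/(_ _ e0); apply: filterS => n.
by rewrite sub0r normrN => /ler_normlW.
Qed.

Lemma nrm_le_sqr a (e : R) : 0 <= e -> l2 a <= e ^+ 2 -> nrm a <= e.
Proof. by move=> e0 h; rewrite -(@ler_pXn2r _ 2) ?nnegrE ?nrm_ge0// nrm_sqr. Qed.

Lemma l2D_le a b : l2 (a + b) <= 2 * l2 a + 2 * l2 b.
Proof.
have := l2_ge0 st (a - b); rewrite !(l2D st) (l2N st) ipNr.
by move: (l2 a) (l2 b) (ip a b) => x y z; lra.
Qed.

Lemma dX_approx t I (e : R) : is_dX_integral Phi F X Y t I -> 0 < e ->
  exists V : step_process A t, [/\ step_adapted F V,
    measurable_fun (`[0, t] : set (measurableTypeR R))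
      (fun s => l2 (step_eval V s - Y s)),
    (\int[leb]_(s in `[0%R, t]) (l2 (step_eval V s - Y s))%:E <= (e ^+ 2)%:E)%E &
    nrm (step_dX_integral X V - I) <= e].
Proof.
move=> [V [aV mV iV cV]] e0; have e20 : 0 < e ^+ 2 by rewrite exprn_gt0.
have [n [h1 h2]] := @filter_ex _ _ _ _ (filterI (cvge0_le e20 iV) (cvg0_le e20 cV)).
by exists (V n); split=> //; apply: nrm_le_sqr => //; exact: ltW.
Qed.

Lemma dt_approx t D (e : R) : is_time_integral Phi Y t D -> 0 < e ->
  exists V : step_process A t, [/\
    measurable_fun (`[0, t] : set (measurableTypeR R))
      (fun s => nrm (step_eval V s - Y s)),
    (\int[leb]_(s in `[0%R, t]) (nrm (step_eval V s - Y s))%:E <= e%:E)%E &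
    nrm (step_time_integral V - D) <= e].
Proof.
move=> [V [mV iV cV]] e0; have e20 : 0 < e ^+ 2 by rewrite exprn_gt0.
have [n [h1 h2]] := @filter_ex _ _ _ _ (filterI (cvge0_le e0 iV) (cvg0_le e20 cV)).
exists (V n); split; [exact: mV|exact: h1|].
by apply: nrm_le_sqr => //; exact: ltW.
Qed.

(** [V] and [W] both approximate $Y$ before $s$, so they nearly cancel there. After $s$ the
    correction [C] compensates [V]: it is $-Y_s$ when the increment is approximated, and minus [V]
    itself when the increment is tested against $\mathscr A_s$. The 4 comes from [l2D_le], applied
    with a factor 2 to each of the two errors. *)
Lemma dX_glue s t (V : step_process A t) (W : step_process A s) C (k e : R) :
  0 <= s -> s <= t -> 0 <= e ->
  step_adapted F V -> step_adapted F W ->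
  measurable_fun (`[0, t] : set (measurableTypeR R)) (fun u => l2 (step_eval V u - Y u)) ->
  measurable_fun (`[0, s] : set (measurableTypeR R)) (fun u => l2 (step_eval W u - Y u)) ->
  (\int[leb]_(u in `[0%R, t]) (l2 (step_eval V u - Y u))%:E <= (e ^+ 2)%:E)%E ->
  (\int[leb]_(u in `[0%R, s]) (l2 (step_eval W u - Y u))%:E <= (e ^+ 2)%:E)%E ->
  elem_in t C -> elem_adapted F C ->
  (forall u, u < s -> elem_eval C u = 0) ->
  (forall u, s <= u -> u < t ->
    l2 (step_eval V u + elem_eval C u) <= 2 * l2 (step_eval V u - Y u) + k ^+ 2) ->
  l2 (step_dX_integral X V - step_dX_integral X W + elem_dX X C)
    <= 4 * e ^+ 2 + k ^+ 2 * (t - s).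
Proof.
move=> s0 s_t e0 aV aW mV mW iV iW Ct aC C0 CK.
have [g [mg g1 g2 ig]] := @glue_bound R s t (k ^+ 2)
  (fun u => 2 * l2 (step_eval V u - Y u)) (fun u => 2 * l2 (step_eval W u - Y u))
  s0 s_t (sqr_ge0 _) (fun u => mulr_ge0 (ler0n _ 2) (l2_ge0 st _))
  (fun u => mulr_ge0 (ler0n _ 2) (l2_ge0 st _))
  (measurable_funM (@measurable_cst _ _ _ _ _ _) mV)
  (measurable_funM (@measurable_cst _ _ _ _ _ _) mW).
pose E := elem_of V ++ elem_opp (elem_of W) ++ C.
have tV : elem_in t (elem_of V) := @elem_of_in _ _ _ V.
have sW : elem_in s (elem_of W) := @elem_of_in _ _ _ W.
have tW := elem_inW s_t sW.
have tE : elem_in t E by do 2 (apply: elem_in_cat => //); exact: elem_in_opp.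
have aE : elem_adapted F E.
  apply: elem_adapted_cat; first exact: elem_of_adapted.
  apply: elem_adapted_cat => //; apply: (elem_adapted_opp hF tW).
  exact: elem_of_adapted.
have evE u : elem_eval E u = step_eval V u - elem_eval (elem_of W) u + elem_eval C u.
  by rewrite !elem_eval_cat elem_eval_opp elem_of_eval addrA.
have gE u : 0 <= u <= t -> l2 (elem_eval E u) <= g u.
  move=> /andP[u0 ut]; rewrite evE; have [us|su] := ltP u s.
    apply: le_trans (g1 _ u0 us); rewrite C0// addr0 elem_of_eval.
    rewrite (_ : _ - _ = (step_eval V u - Y u) + - (step_eval W u - Y u)).
      by rewrite (le_trans (l2D_le _ _))// (l2N st).
    by rewrite opprB addrA subrK.
  apply: le_trans (g2 _ su ut); rewrite (elem_eval_out sW su) subr0.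
  (* At $u=t$ the half-open steps all vanish, so [CK] is only required for $u<t$. *)
  move: ut; rewrite le_eqVlt => /predU1P[->|ut]; last exact: CK.
  rewrite (elem_eval_out Ct (lexx _)) addr0 -elem_of_eval (elem_eval_out tV (lexx _)).
  by rewrite l2E (ip0l st) addr_ge0 ?sqr_ge0// mulr_ge0// l2_ge0.
have := l2_elem_dX_le st hF hX tE aE mg gE.
rewrite !elem_dX_cat elem_dX_opp !elem_of_dX addrA => /le_trans/(_ ig).
have db (r : R) (Z : step_process A r) :
  measurable_fun (`[0, r] : set (measurableTypeR R)) (fun u => l2 (step_eval Z u - Y u)) ->
  (\int[leb]_(u in `[0%R, r]) (l2 (step_eval Z u - Y u))%:E <= (e ^+ 2)%:E)%E ->
  (\int[leb]_(u in `[0%R, r]) (2 * l2 (step_eval Z u - Y u))%:E <= (2 * e ^+ 2)%:E)%E.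
  move=> mZ iZ; under eq_integral do rewrite EFinM.
  rewrite ge0_integralZl//=; last 2 first.
  - exact/measurable_EFinP.
  - by move=> u _; rewrite lee_fin l2_ge0.
  by rewrite EFinM lee_wpmul2l.
have h1 := leeD (db _ _ mV iV) (db _ _ mW iW).
move=> h2; have := le_trans h2 (leeD h1 (lexx _)).
by rewrite -!EFinD lee_fin => h; rewrite (le_trans h)//; lra.
Qed.

Lemma dt_glue s t (V : step_process A t) (W : step_process A s) C (k e : R) :
  0 <= s -> s <= t -> 0 <= e -> 0 <= k ->
  measurable_fun (`[0, t] : set (measurableTypeR R)) (fun u => nrm (step_eval V u - Y u)) ->
  measurable_fun (`[0, s] : set (measurableTypeR R)) (fun u => nrm (step_eval W u - Y u)) ->
  (\int[leb]_(u in `[0%R, t]) (nrm (step_eval V u - Y u))%:E <= e%:E)%E ->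
  (\int[leb]_(u in `[0%R, s]) (nrm (step_eval W u - Y u))%:E <= e%:E)%E ->
  elem_in t C ->
  (forall u, u < s -> elem_eval C u = 0) ->
  (forall u, s <= u -> u < t ->
    nrm (step_eval V u + elem_eval C u) <= nrm (step_eval V u - Y u) + k) ->
  nrm (step_time_integral V - step_time_integral W + elem_dt C) <= 2 * e + k * (t - s).
Proof.
move=> s0 s_t e0 k0 mV mW iV iW Ct C0 CK.
have [g [mg g1 g2 ig]] := @glue_bound R s t k
  (fun u => nrm (step_eval V u - Y u)) (fun u => nrm (step_eval W u - Y u))
  s0 s_t k0 (fun u => nrm_ge0 _ _) (fun u => nrm_ge0 _ _) mV mW.
pose E := elem_of V ++ elem_opp (elem_of W) ++ C.
have tV : elem_in t (elem_of V) := @elem_of_in _ _ _ V.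
have sW : elem_in s (elem_of W) := @elem_of_in _ _ _ W.
have tW := elem_inW s_t sW.
have tE : elem_in t E by do 2 (apply: elem_in_cat => //); exact: elem_in_opp.
have evE u : elem_eval E u = step_eval V u - elem_eval (elem_of W) u + elem_eval C u.
  by rewrite !elem_eval_cat elem_eval_opp elem_of_eval addrA.
have gE u : 0 <= u <= t -> nrm (elem_eval E u) <= g u.
  move=> /andP[u0 ut]; rewrite evE; have [us|su] := ltP u s.
    apply: le_trans (g1 _ u0 us); rewrite C0// addr0 elem_of_eval.
    rewrite (_ : _ - _ = (step_eval V u - Y u) - (step_eval W u - Y u)).
      exact: nrmB.
    by rewrite opprB addrA subrK.
  apply: le_trans (g2 _ su ut); rewrite (elem_eval_out sW su) subr0.
  move: ut; rewrite le_eqVlt => /predU1P[->|ut]; last exact: CK.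
  rewrite (elem_eval_out Ct (lexx _)) addr0 -elem_of_eval (elem_eval_out tV (lexx _)).
  by rewrite nrm0 addr_ge0// nrm_ge0.
have := nrm_elem_dt st tE mg gE.
rewrite !elem_dt_cat elem_dt_opp !elem_of_dt addrA => /le_trans/(_ ig).
move=> h2; have := le_trans h2 (leeD (leeD iV iW) (lexx _)).
by rewrite -!EFinD lee_fin => h; rewrite (le_trans h)//; lra.
Qed.

Let Fusa t : 0 <= t -> unital_star_subalgebra (F t).
Proof. exact: filt_algebra. Qed.

Let sum3_le (a b c q e : R) :
  a <= 2 * e + q -> b <= e -> c <= e -> a + b + c <= 4 * e + q.
Proof. by move=> *; lra. Qed.

(** The correction $-Y_s$ on $[s,t[$ leaves an integrand controlled by $Y_u-Y_s$. The factor 2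
    absorbs the loss $2K^2\le(2K)^2$ in [l2D_le]. *)
Lemma dX_increment_le s t I J (K : R) : 0 <= s -> s <= t -> 0 <= K ->
  is_dX_integral Phi F X Y t I -> is_dX_integral Phi F X Y s J ->
  (forall u, s <= u <= t -> nrm (Y u - Y s) <= K) ->
  nrm (I - J - (X t - X s) * Y s) <= 2 * K * Num.sqrt (t - s).
Proof.
move=> s0 s_t K0 hI hJ hK; apply/ler_addgt0Pl => d d0.
(* The margin [d] is spent as [2 * e] on the glued sum and [e] on each of the two approximations. *)
have [e [e0 de]] : exists e, 0 < e /\ d = 4 * e.
  by exists (d / 4); split; [rewrite divr_gt0|field].
have [V [aV mV iV nV]] := dX_approx hI e0.
have [W [aW mW iW nW]] := dX_approx hJ e0.
pose C : seq (R * R * A) := [:: (s, t, - Y s)].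
have evC u : s <= u -> u < t -> elem_eval C u = - Y s.
  by move=> su ut; rewrite /elem_eval big_seq1 /ind /= su ut scale1r.
have C0 u : u < s -> elem_eval C u = 0.
  by move=> us; rewrite /elem_eval big_seq1 /ind /= leNgt us scale0r.
have Ct : elem_in t C by move=> p; rewrite inE => /eqP -> /=.
have aC : elem_adapted F C.
  move=> p; rewrite inE => /eqP -> /=; apply: (usa_opp (Fusa s0)).
  exact: (fmbm_adapted hY).
have CK u : s <= u -> u < t ->
    l2 (step_eval V u + elem_eval C u) <= 2 * l2 (step_eval V u - Y u) + (2 * K) ^+ 2.
  move=> su ut; rewrite evC// (_ : _ - _ = (step_eval V u - Y u) + (Y u - Y s)); last by rewrite addrA subrK.
  rewrite (le_trans (l2D_le _ _))// lerD2l -(nrm_sqr st (Y u - Y s)).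
  have hu : nrm (Y u - Y s) <= K by apply: hK; rewrite su ltW.
  rewrite (@le_trans _ _ (2 * K ^+ 2))//; last by rewrite exprMn ler_wpM2r ?sqr_ge0//; lra.
  by rewrite ler_pM2l// ler_pXn2r// nnegrE nrm_ge0.
have h := dX_glue s0 s_t (ltW e0) aV aW mV mW iV iW Ct aC C0 CK.
set S := _ + _ in h.
have nS : nrm S <= 2 * e + 2 * K * Num.sqrt (t - s).
  have q0 := sqrtr_ge0 (t - s).
  have q2 : Num.sqrt (t - s) ^+ 2 = t - s by rewrite sqr_sqrtr// subr_ge0.
  apply: nrm_le_sqr; first by rewrite addr_ge0// !mulr_ge0// ltW.
  apply: (le_trans h); move: q0 q2; move: (t - s) (Num.sqrt (t - s)) => r q q0 <-.
  rewrite -subr_ge0 (_ : _ - _ = 8 * (e * (K * q))); last by ring.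
  by rewrite !mulr_ge0// ltW.
have -> : I - J - (X t - X s) * Y s =
    S - (step_dX_integral X V - I) + (step_dX_integral X W - J).
  rewrite /S /elem_dX big_seq1 /= mulrN.
  zmodule.
have nV' : nrm (S - (step_dX_integral X V - I) + (step_dX_integral X W - J)) <=
    nrm S + nrm (step_dX_integral X V - I) + nrm (step_dX_integral X W - J).
  by rewrite (le_trans (nrmD st _ _))// lerD2r nrmB.
by rewrite (le_trans nV')// de; exact: sum3_le nS nV nW.
Qed.

(** $I-J$ is within [4 * e] in $L^2$ of the part [Z] of the elementary integral after $s$, whose
    trace against $\mathscr A_s$ is zero. *)
Lemma dX_increment_martingale s t I J B : 0 <= s -> s <= t ->
  is_dX_integral Phi F X Y t I -> is_dX_integral Phi F X Y s J ->
  F s B -> tr ((I - J) * B) = 0.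
Proof.
move=> s0 s_t hI hJ FB; apply: cmod_eq0; apply/eqP; rewrite eq_le cmod_ge0 andbT.
apply/ler_addgt0Pl => d d0; rewrite addr0.
have nB1 : 0 < nrm B + 1 by rewrite ltr_wpDl ?nrm_ge0.
(* Using [nrm B + 1] avoids a division by zero when [B] vanishes. *)
have [e [e0 de]] : exists e, 0 < e /\ d = 4 * e * (nrm B + 1).
  exists (d / 4 / (nrm B + 1)); split; first by rewrite !divr_gt0.
  by field; rewrite gt_eqF.
have [V [aV mV iV nV]] := dX_approx hI e0.
have [W [aW mW iW nW]] := dX_approx hJ e0.
have tV : elem_in t (elem_of V) := @elem_of_in _ _ _ V.
have aV' := elem_of_adapted aV.
pose C := elem_opp (elem_after s (elem_of V)).
have hVC : elem_in t (elem_after s (elem_of V)) by exact: elem_in_after.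
have Ct : elem_in t C by exact: elem_in_opp.
have aC : elem_adapted F C.
  by apply: (elem_adapted_opp hF hVC); exact: (elem_adapted_after hF tV).
have C0 u : u < s -> elem_eval C u = 0.
  by move=> us; rewrite elem_eval_opp elem_eval_after leNgt us oppr0.
have CK u : s <= u -> u < t ->
    l2 (step_eval V u + elem_eval C u) <= 2 * l2 (step_eval V u - Y u) + 0 ^+ 2.
  move=> su ut; rewrite elem_eval_opp elem_eval_after su elem_of_eval subrr.
  by rewrite l2E (ip0l st) addr_ge0 ?sqr_ge0// mulr_ge0// l2_ge0.
have h := dX_glue s0 s_t (ltW e0) aV aW mV mW iV iW Ct aC C0 CK.
set S := _ + _ in h.
have nS : nrm S <= 2 * e.
  apply: nrm_le_sqr; first by rewrite mulr_ge0// ltW.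
  by rewrite (le_trans h)// exprMn expr0n /= mul0r addr0 (_ : 2 ^+ 2 = 4)//; ring.
pose Z := elem_dX X (elem_after s (elem_of V)).
have eZ : I - J = (S - (step_dX_integral X V - I) + (step_dX_integral X W - J)) + Z.
  by rewrite /S /C elem_dX_opp -/Z; zmodule.
have nI : nrm (I - J - Z) <= 4 * e.
  rewrite eZ addrK (le_trans (nrmD st _ _))//.
  rewrite (le_trans (lerD (nrmB st _ _) (lexx _)))//.
  by rewrite -[leRHS]addr0; apply: sum3_le nV nW; rewrite addr0.
rewrite (_ : I - J = (I - J - Z) + Z); last by rewrite subrK.
rewrite mulrDl trD (elem_dX_martingale st hF hX s0 tV aV' FB) addr0.
rewrite (le_trans (tr_le st _ _))// de.
apply: ler_pM; rewrite ?nrm_ge0//.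
by rewrite lerDl.
Qed.

Lemma dt_increment_le s t I J (K : R) : 0 <= s -> s <= t -> 0 <= K ->
  is_time_integral Phi Y t I -> is_time_integral Phi Y s J ->
  (forall u, s <= u <= t -> nrm (Y u - Y s) <= K) ->
  nrm (I - J - (t - s)%:C *: Y s) <= K * (t - s).
Proof.
move=> s0 s_t K0 hI hJ hK; apply/ler_addgt0Pl => d d0.
have [e [e0 de]] : exists e, 0 < e /\ d = 4 * e.
  by exists (d / 4); split; [rewrite divr_gt0|field].
have [V [mV iV nV]] := dt_approx hI e0.
have [W [mW iW nW]] := dt_approx hJ e0.
pose C : seq (R * R * A) := [:: (s, t, - Y s)].
have evC u : s <= u -> u < t -> elem_eval C u = - Y s.
  by move=> su ut; rewrite /elem_eval big_seq1 /ind /= su ut scale1r.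
have C0 u : u < s -> elem_eval C u = 0.
  by move=> us; rewrite /elem_eval big_seq1 /ind /= leNgt us scale0r.
have Ct : elem_in t C by move=> p; rewrite inE => /eqP -> /=.
have CK u : s <= u -> u < t ->
    nrm (step_eval V u + elem_eval C u) <= nrm (step_eval V u - Y u) + K.
  move=> su ut; rewrite evC// (_ : _ - _ = (step_eval V u - Y u) + (Y u - Y s)); last by rewrite addrA subrK.
  by rewrite (le_trans (nrmD st _ _))// lerD2l hK// su ltW.
have h := dt_glue s0 s_t (ltW e0) K0 mV mW iV iW Ct C0 CK.
set S := _ + _ in h.
have eS : I - J - (t - s)%:C *: Y s =
    S - (step_time_integral V - I) + (step_time_integral W - J).
  by rewrite /S /elem_dt big_seq1 /= scalerN; zmodule.
rewrite eS (le_trans (nrmD st _ _))// (le_trans (lerD (nrmB st _ _) (lexx _)))// de.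
exact: sum3_le h nV nW.
Qed.

(** [K] is kept free for a bootstrap: unitarity gives $K=2$, hence [incr_le], whose bound
    $7\sqrt{t-s}$ then serves as a better [K]. *)
Lemma sde_increment s t : 0 <= s -> s <= t ->
  exists I D, [/\ Y t - Y s = 'i *: I - 2^-1 *: D,
    forall B, F s B -> tr (I * B) = 0,
    forall K, 0 <= K -> (forall u, s <= u <= t -> nrm (Y u - Y s) <= K) ->
      nrm (I - (X t - X s) * Y s) <= 2 * K * Num.sqrt (t - s) &
    forall K, 0 <= K -> (forall u, s <= u <= t -> nrm (Y u - Y s) <= K) ->
      nrm (D - (t - s)%:C *: Y s) <= K * (t - s)].
Proof.
move=> s0 s_t; have t0 := le_trans s0 s_t.
have [I [D [hI hD eY]]] := fmbm_sde hY t0.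
have [J [E [hJ hE eY']]] := fmbm_sde hY s0.
exists (I - J), (D - E); split.
- by rewrite eY eY' !scalerBr; zmodule.
- by move=> B; exact: (dX_increment_martingale s0 s_t hI hJ).
- by move=> K K0 hK; exact: (dX_increment_le s0 s_t K0 hI hJ).
- by move=> K K0 hK; exact: (dt_increment_le s0 s_t K0 hD hE).
Qed.

End Increments.

(** * Second order expansion of the rotated projection *)

Section LocalExpansion.
Variables (R : realType) (A : vonNeumannAlgebra R) (Phi : {scalar A}).
Hypothesis st : faithful_normal_tracial_state Phi.
Variables (F : R -> set A) (X Y : R -> A).
Hypothesis hF : filtration F.
Hypothesis hX : free_brownian_motion Phi F X.
Hypothesis hY : free_multiplicative_brownian_motion Phi F X Y.
Local Notation tr := (tr Phi).
Local Notation nrm := (nrm Phi).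
Local Notation opb := (opb Phi).

Lemma trZl z a b : tr ((z *: a) * b) = z * tr (a * b).
Proof. by rewrite -scalerAl trZ. Qed.

Lemma trZr z a b : tr (a * (z *: b)) = z * tr (a * b).
Proof. by rewrite -scalerAr trZ. Qed.

Lemma mul_le_eq (a b c d e : R) : 0 <= a -> 0 <= b -> a <= c -> b <= d ->
  c * d = e -> a * b <= e.
Proof. by move=> a0 b0 ac bd <-; exact: ler_pM. Qed.

Lemma opb1l a b : opb 1 a -> nrm (a * b) <= nrm b.
Proof. by move=> /(opbl b); rewrite mul1r. Qed.

Lemma opb1r a b : opb 1 a -> nrm (b * a) <= nrm b.
Proof. by move=> /(opbr b); rewrite mul1r. Qed.

Lemma opb1M a b : opb 1 a -> opb 1 b -> opb 1 (a * b).
Proof. by move=> ha hb; rewrite -[1]mulr1; exact: opbM. Qed.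

Lemma opb_Y t : 0 <= t -> opb 1 (Y t).
Proof. by move=> t0; apply: (opb_unitary st); exact: (fmbm_unitary hY). Qed.

Lemma nrm_incr_bm s t : 0 <= s -> s <= t -> nrm (X t - X s) = Num.sqrt (t - s).
Proof.
move=> s0 s_t; congr Num.sqrt; rewrite l2E /ip (bm_incr_selfadjoint hX)//.
have := bm_variance st hF hX s0 s_t (usa_1 (filt_algebra hF s0)).
by rewrite mulr1 tr1// mulr1 => ->.
Qed.

Let half_norm : cmod (2^-1 : R[i]) = 2^-1.
Proof.
by rewrite cmodV (_ : 2 = (2 : R)%:C) ?cmodR ?ger0_norm// rmorphMn.
Qed.

Lemma sqrt_gap (s t : R) : s <= t -> Num.sqrt (t - s) ^+ 2 = t - s.
Proof. by move=> s_t; rewrite sqr_sqrtr// subr_ge0. Qed.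

(** With $K=2$ the stochastic part contributes $(4+1)\sqrt h$ and the drift
    $\frac12\cdot3h\le\frac32\sqrt h$, as $h\le1$. *)
Lemma incr_le s t : 0 <= s -> s <= t -> t - s <= 1 ->
  nrm (Y t - Y s) <= 7 * Num.sqrt (t - s).
Proof.
move=> s0 s_t ts1; have t0 := le_trans s0 s_t.
have [I [D [e _ hI hD]]] := sde_increment st hF hX hY s0 s_t.
have two u : s <= u <= t -> nrm (Y u - Y s) <= 2.
  move=> /andP[su _]; rewrite (le_trans (nrmB st _ _))//.
  by apply: lerD; apply: opb_nrm => //; apply: opb_Y => //; exact: le_trans su.
have {}hI := hI 2 (ler0n _ _) two; have {}hD := hD 2 (ler0n _ _) two.
have q0 := sqrtr_ge0 (t - s); have q2 := sqrt_gap s_t.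
have q1 : Num.sqrt (t - s) <= 1 by rewrite -sqrtr1 ler_wsqrtr.
have nxy : nrm ((X t - X s) * Y s) <= Num.sqrt (t - s).
  by rewrite -(nrm_incr_bm s0 s_t) opb1r//; exact: opb_Y.
have ny : nrm ((t - s)%:C *: Y s) <= t - s.
  rewrite nrmZ// cmodR ger0_norm ?subr_ge0// ler_piMr ?subr_ge0//.
  by apply: opb_nrm => //; exact: opb_Y.
have nI : nrm I <= nrm (I - (X t - X s) * Y s) + nrm ((X t - X s) * Y s).
  by rewrite -{1}(subrK ((X t - X s) * Y s) I) nrmD.
have nD : nrm D <= nrm (D - (t - s)%:C *: Y s) + nrm ((t - s)%:C *: Y s).
  by rewrite -{1}(subrK ((t - s)%:C *: Y s) D) nrmD.
rewrite e (le_trans (nrmB st _ _))// !nrmZ// cmodi half_norm mul1r.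
move: hI hD nxy ny nI nD q2; move: (nrm I) (nrm D) (nrm _) (nrm _) (nrm _) (nrm _).
move: (t - s) (Num.sqrt (t - s)) q0 q1 ts1 => h q q0 q1 ts1 a b c d e' f.
move=> *; have : h <= q by (rewrite -(_ : q ^+ 2 = h)// expr2 ler_piMr).
by move=> hq; lra.
Qed.

(** Second round, with $K=7\sqrt h$: the stochastic error is $14h$ and the drift at most
    $\frac12(7+1)h$. *)
Lemma incr_expansion s t : 0 <= s -> s <= t -> t - s <= 1 ->
  nrm (Y t - Y s - 'i *: ((X t - X s) * Y s)) <= 18 * Num.sqrt (t - s) ^+ 2.
Proof.
move=> s0 s_t ts1; have t0 := le_trans s0 s_t.
have [I [D [e _ hI hD]]] := sde_increment st hF hX hY s0 s_t.
have q0 := sqrtr_ge0 (t - s); have q2 := sqrt_gap s_t.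
have q1 : Num.sqrt (t - s) <= 1 by rewrite -sqrtr1 ler_wsqrtr.
have K0 : 0 <= 7 * Num.sqrt (t - s) by rewrite mulr_ge0.
have hK u : s <= u <= t -> nrm (Y u - Y s) <= 7 * Num.sqrt (t - s).
  move=> /andP[su ut]; have us1 : u - s <= t - s by rewrite lerD2r.
  rewrite (le_trans (incr_le s0 su _))//; first exact: le_trans ts1.
  by rewrite ler_pM2l// ler_wsqrtr.
have {}hI := hI _ K0 hK; have {}hD := hD _ K0 hK.
have ny : nrm ((t - s)%:C *: Y s) <= t - s.
  rewrite nrmZ// cmodR ger0_norm ?subr_ge0// ler_piMr ?subr_ge0//.
  by apply: opb_nrm => //; exact: opb_Y.
have nD : nrm D <= nrm (D - (t - s)%:C *: Y s) + nrm ((t - s)%:C *: Y s).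
  by rewrite -{1}(subrK ((t - s)%:C *: Y s) D) nrmD.
have -> : Y t - Y s - 'i *: ((X t - X s) * Y s) =
    'i *: (I - (X t - X s) * Y s) - 2^-1 *: D.
  by rewrite e scalerBr; zmodule.
rewrite (le_trans (nrmB st _ _))// !nrmZ// cmodi half_norm mul1r.
move: hI hD ny nD q2; move: (nrm D) (nrm _) (nrm _) (nrm _).
move: (t - s) (Num.sqrt (t - s)) q0 q1 ts1 {K0 hK} => h q q0 q1 ts1 a b c d.
move=> h1 h2 h3 h4 qh; subst h; move: h1 h2 h3 h4; have : q * q ^+ 2 <= q ^+ 2 by rewrite ler_piMl ?sqr_ge0.
by have := sqr_ge0 q; move=> *; lra.
Qed.

(** Against $\mathscr A_s$ the stochastic part disappears, leaving the error of the drift alone.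
    This gains a factor $\sqrt h$ over [incr_expansion]; the constant 4 bounds $\frac12\cdot7$. *)
Lemma incr_mean s t B : 0 <= s -> s <= t -> t - s <= 1 -> F s B ->
  cmod (tr ((Y t - Y s) * B) + ((t - s) / 2)%:C * tr (Y s * B))
    <= 4 * Num.sqrt (t - s) ^+ 3 * nrm B.
Proof.
move=> s0 s_t ts1 FB; have t0 := le_trans s0 s_t.
have [I [D [e mI _ hD]]] := sde_increment st hF hX hY s0 s_t.
have q0 := sqrtr_ge0 (t - s); have q2 := sqrt_gap s_t.
have K0 : 0 <= 7 * Num.sqrt (t - s) by rewrite mulr_ge0.
have hK u : s <= u <= t -> nrm (Y u - Y s) <= 7 * Num.sqrt (t - s).
  move=> /andP[su ut]; have us1 : u - s <= t - s by rewrite lerD2r.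
  rewrite (le_trans (incr_le s0 su _))//; first exact: le_trans ts1.
  by rewrite ler_pM2l// ler_wsqrtr.
have {}hD := hD _ K0 hK.
have -> : tr ((Y t - Y s) * B) + ((t - s) / 2)%:C * tr (Y s * B) =
    - 2^-1 * tr ((D - (t - s)%:C *: Y s) * B).
  have -> : ((t - s) / 2)%:C = 2^-1 * (t - s)%:C.
    by rewrite rmorphM /= fmorphV /= rmorphMn rmorph1 mulrC.
  rewrite e !mulrBl !trB !trZl mI//; move: (_%:C) => c.
  by ring.
rewrite cmodM cmodN half_norm.
apply: (@le_trans _ _ (2^-1 * (7 * Num.sqrt (t - s) * (t - s) * nrm B))).
  rewrite ler_pM2l ?invr_gt0//; apply: (le_trans (tr_le st _ _)).
  by rewrite ler_wpM2r ?nrm_ge0.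
rewrite -[X in 7 * _ * X]q2; have := nrm_ge0 Phi B.
move: (nrm B) (Num.sqrt _) q0 => b q q0 b0.
have : 0 <= q ^+ 3 * b by rewrite mulr_ge0 ?exprn_ge0.
rewrite (_ : 7 * q * q ^+ 2 * b = 7 * (q ^+ 3 * b)); last by ring.
rewrite -(mulrA 4); move: (_ * b) => w; lra.
Qed.

End LocalExpansion.

Section ProjectionIncrements.
Variables (R : realType) (A : vonNeumannAlgebra R) (Phi : {scalar A}).
Hypothesis st : faithful_normal_tracial_state Phi.
Variables (F : R -> set A) (X Y : R -> A) (Q : A) (theta : R).
Hypothesis hF : filtration F.
Hypothesis hX : free_brownian_motion Phi F X.
Hypothesis hY : free_multiplicative_brownian_motion Phi F X Y.
Hypotheses (projQ : projection Q) (FQ : F 0 Q) (trQ : Phi Q = theta%:C).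
Local Notation tr := (tr Phi).
Local Notation nrm := (nrm Phi).
Local Notation opb := (opb Phi).

Definition rotated (t : R) : A := Y t * Q * star (Y t).
Local Notation q := rotated.

Let opbQ : opb 1 Q. Proof. exact: (opb_projection st). Qed.

Lemma rotated_projection t : 0 <= t -> projection (q t).
Proof.
move=> t0; have [u1 u2] := fmbm_unitary hY t0; have [sQ QQ] := projQ.
split; first by rewrite /q !starM starK sQ mulrA.
by rewrite /q !mulrA -[_ * _ * star (Y t) * Y t]mulrA u1 mulr1 -[_ * Q * Q]mulrA QQ.
Qed.

Lemma rotated_opb t : 0 <= t -> opb 1 (q t).
Proof. by move=> t0; apply: (opb_projection st); exact: rotated_projection. Qed.

Lemma rotated_adapted t : 0 <= t -> F t (q t).
Proof.
move=> t0; have hu := filt_algebra hF t0.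
have FY : F t (Y t) by exact: (fmbm_adapted hY).
apply: (usa_mul hu); last exact: (usa_star hu).
apply: (usa_mul hu) => //; exact: (filt_mono hF (lexx 0) t0).
Qed.

Lemma rotated_trace t : 0 <= t -> tr (q t) = theta%:C.
Proof.
move=> t0; have [u1 u2] := fmbm_unitary hY t0.
by rewrite /q trC// mulrA u1 mul1r.
Qed.

Section Step.
Variables s t : R.
Hypotheses (s0 : 0 <= s) (s_t : s <= t) (ts1 : t - s <= 1).
Let t0 : 0 <= t := le_trans s0 s_t.
Local Notation h := (t - s).
Local Notation eta := (Num.sqrt (t - s)).
Local Notation x := (X t - X s).
Local Notation y := (Y s).
Local Notation D := (Y t - Y s).
Local Notation x' := ('i *: ((X t - X s) * Y s)).
Local Notation r := (Y t - Y s - 'i *: ((X t - X s) * Y s)).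

Definition rot_incr : A := q t - q s.
(** First order part of the increment. Unlike [rot_incr], it is known to be of order $\sqrt h$ in
    operator norm, by [bm_opb]. *)
Definition rot_incr0 : A := 'i *: (x * q s - q s * x).

Let eta0 : 0 <= eta. Proof. exact: sqrtr_ge0. Qed.
Let opby : opb 1 y. Proof. exact: (opb_Y st hY). Qed.
Let opbys : opb 1 (star y). Proof. exact: (opb_star st). Qed.
Let opbx : opb (2 * eta) x. Proof. exact: (bm_opb st hX). Qed.
Let nx : nrm x = eta. Proof. exact: (nrm_incr_bm st hF hX). Qed.
Let nD : nrm D <= 7 * eta. Proof. exact: (incr_le st hF hX hY). Qed.
Let nr : nrm r <= 18 * eta ^+ 2. Proof. exact: (incr_expansion st hF hX hY). Qed.
Let sx : star x = x. Proof. exact: (bm_incr_selfadjoint hX). Qed.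
Let hu : unital_star_subalgebra (F s). Proof. exact: filt_algebra. Qed.
Let FsQ : F s Q. Proof. exact: (filt_mono hF (lexx 0) s0). Qed.
Let Fsy : F s y. Proof. exact: (fmbm_adapted hY). Qed.
Let Fsq : F s (q s). Proof. exact: rotated_adapted. Qed.
Let opbq : opb 1 (q s). Proof. exact: rotated_opb. Qed.
Let Fm a b : F s a -> F s b -> F s (a * b). Proof. exact: usa_mul. Qed.
Let Fst a : F s a -> F s (star a). Proof. exact: usa_star. Qed.

Let opbD : opb 2 D.
Proof. by rewrite (_ : 2 = 1 + 1 :> R)//; apply: opbB => //; exact: (opb_Y st hY). Qed.

Let opbx' : opb (2 * eta) x'.
Proof.
have := opbZ st 'i (opbM opbx opby).
by rewrite cmodi mul1r mulr1.
Qed.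

Let nx' : nrm x' <= eta.
Proof. by rewrite nrmZ// cmodi mul1r -nx opb1r. Qed.

Let sx' : star x' = - 'i *: (star y * x).
Proof. by rewrite starZ starM sx; congr (_ *: _); apply/eqP; rewrite eq_complex /= oppr0 !eqxx. Qed.

Lemma rot_incrE : rot_incr = D * Q * star y + y * Q * star D + D * Q * star D.
Proof.
rewrite /rot_incr /q !starB !mulrBl !mulrBr; zmodule.
Qed.

Lemma rot_incr_opb : opb 2 rot_incr.
Proof. by rewrite (_ : 2 = 1 + 1 :> R)//; apply: opbB => //; exact: rotated_opb. Qed.

Lemma rot_incr0_nrm : nrm rot_incr0 <= 2 * eta.
Proof.
rewrite nrmZ// cmodi mul1r (le_trans (nrmB st _ _))//.
have := opb1r x opbq; have := opb1l x opbq; rewrite nx.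
by move=> *; lra.
Qed.

Lemma rot_incr0_opb : opb (4 * eta) rot_incr0.
Proof.
have := opbZ st 'i (opbB st (opbM opbx opbq) (opbM opbq opbx)).
by rewrite cmodi !mul1r mulr1 (_ : 2 * eta + 2 * eta = 4 * eta)//; ring.
Qed.

(** In the quadratic term one factor is measured in operator norm and the other in $L^2$: with
    $D=r+x'$, the remainder $r$ meets the bound 2 of $D$, and $x'$ has the bound [2 * eta]. Hence
    $86=18+18+2\cdot18+2\cdot7$. *)
Lemma rot_incr_expansion : nrm (rot_incr - rot_incr0) <= 86 * eta ^+ 2.
Proof.
have e : rot_incr - rot_incr0 = r * Q * star y + y * Q * star r + r * Q * star D + x' * Q * star D.
  rewrite rot_incrE /rot_incr0 /q.
  have eD : D = r + x' by rewrite subrK.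
  move: eD sx'; move: (r) => r'; move: (D) => D'; move: (x) => z -> ez.
  rewrite !starD ez.
  rewrite !(mulrDl, mulrDr, scaleNr, mulrN, mulrBr, scalerBr) -!scalerAl -!scalerAr -!mulrA.
  zmodule.
rewrite e.
have n1 : nrm (r * Q * star y) <= 18 * eta ^+ 2.
  by rewrite (le_trans (opb1r _ opbys))// (le_trans (opb1r _ opbQ)).
have n2 : nrm (y * Q * star r) <= 18 * eta ^+ 2.
  by rewrite (le_trans (opb1l _ (opb1M opby opbQ)))// nrm_star.
have n3 : nrm (r * Q * star D) <= 36 * eta ^+ 2.
  rewrite (le_trans (opbr _ (opb_star st opbD)))//.
  rewrite (le_trans (_ : _ <= 2 * (18 * eta ^+ 2)))//; last by rewrite mulrA; lra.
  by rewrite ler_pM2l// (le_trans (opb1r _ opbQ)).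
have n4 : nrm (x' * Q * star D) <= 14 * eta ^+ 2.
  rewrite -mulrA (le_trans (opbl _ opbx'))//.
  apply: (mul_le_eq (c := 2 * eta) (d := 7 * eta)) => //; rewrite ?mulr_ge0 ?nrm_ge0//.
    by rewrite (le_trans (opb1l _ opbQ))// nrm_star.
  by ring.
rewrite (le_trans (nrmD st _ _))//.
have := nrmD st (r * Q * star y + y * Q * star r) (r * Q * star D).
have := nrmD st (r * Q * star y) (y * Q * star r).
move: n1 n2 n3 n4; move: (nrm _) (nrm _) (nrm _) (nrm _) (nrm _) (nrm _) (eta ^+ 2).
by move=> *; lra.
Qed.

Lemma rot_incr_nrm : nrm rot_incr <= 28 * eta.
Proof.
rewrite rot_incrE.
have n1 : nrm (D * Q * star y) <= 7 * eta.
  by rewrite (le_trans (opb1r _ opbys))// (le_trans (opb1r _ opbQ)).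
have n2 : nrm (y * Q * star D) <= 7 * eta.
  by rewrite (le_trans (opb1l _ (opb1M opby opbQ)))// nrm_star.
have n3 : nrm (D * Q * star D) <= 14 * eta.
  rewrite (le_trans (opbr _ (opb_star st opbD)))//.
  rewrite (le_trans (_ : _ <= 2 * (7 * eta)))//; last by lra.
  by rewrite ler_pM2l// (le_trans (opb1r _ opbQ)).
rewrite (le_trans (nrmD st _ _))//.
have := nrmD st (D * Q * star y) (y * Q * star D).
move: n1 n2 n3; move: (nrm _) (nrm _) (nrm _) (nrm _) (eta).
by move=> *; lra.
Qed.

Let conj_realM (u : R) (z : R[i]) : conjc (u%:C * z) = u%:C * conjc z.
Proof. by rewrite rmorphM; congr (_ * _); rewrite /= oppr0. Qed.

Let conj_add (z w : R[i]) : conjc (z + w) = conjc z + conjc w.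
Proof. exact: rmorphD. Qed.

(** Each of the two linear terms of [rot_incrE] has drift $-\frac h2\Phi(q_sB)$. The quadratic term
    contains $x'Qx'^\star=xq_sx$, an Itô correction of trace $h\theta\Phi(B)$. The errors add up to
    $152=4+4+18\cdot7+18$. *)
Lemma rot_incr_mean B K : F s B -> opb K B ->
  cmod (tr (rot_incr * B) - h%:C * (theta%:C * tr B - tr (q s * B)))
    <= 152 * eta ^+ 3 * K.
Proof.
move=> FB oB; have K0 := opb_ge0 oB.
have F1 : F s (Q * star y * B) by apply: (Fm (Fm FsQ (Fst Fsy))).
have F2 : F s (Q * star y * star B) by apply: (Fm (Fm FsQ (Fst Fsy))); exact: Fst.
have n1 : nrm (Q * star y * B) <= K.
  by rewrite (le_trans (opb1l _ (opb1M opbQ opbys)))// opb_nrm.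
have n2 : nrm (Q * star y * star B) <= K.
  by rewrite (le_trans (opb1l _ (opb1M opbQ opbys)))// nrm_star// opb_nrm.
have := incr_mean st hF hX hY s0 s_t ts1 F1; set E1 := _ + _ => c1.
have := incr_mean st hF hX hY s0 s_t ts1 F2; set E2 := _ + _ => c2.
pose E3a := tr (r * Q * star D * B); pose E3b := tr (x' * Q * star r * B).
have hC : (h / 2)%:C + (h / 2)%:C = h%:C :> R[i].
  by rewrite -rmorphD /=; congr (_%:C); field.
have e1 : tr (D * Q * star y * B) = E1 - (h / 2)%:C * tr (q s * B).
  by rewrite /E1 /q !mulrA addrK.
have e2 : tr (y * Q * star D * B) = conjc E2 - (h / 2)%:C * tr (q s * B).
  (* Taking adjoints moves the increment to the left, in the form that [incr_mean] treats. *)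
  have -> : tr (y * Q * star D * B) = conjc (tr (D * (Q * star y * star B))).
    by rewrite -tr_star// !starM !starK projQ.1 [LHS]trC// !mulrA.
  have -> : tr (q s * B) = conjc (tr (y * (Q * star y * star B))).
    by rewrite -tr_star// !starM !starK projQ.1 [LHS]trC// !mulrA.
  have -> : conjc E2 = conjc (tr (D * (Q * star y * star B))) +
      (h / 2)%:C * conjc (tr (y * (Q * star y * star B))).
    by rewrite -conj_realM; exact: conj_add.
  by rewrite addrK.
have e3 : tr (D * Q * star D * B) = E3a + E3b + h%:C * (theta%:C * tr B).
  have -> : D * Q * star D * B = r * Q * star D * B + x' * Q * star r * B
      + x' * Q * star x' * B.
    have eD : D = r + x' by rewrite subrK.
    rewrite -!mulrDl; congr (_ * _).
    move: eD; move: (r) => r'; move: (D) => D'; move: (x') => z ->.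
    by rewrite !starD !(mulrDl, mulrDr); zmodule.
  (* The coefficients $i$ and $-i$ multiply to 1, and the sandwiched $q_s$ has trace $\theta$. *)
  rewrite !trD; congr (_ + _); rewrite sx' -(rotated_trace s0) mulrA.
  rewrite -(bm_sandwich st hF hX s0 s_t Fsq FB).
  rewrite -!(scalerAl, scalerAr) scalerA. rewrite mulNr -expr2 sqr_i opprK scale1r.
  by rewrite /q !mulrA.
have -> : tr (rot_incr * B) - h%:C * (theta%:C * tr B - tr (q s * B)) =
    E1 + conjc E2 + (E3a + E3b).
  rewrite rot_incrE (mulrDl _ _ B) (mulrDl _ _ B) !trD e1 e2 e3; move: hC.
  move: (tr _) (tr _) (E1) (conjc E2) (E3a + E3b) (h / 2)%:C (h%:C) => u v w z f hh c <-.
  by ring.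
have c3a : cmod E3a <= 126 * eta ^+ 3 * K.
  rewrite /E3a -mulrA -mulrA (le_trans (tr_le st _ _))//.
  apply: (mul_le_eq (c := 18 * eta ^+ 2) (d := 7 * eta * K)) => //; rewrite ?nrm_ge0//.
    rewrite (le_trans (opb1l _ opbQ))// (le_trans (opbr _ oB))// mulrC.
    by rewrite ler_wpM2r// nrm_star.
  by ring.
have c3b : cmod E3b <= 18 * eta ^+ 3 * K.
  rewrite /E3b -!(mulrA x') (le_trans (tr_le st _ _))//.
  apply: (mul_le_eq (c := eta) (d := 18 * eta ^+ 2 * K)) => //; rewrite ?nrm_ge0//.
    rewrite -mulrA (le_trans (opb1l _ opbQ))// (le_trans (opbr _ oB))// mulrC.
    by rewrite ler_wpM2r// nrm_star.
  by ring.
have c1' : cmod E1 <= 4 * eta ^+ 3 * K.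
  by rewrite (le_trans c1)// ler_wpM2l// mulr_ge0// exprn_ge0.
have c2' : cmod (conjc E2) <= 4 * eta ^+ 3 * K.
  by rewrite cmodJ (le_trans c2)// ler_wpM2l// mulr_ge0// exprn_ge0.
rewrite (le_trans (cmodD _ _))//.
have := cmodD E1 (conjc E2); have := cmodD E3a E3b.
move: c1' c2' c3a c3b; rewrite -!(mulrA _ (eta ^+ 3)).
move: (cmod _) (cmod _) (cmod _) (cmod _) (cmod _) (cmod _) (eta ^+ 3 * K) => *.
by lra.
Qed.

(** One increment at a time is replaced by its linear part, the other staying in $L^2$:
    $2580=86\cdot28+2\cdot86$. *)
Lemma rot_incr_second B C K L : opb K B -> opb L C ->
  cmod (tr (rot_incr * B * rot_incr * C) - tr (rot_incr0 * B * rot_incr0 * C))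
    <= 2580 * eta ^+ 3 * (K * L).
Proof.
move=> oB oC; have K0 := opb_ge0 oB; have L0 := opb_ge0 oC.
have nd := rot_incr_expansion; have n1 := rot_incr_nrm; have n0 := rot_incr0_nrm.
have -> : tr (rot_incr * B * rot_incr * C) - tr (rot_incr0 * B * rot_incr0 * C) =
    tr ((rot_incr - rot_incr0) * (B * rot_incr * C)) +
    tr (rot_incr0 * (B * (rot_incr - rot_incr0) * C)).
  by rewrite -trB -trD; congr tr; rewrite !(mulrBl, mulrBr) !mulrA; zmodule.
rewrite (le_trans (cmodD _ _))//.
have nBC (a : A) M : 0 <= M -> nrm a <= M -> nrm (B * a * C) <= M * (K * L).
  move=> M0 aM; rewrite (le_trans (opbr _ oC))//.
  apply: (@mul_le_eq _ _ _ L (K * M)); rewrite ?nrm_ge0//; last by ring.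
  by rewrite (le_trans (opbl _ oB))// ler_wpM2l.
have m1 : nrm (B * rot_incr * C) <= 28 * eta * (K * L) by apply: nBC => //; rewrite mulr_ge0.
have m2 : nrm (B * (rot_incr - rot_incr0) * C) <= 86 * eta ^+ 2 * (K * L).
  by apply: nBC => //; rewrite mulr_ge0// exprn_ge0.
have t1 : cmod (tr ((rot_incr - rot_incr0) * (B * rot_incr * C))) <= 2408 * (eta ^+ 3 * (K * L)).
  rewrite (le_trans (tr_le st _ _))//.
  by apply: (mul_le_eq _ _ nd m1); rewrite ?nrm_ge0//; ring.
have t2 : cmod (tr (rot_incr0 * (B * (rot_incr - rot_incr0) * C))) <= 172 * (eta ^+ 3 * (K * L)).
  rewrite (le_trans (tr_le st _ _))//.
  by apply: (mul_le_eq _ _ n0 m2); rewrite ?nrm_ge0//; ring.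
rewrite -(mulrA _ (eta ^+ 3)); move: t1 t2.
by move: (cmod _) (cmod _) (eta ^+ 3 * _) => *; lra.
Qed.

(** Two factors can be put in $L^2$; the third has to be small in operator norm. So the first
    increment is replaced by [rot_incr0], giving $(4\cdot28)\cdot28$, while the replacement error,
    already of order $h$, gives $86\cdot(2\cdot28)$. The sum 7952 is rounded up. *)
Lemma rot_incr_third B C E K L M : opb K B -> opb L C -> opb M E ->
  cmod (tr (rot_incr * B * rot_incr * C * rot_incr * E))
    <= 8000 * eta ^+ 3 * (K * L * M).
Proof.
move=> oB oC oE; have K0 := opb_ge0 oB; have L0 := opb_ge0 oC; have M0 := opb_ge0 oE.
have nd := rot_incr_expansion; have n1 := rot_incr_nrm; have n0 := rot_incr0_opb.
have od := rot_incr_opb.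
have -> : tr (rot_incr * B * rot_incr * C * rot_incr * E) =
    tr ((rot_incr - rot_incr0) * (B * rot_incr * C * rot_incr * E)) +
    tr ((rot_incr0 * B * rot_incr * C) * (rot_incr * E)).
  by rewrite -trD; congr tr; rewrite (mulrBl (B * rot_incr * C * rot_incr * E)) !mulrA; zmodule.
rewrite (le_trans (cmodD _ _))//.
have m1 : nrm (B * rot_incr * C * rot_incr * E) <= 56 * eta * (K * L * M).
  rewrite (le_trans (opbr _ oE))// mulrC.
  apply: (@mul_le_eq _ _ _ (56 * eta * (K * L)) M); rewrite ?nrm_ge0//; last by ring.
  rewrite -(mulrA (B * rot_incr)) (le_trans (opbl _ (opbM oB od)))//.
  apply: (@mul_le_eq _ _ _ (K * 2) (28 * eta * L)); rewrite ?mulr_ge0 ?nrm_ge0//; last by ring.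
  rewrite (le_trans (opbl _ oC))// mulrC.
  by rewrite ler_wpM2r.
have m2 : nrm (rot_incr0 * B * rot_incr * C) <= 112 * eta ^+ 2 * (K * L).
  rewrite (le_trans (opbr _ oC))// mulrC.
  apply: (@mul_le_eq _ _ _ (112 * eta ^+ 2 * K) L); rewrite ?nrm_ge0//; last by ring.
  rewrite (le_trans (opbl _ (opbM n0 oB)))//.
  by apply: (@mul_le_eq _ _ _ (4 * eta * K) (28 * eta)); rewrite ?mulr_ge0 ?nrm_ge0//; ring.
have m3 : nrm (rot_incr * E) <= 28 * eta * M.
  rewrite (le_trans (opbr _ oE))// mulrC.
  by rewrite ler_wpM2r.
have t1 : cmod (tr ((rot_incr - rot_incr0) * (B * rot_incr * C * rot_incr * E)))
    <= 4816 * (eta ^+ 3 * (K * L * M)).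
  rewrite (le_trans (tr_le st _ _))//.
  by apply: (mul_le_eq _ _ nd m1); rewrite ?nrm_ge0//; ring.
have t2 : cmod (tr ((rot_incr0 * B * rot_incr * C) * (rot_incr * E)))
    <= 3136 * (eta ^+ 3 * (K * L * M)).
  rewrite (le_trans (tr_le st _ _))//.
  by apply: (mul_le_eq _ _ m2 m3); rewrite ?nrm_ge0//; ring.
have w0 : 0 <= eta ^+ 3 * (K * L * M) by rewrite !mulr_ge0 ?exprn_ge0.
rewrite -(mulrA _ (eta ^+ 3)); move: t1 t2 w0.
by move: (cmod _) (cmod _) (eta ^+ 3 * _) => *; lra.
Qed.

(** Expanding the two commutators gives four words, each rotated cyclically into a sandwich that
    [bm_sandwich] evaluates exactly; $q_s^2=q_s$ then merges the four products into three. *)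
Lemma rot_incr0_second B C : F s B -> F s C ->
  tr (rot_incr0 * B * rot_incr0 * C) =
  h%:C * (tr (q s * B) * tr C + tr B * tr (q s * C) - 2 * tr (q s * B) * tr (q s * C)).
Proof.
move=> FB FC; rewrite /rot_incr0.
have qq : q s * q s = q s by case: (rotated_projection s0).
have -> : tr ('i *: (x * q s - q s * x) * B * ('i *: (x * q s - q s * x)) * C) =
   - (tr (x * (q s * B) * x * (q s * C)) - tr (x * (q s * B * q s) * x * C)
     - tr (x * B * x * (q s * C * q s)) + tr (x * (B * q s) * x * (C * q s))).
  have -> : tr (x * B * x * (q s * C * q s)) = tr (q s * x * B * x * q s * C).
    by move: (x) (q s) => z p; rewrite -!mulrA [RHS]trC// -!mulrA.
  have -> : tr (x * (B * q s) * x * (C * q s)) = tr (q s * x * B * q s * x * C).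
    by move: (x) (q s) => z p; rewrite -!mulrA [RHS]trC// -!mulrA.
  rewrite -!(scalerAl, scalerAr) scalerA -expr2 sqr_i scaleN1r trN; congr (- _).
  rewrite -!trB -trD; congr tr; move: (x) (q s) => z p.
  by rewrite !(mulrBl, mulrBr) !mulrA; zmodule.
have FqB := Fm Fsq FB; have FqC := Fm Fsq FC.
have FqBq := Fm FqB Fsq; have FqCq := Fm FqC Fsq.
have FBq := Fm FB Fsq; have FCq := Fm FC Fsq.
rewrite !(bm_sandwich st hF hX s0 s_t)//.
have e (Z : A) : tr (q s * Z * q s) = tr (q s * Z) by rewrite trC// mulrA qq.
rewrite !e (trC st B) (trC st C).
by ring.
Qed.

End Step.
End ProjectionIncrements.

(** * Approximate resolvents *)

Section GeometricPolynomial.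
Variable R : realType.
Implicit Types (c w z : R[i]) (k : nat).

(* Partial sums of the expansion of 1/(z - X) around [c], for w = 1/(z - c). *)
Fixpoint geom_poly c w k : {poly R[i]} :=
  if k is k'.+1 then w *: (1 + ('X - c%:P) * geom_poly c w k') else 0.

Lemma geom_polyE c w z k : w * (z - c) = 1 ->
  (z%:P - 'X) * geom_poly c w k = 1 - (w *: ('X - c%:P)) ^+ k.
Proof.
move=> wz; elim: k => [|k IH]; first by rewrite mulr0 expr0 subrr.
have wz' : w%:P * (z%:P - c%:P) = 1 by rewrite -polyCB -polyCM wz.
rewrite exprS /= -!mul_polyC; rewrite -!mul_polyC in IH.
move: wz' IH; move: (geom_poly c w k) (w%:P) (z%:P) (c%:P) => p u v d.
move: ((_ * _) ^+ k) => e uv IH.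
have -> : e = 1 - (v - 'X) * p by rewrite IH opprB addrC subrK.
have -> : (v - 'X) * (u * (1 + ('X - d) * p)) =
  u * (v - d) * (1 + ('X - d) * p) - u * ('X - d) * (1 + ('X - d) * p) by ring.
have -> : u * ('X - d) * (1 - (v - 'X) * p) =
  u * ('X - d) - u * (v - d) * ('X - d) * p + u * ('X - d) * ('X - d) * p by ring.
by rewrite uv; ring.
Qed.

(** The bound is the fixed point of $b\mapsto|w|(1+rb)$, the recursion obeyed by the moduli, so it
    holds for every [k]. [geom_opb] repeats this for operators. *)
Lemma geom_poly_le c w (r x : R) k : cmod w * r < 1 -> 0 <= r ->
  cmod (x%:C - c) <= r -> cmod (geom_poly c w k).[x%:C] <= cmod w / (1 - cmod w * r).
Proof.
move=> wr r0 xr; have d0 : 0 < 1 - cmod w * r by rewrite subr_gt0.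
elim: k => [|k IH]; first by rewrite horner0 cmod0 divr_ge0 ?cmod_ge0// ltW.
rewrite /= hornerZ !hornerE cmodM.
apply: (@le_trans _ _ (cmod w * (1 + r * (cmod w / (1 - cmod w * r))))).
  rewrite ler_wpM2l ?cmod_ge0// (le_trans (cmodD _ _))// cmod1 lerD2l cmodM.
  by rewrite ler_pM ?cmod_ge0.
by rewrite le_eqVlt; apply/orP; left; apply/eqP; field; rewrite gt_eqF.
Qed.

Lemma geom_poly_error c w z (r x : R) k : w * (z - c) = 1 -> 0 <= r ->
  cmod (x%:C - c) <= r ->
  cmod (1 - (z - x%:C) * (geom_poly c w k).[x%:C]) <= (cmod w * r) ^+ k.
Proof.
move=> wz r0 xr; have := congr1 (fun p => p.[x%:C]) (geom_polyE k wz).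
rewrite !hornerE => ->.
rewrite opprB addrC subrK cmodX; apply: lerXn2r; rewrite ?nnegrE ?mulr_ge0 ?cmod_ge0//.
by rewrite cmodM ler_wpM2l ?cmod_ge0.
Qed.

End GeometricPolynomial.

Section PolynomialCalculus.
Variables (R : realType) (A : vonNeumannAlgebra R) (Phi : {scalar A}).
Hypothesis st : faithful_normal_tracial_state Phi.
Local Notation tr := (tr Phi).
Local Notation nrm := (nrm Phi).
Local Notation opb := (opb Phi).

Definition pev (a : A) (p : {poly R[i]}) : A := horner_alg a p.

Lemma pevM a p q : pev a (p * q) = pev a p * pev a q.
Proof. exact: rmorphM. Qed.

Lemma pevD a p q : pev a (p + q) = pev a p + pev a q.
Proof. exact: rmorphD. Qed.

Lemma pevB a p q : pev a (p - q) = pev a p - pev a q.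
Proof. exact: rmorphB. Qed.

Lemma pev1 a : pev a 1 = 1.
Proof. exact: rmorph1. Qed.

Lemma pev0 a : pev a 0 = 0.
Proof. exact: rmorph0. Qed.

Lemma pevXn a p n : pev a (p ^+ n) = pev a p ^+ n.
Proof. exact: rmorphXn. Qed.

Lemma pevX a : pev a 'X = a.
Proof. exact: horner_algX. Qed.

Lemma pevC a c : pev a c%:P = c *: 1.
Proof. exact: horner_algC. Qed.

Lemma pevZ a c p : pev a (c *: p) = c *: pev a p.
Proof. by rewrite -mul_polyC pevM pevC -scalerAl mul1r. Qed.

Lemma pev_mem (S : set A) a p : unital_star_subalgebra S -> S a -> S (pev a p).
Proof.
move=> hS Sa; elim/poly_ind: p => [|p c IH]; first by rewrite pev0; exact: usa_0.
rewrite pevD pevM pevX pevC; apply: (usa_add hS); first exact: usa_mul.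
by apply: (usa_scale hS); exact: usa_1.
Qed.

Lemma pev_comm a b p : a * b = b * a -> pev a p * b = b * pev a p.
Proof.
move=> ab; elim/poly_ind: p => [|p c IH]; first by rewrite pev0 mulr0 mul0r.
rewrite pevD pevM pevX pevC mulrDl mulrDr -mulrA ab !mulrA IH.
by rewrite -scalerAl -scalerAr mul1r mulr1.
Qed.

Lemma geom_opb a c w (r : R) k : cmod w * r < 1 -> opb r (a - c *: 1) ->
  opb (cmod w / (1 - cmod w * r)) (pev a (geom_poly c w k)).
Proof.
move=> wr oa; have d0 : 0 < 1 - cmod w * r by rewrite subr_gt0.
elim: k => [|k IH]; first by rewrite pev0; apply: (opbW _ (opb0 Phi)); rewrite divr_ge0 ?cmod_ge0// ltW.
rewrite /= pevZ pevD pev1 pevM pevB pevX pevC.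
have := opbZ st w (opbD st (opb1 Phi) (opbM oa IH)).
by rewrite (_ : _ * (1 + _) = cmod w / (1 - cmod w * r))//; field; rewrite gt_eqF.
Qed.

Lemma geom_resolvent a c w z k : w * (z - c) = 1 ->
  (z *: 1 - a) * pev a (geom_poly c w k) = 1 - (w *: (a - c *: 1)) ^+ k.
Proof.
move=> wz; have := congr1 (pev a) (geom_polyE k wz).
by rewrite pevM !pevB pev1 pevXn pevZ !pevB pevX !pevC.
Qed.

End PolynomialCalculus.

(** Three substitutions of $T=S+TdS+e$. The later resolvent $T$ survives in the cubic term only,
    where a bound suffices; [e] is the defect of approximate inverses. *)
Lemma resolvent_expand (B : pzRingType) (p S T d e : B) : T - S = T * d * S + e ->
  p * T - p * S = p * S * d * S + p * S * d * S * d * S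
    + p * T * d * S * d * S * d * S + p * (e * (1 + d * S + d * S * d * S)).
Proof.
move=> TS; have eT : T = S + T * d * S + e by rewrite -addrA -TS addrC subrK.
have x1 : p * T - p * S = p * T * d * S + p * e by rewrite -mulrBr TS mulrDr !mulrA.
have x2 : p * T * d * S = p * S * d * S + p * T * d * S * d * S + p * e * d * S.
  by rewrite {1}eT !(mulrDl, mulrDr) !mulrA.
have x3 : p * T * d * S * d * S = p * S * d * S * d * S + p * T * d * S * d * S * d * S
    + p * e * d * S * d * S.
  by rewrite {1}eT !(mulrDl, mulrDr) !mulrA.
by rewrite x1 [in LHS]x2 [in LHS]x3 !(mulrDl, mulrDr) !mulrA mulr1; zmodule.
Qed.

Lemma step_const_le (R : realFieldType) (a b c L e p : R) :
  0 <= a -> 0 <= b -> 0 <= c -> 0 <= L -> 0 <= e -> 0 <= p ->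
  a * e * L ^+ 2 + b * e * (L * L ^+ 2) + c * e * (L * L * L ^+ 2)
    + 2 * L * (1 + 2 * L + 4 * L ^+ 2) * p
  <= (a * L ^+ 2 + b * L ^+ 3 + c * L ^+ 4 + 2 * L * (1 + 2 * L + 4 * L ^+ 2)) * (e + p).
Proof.
move=> a0 b0 c0 L0 e0 p0; set d := 2 * L * _.
have d0 : 0 <= d by rewrite !(addr_ge0, mulr_ge0) ?exprn_ge0.
rewrite -subr_ge0.
rewrite (_ : _ - _ = (a * L ^+ 2 + b * L ^+ 3 + c * L ^+ 4) * p + d * e); last by ring.
by rewrite !(addr_ge0, mulr_ge0) ?exprn_ge0.
Qed.

(** * One time step for the approximate resolvent *)

Section JacobiStep.
Variables (R : realType) (A : vonNeumannAlgebra R) (Phi : {scalar A}).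
Hypothesis st : faithful_normal_tracial_state Phi.
Variables (F : R -> set A) (X Y : R -> A) (P Q : A) (theta : R).
Hypothesis hF : filtration F.
Hypothesis hX : free_brownian_motion Phi F X.
Hypothesis hY : free_multiplicative_brownian_motion Phi F X Y.
Hypotheses (projQ : projection Q) (FQ : F 0 Q) (trQ : Phi Q = theta%:C).
Hypotheses (projP : projection P) (FP : F 0 P).
Local Notation tr := (tr Phi).
Local Notation nrm := (nrm Phi).
Local Notation opb := (opb Phi).
Local Notation l2 := (l2sq Phi).
Local Notation q := (rotated Y Q).
Local Notation J := (jacobi Y P Q).

Lemma jacobiE t : J t = P * q t * P.
Proof. by rewrite /jacobi /rotated !mulrA. Qed.

Let sP : star P = P. Proof. exact: projP.1. Qed.
Let PP : P * P = P. Proof. exact: projP.2. Qed.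

Lemma jacobi_star t : 0 <= t -> star (J t) = J t.
Proof.
move=> t0; have [sq _] := rotated_projection hY projQ t0.
rewrite jacobiE; move: (q t) sq => p sp; by rewrite !starM sP sp mulrA.
Qed.

Lemma jacobi_Pl t : P * J t = J t.
Proof. by rewrite jacobiE; move: (q t) => p; rewrite !mulrA PP. Qed.

Lemma jacobi_Pr t : J t * P = J t.
Proof. by rewrite jacobiE; move: (q t) => p; rewrite -!mulrA PP. Qed.

Lemma jacobi_adapted t : 0 <= t -> F t (J t).
Proof.
move=> t0; have hu := filt_algebra hF t0; rewrite jacobiE.
have FPt : F t P by exact: (filt_mono hF (lexx 0) t0).
apply: (usa_mul hu) => //; apply: (usa_mul hu) => //.
exact: (rotated_adapted hF hY).
Qed.

(* 0 <= J <= 1 enters through J - J^2 = k^* k. *)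
Lemma jacobi_sub_sqr t : 0 <= t ->
  exists k, J t - J t * J t = star k * k.
Proof.
move=> t0; have [sq qq] := rotated_projection hY projQ t0.
exists ((1 - P) * q t * P).
rewrite jacobiE; move: (q t) sq qq => p sp pp; rewrite !starM starB star1 sP sp.
have e : (1 - P) * (1 - P) = 1 - P.
  by rewrite mulrBl mul1r mulrBr mulr1 PP; zmodule.
transitivity (P * p * ((1 - P) * (1 - P)) * p * P); last by rewrite !mulrA.
rewrite e mulrBr mulr1 !mulrBl -(mulrA P p p) pp.
by rewrite -!mulrA (mulrA P P) PP.
Qed.

(** The centre has real part $\frac12$, so $c+\bar c=1$ and
    $(J-c)^\star(J-c)=|c|^2-(J-J^2)=r^2-k^\star k$, which is at most $r^2$. *)
Lemma jacobi_center_opb t (M : R) : 0 <= t ->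
  opb (Num.sqrt (4^-1 + M ^+ 2)) (J t - (2^-1 +i* M) *: 1).
Proof.
move=> t0; have [k ek] := jacobi_sub_sqr t0; have sJ := jacobi_star t0.
set c := _ +i* _; set r2 := 4^-1 + M ^+ 2.
have r20 : 0 <= r2 by rewrite addr_ge0 ?sqr_ge0// invr_ge0.
have cc : conjc c * c = r2%:C.
  by rewrite /c /r2; apply/eqP; rewrite eq_complex /=; apply/andP; split; apply/eqP; field.
have cD : conjc c + c = 1.
  by rewrite /c; apply/eqP; rewrite eq_complex /=; apply/andP; split; apply/eqP; field.
have sc : star (J t - c *: 1) = J t - conjc c *: 1 by rewrite starB starZ star1 sJ.
have expand d e : d * e = r2%:C -> d + e = 1 ->
    (J t - d *: 1) * (J t - e *: 1) = r2%:C *: 1 - star k * k.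
  move=> de d_e; rewrite -ek !(mulrBl, mulrBr) -!scalerAl -!scalerAr !mul1r !mulr1 scalerA.
  rewrite de; have eJ : J t = d *: J t + e *: J t by rewrite -scalerDl d_e scale1r.
  rewrite [X in _ = _ - (X - _)]eJ; zmodule.
have e1 := expand _ _ cc cD.
have e2 : (J t - c *: 1) * (J t - conjc c *: 1) = r2%:C *: 1 - star k * k.
  by apply: expand; rewrite 1?mulrC 1?addrC.
have le (T : A) : star T * T = r2%:C *: 1 - star k * k -> forall b, l2 (T * b) <= r2 * l2 b.
  move=> eT b; rewrite l2E /ip starM -mulrA (mulrA (star T)) eT.
  rewrite mulrBl mulrBr trB -scalerAl mul1r trZr ReB ReZ -mulrA (mulrA (star b)) -starM.
  by rewrite -/(ip Phi (k * b) (k * b)) -l2E gerBl l2_ge0.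
apply: opbP; first exact: sqrtr_ge0.
  by move=> b; rewrite sqr_sqrtr//; apply: le; rewrite sc.
move=> b; rewrite sqr_sqrtr// -(l2_star st) starM sc -(l2_star st b).
apply: le; rewrite (_ : star _ = J t - c *: 1); first exact: e2.
by rewrite starB starZ star1 sJ; congr (_ - _ *: _); exact: conjcK.
Qed.

Lemma pev_corner t p : P * pev (J t) p = pev (J t) p * P.
Proof. by apply/esym/pev_comm; rewrite jacobi_Pl jacobi_Pr. Qed.

Variables (z c w : R[i]) (r : R).
Hypothesis hw : w * (z - c) = 1.
Hypothesis hr : cmod w * r < 1.
Hypothesis hJ : forall t, 0 <= t -> opb r (J t - c *: 1).

Let L := cmod w / (1 - cmod w * r).
Definition resolvent (k : nat) (t : R) : A := pev (J t) (geom_poly c w k).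

Lemma resolvent_opb k t : 0 <= t -> opb L (resolvent k t).
Proof. by move=> t0; apply: (geom_opb st) => //; exact: hJ. Qed.

Let L0 : 0 <= L.
Proof. exact: (opb_ge0 (resolvent_opb 0 (lexx 0))). Qed.

Lemma resolvent_adapted k t : 0 <= t -> F t (resolvent k t).
Proof.
by move=> t0; apply: pev_mem; [exact: (filt_algebra hF)|exact: jacobi_adapted].
Qed.

Lemma resolvent_P k t : P * resolvent k t = resolvent k t * P.
Proof. exact: pev_corner. Qed.

Let rho := cmod w * r.
Let err k t : A := (w *: (J t - c *: 1)) ^+ k.

Lemma err_opb k t : 0 <= t -> opb (rho ^+ k) (err k t).
Proof. by move=> t0; apply: opbX; apply: (opbZ st); exact: hJ. Qed.

Lemma resolvent_eql k t : (z *: 1 - J t) * resolvent k t = 1 - err k t.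
Proof. exact: geom_resolvent. Qed.

Lemma resolvent_eqr k t : resolvent k t * (z *: 1 - J t) = 1 - err k t.
Proof.
rewrite -resolvent_eql; apply: pev_comm.
by rewrite mulrBr mulrBl -scalerAl -scalerAr mul1r mulr1.
Qed.

(** The resolvent identity, with the defects of the two approximate inverses as an extra term. *)
Lemma resolvent_diff k s t : resolvent k t - resolvent k s =
  resolvent k t * (J t - J s) * resolvent k s
  + (resolvent k t * err k s - err k t * resolvent k s).
Proof.
have e1 : resolvent k t * (z *: 1 - J s) * resolvent k s = resolvent k t - resolvent k t * err k s.
  by rewrite -mulrA resolvent_eql mulrBr mulr1.
have e2 : resolvent k t * (z *: 1 - J t) * resolvent k s = resolvent k s - err k t * resolvent k s.
  by rewrite resolvent_eqr mulrBl mul1r.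
have -> : J t - J s = (z *: 1 - J s) - (z *: 1 - J t) by zmodule.
by rewrite mulrBr mulrBl e1 e2; zmodule.
Qed.

(** The terms [theta%:C * b1 - b2] are the drift in [rot_incr_mean] for $B=PS^2$; the others are
    [rot_incr0_second] for $B=PS$, $C=PS^2$, with $S$ the approximate resolvent. *)
Definition gen_rhs k s : R[i] :=
  let a1 := tr (P * resolvent k s) in
  let b1 := tr (P * resolvent k s * resolvent k s) in
  let a2 := tr (J s * resolvent k s) in
  let b2 := tr (J s * resolvent k s * resolvent k s) in
  theta%:C * b1 - b2 + a2 * b1 + a1 * b2 - 2 * a2 * b2.

(** The constants of [rot_incr_mean], [rot_incr_second] and [rot_incr_third] appear with one factor
    [L] for each resolvent; the last term bounds the contribution of the defect. *)
Definition step_const : R :=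
  152 * L ^+ 2 + 2580 * L ^+ 3 + 8000 * L ^+ 4 + 2 * L * (1 + 2 * L + 4 * L ^+ 2).

Let opbP1 : opb 1 P. Proof. exact: (opb_projection st). Qed.

Lemma resolvent_step k s t : 0 <= s -> s <= t -> t - s <= 1 ->
  cmod (tr (P * resolvent k t) - tr (P * resolvent k s) - (t - s)%:C * gen_rhs k s)
    <= step_const * (Num.sqrt (t - s) ^+ 3 + rho ^+ k).
Proof.
move=> s0 s_t ts1; have t0 := le_trans s0 s_t.
set S := resolvent k s; set T := resolvent k t; set h := t - s; set eta := Num.sqrt _.
have eta0 : 0 <= eta by exact: sqrtr_ge0.
have oS : opb L S by exact: resolvent_opb.
have oT : opb L T by exact: resolvent_opb.
have FS : F s S by exact: resolvent_adapted.
have FsP : F s P by exact: (filt_mono hF (lexx 0) s0).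
have hu := filt_algebra hF s0.
pose d := J t - J s; pose e := T * err k s - err k t * S.
(* Cyclicity strips the projections off [d] and leaves these words between increments of $q$. [B1]
   and [B2] lie in $\mathscr A_s$, as the first and second order terms require; [C] contains [T],
   hence it may enter the cubic term only. *)
pose B1 := P * S * P; pose B2 := P * S * P * S * P; pose C := P * S * P * T * P.
have oB1 : opb L B1.
  by rewrite -[L]mulr1 -[L]mul1r; apply: opbM => //; exact: opbM.
have oB2 : opb (L ^+ 2) B2.
  by rewrite -[L ^+ 2]mulr1 expr2; apply: opbM => //; exact: opbM.
have oC : opb (L ^+ 2) C.
  by rewrite -[L ^+ 2]mulr1 expr2; apply: opbM => //; exact: opbM.
have FB1 : F s B1 by do 2 (apply: (usa_mul hu) => //).
have FB2 : F s B2 by do 4 (apply: (usa_mul hu) => //).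
pose del := rot_incr Y Q s t.
have ed : d = P * del * P by rewrite /d !jacobiE /del /rot_incr mulrBr mulrBl.
have od : opb 2 d.
  rewrite ed -[2]mulr1 -[2]mul1r; apply: opbM => //; apply: opbM => //.
  exact: (rot_incr_opb st hY projQ).
have TS : T - S = T * d * S + e by exact: resolvent_diff.
have exp := resolvent_expand P TS.
have PS : P * S = S * P by exact: resolvent_P.
have PT : P * T = T * P by exact: resolvent_P.
have t1 : tr (P * S * d * S) = tr (del * B2).
  rewrite ed /B2; move: (del) (S) => dl S'.
  by rewrite -!mulrA (trC st P) -!mulrA (trC st S') -!mulrA (trC st P) -!mulrA.
have t2 : tr (P * S * d * S * d * S) = tr (del * B1 * del * B2).
  rewrite ed /B1 /B2; move: (del) (S) => dl S'.
  by rewrite -!mulrA (trC st P) -!mulrA (trC st S') -!mulrA (trC st P) -!mulrA.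
have t3 : tr (P * T * d * S * d * S * d * S) = tr (del * B1 * del * B1 * del * C).
  rewrite ed /B1 /C; move: (del) (S) (T) => dl S' T'.
  by rewrite -!mulrA (trC st P) -!mulrA (trC st T') -!mulrA (trC st P) -!mulrA.
have eB1 : P * S * P = P * S by rewrite PS -mulrA PP.
have eB2 : P * S * S * P = P * S * S by rewrite -mulrA -PS mulrA eB1.
have v1 : B1 = P * S by [].
have v2 : B2 = P * S * S by rewrite /B2 eB1 eB2.
have w1 : tr (q s * B1) = tr (J s * S).
  rewrite v1 jacobiE -{1}eB1; move: (q s) => p.
  by rewrite mulrA trC// !mulrA.
have w2 : tr (q s * B2) = tr (J s * S * S).
  rewrite v2 jacobiE -{1}eB2; move: (q s) => p.
  by rewrite mulrA trC// !mulrA.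
have eta3 : 0 <= eta ^+ 3 by rewrite exprn_ge0.
have rhok : 0 <= rho ^+ k by rewrite exprn_ge0// mulr_ge0 ?cmod_ge0//; exact: (opb_ge0 (hJ s0)).
have c1 := rot_incr_mean st hF hX hY projQ FQ trQ s0 s_t ts1 FB2 oB2.
have c2 := rot_incr_second st hF hX hY projQ s0 s_t ts1 oB1 oB2.
rewrite (rot_incr0_second st hF hX hY projQ FQ s0 s_t FB1 FB2) in c2.
have c3 := rot_incr_third st hF hX hY projQ s0 s_t ts1 oB1 oB1 oC.
have oe : opb (2 * L * rho ^+ k) e.
  rewrite (_ : 2 * L * rho ^+ k = L * rho ^+ k + rho ^+ k * L); last by ring.
  by apply: (opbB st); apply: opbM => //; exact: err_opb.
have c4 : cmod (tr (P * (e * (1 + d * S + d * S * d * S))))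
    <= 2 * L * (1 + 2 * L + 4 * L ^+ 2) * rho ^+ k.
  rewrite (le_trans (tr_le1 st _))//.
  have o := opbM opbP1 (opbM oe (opbD st (opbD st (opb1 Phi) (opbM od oS)) (opbM (opbM (opbM od oS) od) oS))).
  rewrite (le_trans (opb_nrm st o))// le_eqVlt; apply/orP; left; apply/eqP.
  by ring.
have split : tr (P * T) - tr (P * S) - h%:C * gen_rhs k s =
    (tr (del * B2) - h%:C * (theta%:C * tr B2 - tr (q s * B2)))
  + (tr (del * B1 * del * B2) - h%:C * (tr (q s * B1) * tr B2 + tr B1 * tr (q s * B2)
       - 2 * tr (q s * B1) * tr (q s * B2)))
  + tr (del * B1 * del * B1 * del * C) + tr (P * (e * (1 + d * S + d * S * d * S))).
  rewrite -trB exp !trD t1 t2 t3 /gen_rhs -/S w1 w2 -v2 -v1.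
  by ring.
rewrite split (le_trans (cmodD _ _))// (le_trans (lerD (cmodD _ _) (lexx _)))//.
rewrite (le_trans (lerD (lerD (cmodD _ _) (lexx _)) (lexx _)))//.
rewrite (le_trans (lerD (lerD (lerD c1 c2) c3) c4))//.
exact: (step_const_le (ler0n R 152) (ler0n R 2580) (ler0n R 8000) L0 eta3 rhok).
Qed.

(** In the limit in [k] this yields the Hölder continuity in time of the Cauchy transform. *)
Lemma resolvent_holder k s t : 0 <= s -> s <= t -> t - s <= 1 ->
  nrm (resolvent k t - resolvent k s)
    <= 28 * L ^+ 2 * Num.sqrt (t - s) + 2 * L * rho ^+ k.
Proof.
move=> s0 s_t ts1; have t0 := le_trans s0 s_t.
have oS : opb L (resolvent k s) by exact: resolvent_opb.
have oT : opb L (resolvent k t) by exact: resolvent_opb.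
rewrite resolvent_diff (le_trans (nrmD st _ _))// lerD//.
  have nd : nrm (J t - J s) <= 28 * Num.sqrt (t - s).
    have -> : J t - J s = P * rot_incr Y Q s t * P.
      by rewrite !jacobiE /rot_incr mulrBr mulrBl.
    rewrite (le_trans (opb1r _ opbP1))// (le_trans (opb1l _ opbP1))//.
    exact: (rot_incr_nrm st hF hX hY projQ s0 s_t ts1).
  rewrite (le_trans (opbr _ oS))//.
  apply: (@mul_le_eq _ _ _ L (L * (28 * Num.sqrt (t - s)))); rewrite ?nrm_ge0//.
    by rewrite (le_trans (opbl _ oT))// ler_wpM2l.
  by ring.
apply: (opb_nrm st); rewrite (_ : 2 * L * rho ^+ k = L * rho ^+ k + rho ^+ k * L); last by ring.
by apply: (opbB st); apply: opbM => //; exact: err_opb.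
Qed.

Lemma resolvent_sqr_holder k s t : 0 <= s -> s <= t -> t - s <= 1 ->
  nrm (resolvent k t * resolvent k t - resolvent k s * resolvent k s)
    <= 2 * L * (28 * L ^+ 2 * Num.sqrt (t - s) + 2 * L * rho ^+ k).
Proof.
move=> s0 s_t ts1; have t0 := le_trans s0 s_t.
have oS : opb L (resolvent k s) by exact: resolvent_opb.
have oT : opb L (resolvent k t) by exact: resolvent_opb.
have h := resolvent_holder k s0 s_t ts1.
move: (resolvent k s) (resolvent k t) oS oT h => S T oS oT h.
have -> : T * T - S * S = (T - S) * T + S * (T - S).
  by rewrite !(mulrBl, mulrBr); zmodule.
rewrite (le_trans (nrmD st _ _))// -mulrA mulr_natl mulr2n lerD//.
  by rewrite (le_trans (opbr _ oT))// ler_wpM2l.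
by rewrite (le_trans (opbl _ oS))// ler_wpM2l.
Qed.

End JacobiStep.

(** * Complex valued limits and integrals *)

Section ComplexLimits.
Variables (R : realType) (T : Type) (F : set_system T).
Context {FF : Filter F}.
Implicit Types (f g : T -> R[i]) (l m : R[i]).
Local Notation Re := complex.Re.
Local Notation Im := complex.Im.

(** Limits are componentwise, like [cintegral], so that real limit theorems apply to each part. *)
Definition cclim f l := (Re (f x) @[x --> F] --> Re l) /\ (Im (f x) @[x --> F] --> Im l).

Lemma cclim_cst l : cclim (fun=> l) l.
Proof. by split; exact: cvg_cst. Qed.

Lemma cclimD f g l m : cclim f l -> cclim g m -> cclim (fun x => f x + g x) (l + m).
Proof.
move=> [f1 f2] [g1 g2]; split; rewrite ?ReD ?ImD.
  by under eq_fun do rewrite ReD; exact: cvgD.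
by under eq_fun do rewrite ImD; exact: cvgD.
Qed.

Lemma cclimN f l : cclim f l -> cclim (fun x => - f x) (- l).
Proof.
move=> [f1 f2]; split; rewrite ?ReN ?ImN.
  by under eq_fun do rewrite ReN; exact: cvgN.
by under eq_fun do rewrite ImN; exact: cvgN.
Qed.

Lemma cclimB f g l m : cclim f l -> cclim g m -> cclim (fun x => f x - g x) (l - m).
Proof. by move=> hf hg; apply: cclimD => //; exact: cclimN. Qed.

Lemma ReM (z w : R[i]) : Re (z * w) = Re z * Re w - Im z * Im w.
Proof. by case: z => a b; case: w. Qed.

Lemma ImM (z w : R[i]) : Im (z * w) = Re z * Im w + Im z * Re w.
Proof. by case: z => a b; case: w. Qed.

Lemma cclimM f g l m : cclim f l -> cclim g m -> cclim (fun x => f x * g x) (l * m).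
Proof.
move=> [f1 f2] [g1 g2]; split; rewrite ?ReM ?ImM.
  by under eq_fun do rewrite ReM; apply: cvgB; exact: cvgM.
by under eq_fun do rewrite ImM; apply: cvgD; exact: cvgM.
Qed.

Lemma ReV (z : R[i]) : Re z^-1 = Re z / (Re z ^+ 2 + Im z ^+ 2).
Proof. by case: z. Qed.

Lemma ImV (z : R[i]) : Im z^-1 = - Im z / (Re z ^+ 2 + Im z ^+ 2).
Proof. by case: z => a b; rewrite mulNr. Qed.

Lemma cclimV f l : l != 0 -> cclim f l -> cclim (fun x => (f x)^-1) l^-1.
Proof.
move=> l0 [f1 f2].
have n0 : Re l ^+ 2 + Im l ^+ 2 != 0.
  apply: contra l0; rewrite paddr_eq0 ?sqr_ge0// !sqrf_eq0 => /andP[/eqP a /eqP b].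
  by rewrite eq_complex a b !eqxx.
have h : (Re (f x) ^+ 2 + Im (f x) ^+ 2 : R) @[x --> F] --> Re l ^+ 2 + Im l ^+ 2.
  by apply: cvgD; rewrite !expr2; under eq_fun do rewrite expr2; exact: cvgM.
split; rewrite ?ReV ?ImV.
  by under eq_fun do rewrite ReV; apply: cvgM => //; exact: cvgV.
by under eq_fun do rewrite ImV; apply: cvgM; [exact: cvgN|exact: cvgV].
Qed.

End ComplexLimits.

Lemma cclim_le (R : realType) (T : topologicalType) (F : set_system T) {PF : ProperFilter F}
    (f : T -> R[i]) l (b : T -> R) (c : R) :
  cclim F f l -> b x @[x --> F] --> c ->
  (\forall x \near F, cmod (f x) <= b x) -> cmod l <= c.
Proof.
move=> [f1 f2] hb hfb.
have h : cmod (f x) @[x --> F] --> cmod l.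
  rewrite /cmod; apply: (continuous_cvg _ (@sqrt_continuous R _)).
  by apply: cvgD; rewrite !expr2; under eq_fun do rewrite expr2; exact: cvgM.
exact: (ler_cvg_to h hb hfb).
Qed.

Lemma cclim_geometric (R : realType) (u : nat -> R[i]) l (C r : R) : 0 <= r -> r < 1 ->
  (forall k, cmod (u k - l) <= C * r ^+ k) -> cclim \oo u l.
Proof.
move=> r0 r1 h.
have z : C * r ^+ k @[k --> \oo] --> (0 : R).
  rewrite -[0](mulr0 C); apply: cvgM; first exact: cvg_cst.
  by apply: cvg_expr; rewrite ger0_norm.
have aux (f : nat -> R) (a : R) : (forall k, `|f k - a| <= C * r ^+ k) -> f k @[k --> \oo] --> a.
  move=> hf; apply/subr_cvg0; apply: (@squeeze_cvgr _ _ _ _ (fun k => - (C * r ^+ k)) (fun k => C * r ^+ k)) => //.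
    by apply: nearW => k; rewrite -ler_norml.
  by rewrite -oppr0; exact: cvgN.
split; apply: aux => k; rewrite -?ReB; apply: le_trans (h k).
  exact: Re_le_cmod.
by rewrite -ImN -ImD Im_le_cmod.
Qed.

Section ComplexIntegral.
Variable R : realType.
Variables (m : {measure set (measurableTypeR R) -> \bar R}) (D : set (measurableTypeR R)).
Hypothesis mD : measurable D.
Implicit Types (f g : R -> R[i]).
Local Notation Re := complex.Re.
Local Notation Im := complex.Im.

Definition cintegrable f :=
  m.-integrable D (EFin \o (fun x => Re (f x))) /\
  m.-integrable D (EFin \o (fun x => Im (f x))).

Lemma cintegralD f g : cintegrable f -> cintegrable g ->
  cintegral m D (fun x => f x + g x) = cintegral m D f + cintegral m D g.
Proof.
move=> [f1 f2] [g1 g2]; rewrite /cintegral; apply/eqP; rewrite eq_complex /=.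
apply/andP; split; apply/eqP.
  by under eq_Rintegral do rewrite ReD; rewrite RintegralD.
by under eq_Rintegral do rewrite ImD; rewrite RintegralD.
Qed.

Lemma cintegralZ (c : R[i]) f : cintegrable f ->
  cintegral m D (fun x => c * f x) = c * cintegral m D f.
Proof.
move=> [f1 f2]; have z (a : R) h : m.-integrable D (EFin \o h) ->
    m.-integrable D (EFin \o (fun x => a * h x)).
  by move=> hh; rewrite (_ : _ \o _ = (fun x => a%:E * (h x)%:E)%E)//; exact: integrableZl.
rewrite /cintegral; apply/eqP; rewrite eq_complex ReM ImM /=.
apply/andP; split; apply/eqP.
  under eq_Rintegral do rewrite ReM.
  by rewrite RintegralB ?RintegralZl//; exact: z.
under eq_Rintegral do rewrite ImM.
by rewrite RintegralD ?RintegralZl//; exact: z.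
Qed.

Lemma cintegrableD f g : cintegrable f -> cintegrable g -> cintegrable (fun x => f x + g x).
Proof.
move=> [f1 f2] [g1 g2]; split.
  rewrite (_ : _ \o _ = ((EFin \o (fun x => Re (f x))) \+ (EFin \o (fun x => Re (g x))))%E).
    exact: integrableD.
  by apply/funext => x /=; rewrite ReD.
rewrite (_ : _ \o _ = ((EFin \o (fun x => Im (f x))) \+ (EFin \o (fun x => Im (g x))))%E).
  exact: integrableD.
by apply/funext => x /=; rewrite ImD.
Qed.

(** The factor 2 comes from estimating real and imaginary parts separately; only the order of
    magnitude matters later. *)
Lemma cintegral_le f (M : R) : (m D < +oo)%E -> cintegrable f ->
  (forall x, D x -> cmod (f x) <= M) -> cmod (cintegral m D f) <= 2 * (M * fine (m D)).
Proof.
move=> Dfin [f1 f2] fM.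
have b (h : R -> R) : m.-integrable D (EFin \o h) -> (forall x, D x -> `|h x| <= M) ->
    `|\int[m]_(x in D) h x| <= M * fine (m D).
  move=> ih hM; rewrite (le_trans (le_normr_Rintegral mD ih))// -Rintegral_cst//.
  apply: le_Rintegral => //.
    exact: (integrable_norm ih).
  apply: measurable_bounded_integrable => //.
  by exists `|M|; split=> [|N MN x _ /=]; [exact: num_real|exact: ltW].
rewrite (le_trans (cmod_le_ReIm _))// mulr_natl mulr2n /cintegral /=.
apply: lerD; apply: b => // x /fM; apply: le_trans; [exact: Re_le_cmod|exact: Im_le_cmod].
Qed.

Lemma eq_cintegral f g : (forall x, D x -> f x = g x) -> cintegral m D f = cintegral m D g.
Proof.
move=> fg; rewrite /cintegral; congr (_ +i* _); apply: eq_Rintegral => x; rewrite inE => /fg.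
  by move=> ->.
by move=> ->.
Qed.

End ComplexIntegral.

(** * Hölder functions of time and their integrals *)

Section Holder.
Variable R : realType.
Implicit Types (f g : R -> R[i]).
Local Notation leb := (@lebesgue_measure R).

(** Boundedness is included to make the class stable under products. Half-Hölder regularity gives
    integrability and, for the integral, increments $hf(s)+O(h^{3/2})$. *)
Definition cholder f :=
  (exists2 B, 0 <= B & forall s, 0 <= s -> cmod (f s) <= B) /\
  (exists2 C, 0 <= C & forall s t, 0 <= s -> s <= t -> t - s <= 1 ->
    cmod (f t - f s) <= C * Num.sqrt (t - s)).

Lemma cholder_cst (c : R[i]) : cholder (fun=> c).
Proof.
split; first by exists (cmod c) => //; exact: cmod_ge0.
by exists 0 => // s t _ _ _; rewrite subrr cmod0 mul0r.
Qed.

Lemma cholderD f g : cholder f -> cholder g -> cholder (fun s => f s + g s).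
Proof.
move=> [[B B0 fB] [C C0 fC]] [[B' B'0 gB] [C' C'0 gC]]; split.
  exists (B + B'); first exact: addr_ge0.
  by move=> s s0; rewrite (le_trans (cmodD _ _))// lerD// (fB, gB).
exists (C + C'); first exact: addr_ge0.
move=> s t s0 st t1; rewrite (_ : _ - _ = (f t - f s) + (g t - g s)); last by ring.
by rewrite (le_trans (cmodD _ _))// [leRHS]mulrDl lerD// (fC, gC).
Qed.

Lemma cholderM f g : cholder f -> cholder g -> cholder (fun s => f s * g s).
Proof.
move=> [[B B0 fB] [C C0 fC]] [[B' B'0 gB] [C' C'0 gC]]; split.
  exists (B * B'); first exact: mulr_ge0.
  by move=> s s0; rewrite cmodM ler_pM ?cmod_ge0// (fB, gB).
exists (C * B' + B * C'); first by rewrite addr_ge0 ?mulr_ge0.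
move=> s t s0 st t1; have t0 := le_trans s0 st.
rewrite (_ : _ - _ = (f t - f s) * g t + f s * (g t - g s)); last by ring.
rewrite (le_trans (cmodD _ _))// [leRHS]mulrDl !cmodM lerD//.
  by rewrite mulrAC ler_pM ?cmod_ge0 ?fC ?gB.
by rewrite -mulrA ler_pM ?cmod_ge0 ?fB ?gC.
Qed.

Lemma cholderZ (c : R[i]) f : cholder f -> cholder (fun s => c * f s).
Proof. by apply: cholderM; exact: cholder_cst. Qed.

Lemma holder_continuous (h : R -> R) (C : R) : 0 <= C ->
  (forall s t, s <= t -> t - s <= 1 -> `|h t - h s| <= C * Num.sqrt (t - s)) ->
  continuous h.
Proof.
move=> C0 hC x; apply/cvgrPdist_le => e e0.
pose d : R := Order.min 1 ((e / (C + 1)) ^+ 2).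
have C1 : 0 < C + 1 by rewrite ltr_wpDl.
have d0 : 0 < d by rewrite lt_min ltr01 exprn_gt0// divr_gt0.
have key s t : s <= t -> t - s <= d -> `|h t - h s| <= e.
  move=> st tsd; have ts1 : t - s <= 1 by rewrite (le_trans tsd)// ge_min lexx.
  rewrite (le_trans (hC _ _ st ts1))//.
  have : Num.sqrt (t - s) <= e / (C + 1).
    have ed0 : 0 <= e / (C + 1) by rewrite divr_ge0// ltW.
    rewrite -(ger0_norm ed0) -sqrtr_sqr ler_wsqrtr//.
    by rewrite (le_trans tsd)// ge_min lexx orbT.
  move=> q; rewrite (@le_trans _ _ ((C + 1) * (e / (C + 1))))//.
    by rewrite ler_pM ?sqrtr_ge0// lerDl.
  by rewrite mulrCA divff ?mulr1// gt_eqF.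
near=> y; have : `|x - y| <= d by near: y; apply: cvgr_dist_le.
have [xy|/ltW yx] := leP x y.
  by rewrite distrC [X in _ -> X <= _]distrC ger0_norm ?subr_ge0//; exact: key.
by rewrite ger0_norm ?subr_ge0//; exact: key.
Unshelve. all: by end_near. Qed.

Lemma cholder_integrable f t : cholder f -> cintegrable leb `[0, t] f.
Proof.
move=> [_ [C C0 fC]].
have aux (p : R[i] -> R) : (forall z w, p (z - w) = p z - p w) ->
    (forall z, `|p z| <= cmod z) -> leb.-integrable `[0, t] (EFin \o (fun x => p (f x))).
  move=> pB pc; pose h (x : R) := p (f (Order.max 0 x)).
  have ch : continuous h.
    apply: (holder_continuous C0) => s u su us1.
    rewrite /h -pB (le_trans (pc _))//.
    have m0 : 0 <= Order.max 0 s by rewrite le_max lexx.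
    have m1 : Order.max 0 s <= Order.max 0 u by rewrite ge_max !le_max lexx su orbT.
    have m2 : Order.max 0 u - Order.max 0 s <= u - s.
      by case: (leP 0 u) => ?; case: (leP 0 s) => ?; lra.
    rewrite (le_trans (fC _ _ m0 m1 (le_trans m2 us1)))//.
    by rewrite ler_wpM2l// ler_wsqrtr.
  have := @continuous_itv_integrable R h 0 t ch.
  apply: eq_integrable => // x; rewrite inE /= in_itv /= => /andP[x0 _].
  by rewrite /h max_r.
split; apply: aux => *; rewrite ?ReB ?Re_le_cmod ?Im_le_cmod//.
by rewrite ImD ImN.
Qed.

Lemma cholder_int_expansion f : cholder f -> exists2 C, 0 <= C &
  forall s t, 0 <= s -> s <= t -> t - s <= 1 ->
    cmod (cintegral leb `[0, t] f - cintegral leb `[0, s] f - (t - s)%:C * f s)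
      <= C * ((t - s) * Num.sqrt (t - s)).
Proof.
move=> hf; have [_ [C C0 fC]] := hf; exists (2 * C); first by rewrite mulr_ge0.
move=> s t s0 st ts1; have [i1 i2] := cholder_integrable t hf.
have sub : cintegral leb `[0, t] f - cintegral leb `[0, s] f = cintegral leb `]s, t] f.
  rewrite /cintegral; apply/eqP; rewrite eq_complex /=; apply/andP; split; apply/eqP.
    by apply: Rintegral_itvB; rewrite ?bnd_simp.
  by apply: Rintegral_itvB; rewrite ?bnd_simp.
have le : (leb `]s, t] = (t - s)%:E)%E.
  rewrite lebesgue_measure_itv /= lte_fin; case: ltP => // ts.
  by congr (_%:E); apply/esym/eqP; rewrite subr_eq0 eq_le ts.
have fin : (leb `]s, t] < +oo)%E by rewrite le ltry.
have ic (c : R[i]) : cintegrable leb `]s, t] (fun=> c).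
  by split; apply: measurable_bounded_integrable => //;
    exists (cmod c); split=> [|N MN x _ /=]; rewrite ?num_real//;
    apply: ltW; apply: le_lt_trans MN; rewrite ?Re_le_cmod ?Im_le_cmod.
have ifst : cintegrable leb `]s, t] f.
  by split; [apply: integrableS i1|apply: integrableS i2] => //; apply: subset_itv;
    rewrite bnd_simp.
have ec (c : R[i]) : cintegral leb `]s, t] (fun=> c) = (t - s)%:C * c.
  rewrite /cintegral !Rintegral_cst// [fine _](_ : _ = t - s); last exact: (congr1 fine le).
  apply/eqP; rewrite eq_complex ReZ ImZ /=.
  by rewrite ![_ * (t - s)]mulrC !eqxx.
have ed : cintegral leb `]s, t] (fun u => f u - f s) = cintegral leb `]s, t] f - (t - s)%:C * f s.
  by rewrite -mulrN -ec -cintegralD.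
have id : cintegrable leb `]s, t] (fun u => f u - f s).
  by apply: cintegrableD => //; exact: (ic (- f s)).
rewrite sub -ed (le_trans (cintegral_le (M := C * Num.sqrt (t - s)) _ fin id _))//.
  move=> u; rewrite /= in_itv /= => /andP[su ut].
  have us : u - s <= t - s by rewrite lerD2r.
  rewrite (le_trans (fC _ _ s0 (ltW su) (le_trans us ts1)))//.
  by rewrite ler_wpM2l// ler_wsqrtr.
rewrite [fine _](_ : _ = t - s); last exact: (congr1 fine le).
by rewrite le_eqVlt; apply/orP; left; apply/eqP; ring.
Qed.

Lemma superlinear_constant (f : R -> R[i]) (C : R) : 0 <= C ->
  (forall s t, 0 <= s -> s <= t -> t - s <= 1 ->
    cmod (f t - f s) <= C * ((t - s) * Num.sqrt (t - s))) ->
  forall t, 0 <= t -> f t = f 0.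
Proof.
move=> C0 hf t t0; apply/eqP; rewrite -subr_eq0; apply/eqP/cmod_eq0/eqP.
rewrite eq_le cmod_ge0 andbT leNgt; apply/negP; set d := cmod _ => d0.
pose K := C * t.
have K0 : 0 <= K by rewrite mulr_ge0.
pose n := (Num.bound (t + K ^+ 2 * t / d ^+ 2)).
have d20 : 0 < d ^+ 2 by rewrite exprn_gt0.
have b0 : 0 <= K ^+ 2 * t / d ^+ 2 by rewrite divr_ge0 ?sqr_ge0// mulr_ge0// sqr_ge0.
have nb : t + K ^+ 2 * t / d ^+ 2 < n%:R.
  by apply: archi_boundP; rewrite addr_ge0.
have n0 : 0 < n%:R :> R by rewrite (le_lt_trans _ nb)// addr_ge0.
have tn1 : t / n%:R <= 1 by rewrite ler_pdivrMr// mul1r (le_trans _ (ltW nb))// lerDl.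
pose u (i : nat) := i%:R * (t / n%:R).
have u0 : u 0%N = 0 by rewrite /u mul0r.
have un : u n = t by rewrite /u mulrC divfK// gt_eqF.
have us i : u i.+1 - u i = t / n%:R by rewrite /u -mulrBl -natrB// subSnn mul1r.
have tn0 : 0 <= t / n%:R by rewrite divr_ge0// ltW.
have step m : cmod (f (u m) - f 0) <= m%:R * (C * (t / n%:R * Num.sqrt (t / n%:R))).
  elim: m => [|m IH]; first by rewrite u0 subrr cmod0 mul0r.
  rewrite (_ : f (u m.+1) - f 0 = (f (u m.+1) - f (u m)) + (f (u m) - f 0)); last by ring.
  rewrite (le_trans (cmodD _ _))// -natr1 mulrDl mul1r addrC lerD//.
  rewrite -(us m); apply: hf; rewrite ?us//.
    by rewrite /u mulr_ge0.
  by rewrite -subr_ge0 us.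
have := step n; rewrite un -/d => dn.
have {}dn : d <= K * Num.sqrt (t / n%:R).
  rewrite (le_trans dn)// le_eqVlt; apply/orP; left; apply/eqP.
  by rewrite /K; field; rewrite gt_eqF.
have : d ^+ 2 <= K ^+ 2 * (t / n%:R).
  have d0' := ltW d0; have q0 := sqrtr_ge0 (t / n%:R).
  by rewrite -(sqr_sqrtr tn0) -exprMn ler_pXn2r ?nnegrE// mulr_ge0.
rewrite mulrA ler_pdivlMr// mulrC -ler_pdivlMr// leNgt => /negP; apply.
by rewrite (le_lt_trans _ nb)// lerDr.
Qed.

End Holder.

(** * The law of the Jacobi process and its Cauchy transform *)

Section ContinuousIntegrands.
Variable R : realType.
Implicit Types (f g : R -> R[i]) (m : probability (measurableTypeR R) R).

Definition ccont f := forall x, cclim (nbhs x) f (f x).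

Lemma ccont_cst (c : R[i]) : ccont (fun=> c).
Proof. by move=> x; exact: cclim_cst. Qed.

Lemma ccont_id : ccont (fun x : R => x%:C).
Proof. by move=> x; split => /=; [exact: cvg_id|exact: cvg_cst]. Qed.

Lemma ccontD f g : ccont f -> ccont g -> ccont (fun x => f x + g x).
Proof. by move=> hf hg x; exact: cclimD. Qed.

Lemma ccontM f g : ccont f -> ccont g -> ccont (fun x => f x * g x).
Proof. by move=> hf hg x; exact: cclimM. Qed.

Lemma ccontV f : (forall x, f x != 0) -> ccont f -> ccont (fun x => (f x)^-1).
Proof. by move=> f0 hf x; exact: cclimV. Qed.

Lemma ccont_poly (p : {poly R[i]}) : ccont (fun x => p.[x%:C]).
Proof.
elim/poly_ind: p => [|p c IH].
  by rewrite (_ : (fun x => _) = fun=> 0); [exact: ccont_cst|apply/funext => x; rewrite horner0].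
rewrite (_ : (fun x : R => _) = fun x => p.[x%:C] * x%:C + c).
  by apply: ccontD; [apply: ccontM => //; exact: ccont_id|exact: ccont_cst].
by apply/funext => x; rewrite !hornerE.
Qed.

Lemma continuous_integrable m (h : R -> R) a b : a <= b -> continuous h ->
  m.-integrable `[a, b] (EFin \o h).
Proof.
move=> ab ch; apply: measurable_bounded_integrable => //.
- by rewrite (le_lt_trans (probability_le1 _ _))// ltry.
- by apply: (measurable_funS measurableT) => //; exact: continuous_measurable_fun.
have cn : continuous (fun x => `|h x|).
  by move=> x; apply: (continuous_comp (ch x)); exact: norm_continuous.
have [c _ hc] := EVT_max ab (continuous_subspaceT cn).
by exists `|h c|; split=> [|M hM x /= xab]; [exact: num_real|rewrite (le_trans (hc _ xab))// ltW].
Qed.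

Lemma ccont_integrable m f a b : a <= b -> ccont f -> cintegrable m `[a, b] f.
Proof. by move=> ab hf; split; apply: continuous_integrable => // x; have [] := hf x. Qed.

End ContinuousIntegrands.

Section Law.
Variables (R : realType) (A : vonNeumannAlgebra R) (Phi : {scalar A}).
Hypothesis st : faithful_normal_tracial_state Phi.
Variables (kappa : R) (P J : A) (m : probability (measurableTypeR R) R).
Hypotheses (k0 : 0 < kappa) (hP : projection P).
Hypothesis hm : law_in_corner Phi kappa P J m.
Hypothesis hJ : opb Phi 2^-1 (J - (2^-1)%:C *: 1).
Local Notation tr := (tr Phi).

Lemma law_integrable (h : R -> R) : continuous h -> m.-integrable setT (EFin \o h).
Proof.
move=> ch; have [[M mM] _] := hm.
have M0 : - M <= M.
  rewrite leNgt; apply/negP => MM; move: mM; rewrite set_itv_ge ?bnd_simp ?leNgt ?MM//.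
  by rewrite measure0 => /eqP; rewrite eq_sym onee_eq0.
have mC : m (~` `[- M, M]%classic) = 0%E.
  by rewrite probability_setC// mM subee.
have mN : measurable (~` `[- M, M]%classic : set (measurableTypeR R)) by exact: measurableC.
have mh : measurable_fun (setT : set (measurableTypeR R)) (EFin \o h).
  by apply/measurable_EFinP; exact: continuous_measurable_fun.
have [_] := negligible_integrable mN measurableT mh mC; apply.
by rewrite setTD setCK; exact: continuous_integrable.
Qed.

Lemma law_cintegrable f : ccont f -> cintegrable m setT f.
Proof. by move=> hf; split; apply: law_integrable => x; have [] := hf x. Qed.

Lemma law_poly_setT p : tr (P * pev J p) / kappa%:C = cintegral m setT (fun x => p.[x%:C]).
Proof.
pose Q p := tr (P * pev J p) / kappa%:C = cintegral m setT (fun x => p.[x%:C]).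
suff H : Q (\sum_(i < size p) p`_i *: 'X^i) by move: H; rewrite -poly_def coefK.
elim/big_ind: _ => [|p1 p2 h1 h2|i _]; rewrite /Q.
- rewrite pev0 mulr0 tr0 mul0r; apply/esym; rewrite (@eq_cintegral _ _ _ _ (fun=> 0)).
    by rewrite /cintegral !Rintegral_cst// !mul0r.
  by move=> x _; rewrite horner0.
- rewrite pevD mulrDr trD mulrDl h1 h2 -cintegralD//; try exact: law_cintegrable (ccont_poly _).
  by apply: eq_cintegral => x _; rewrite hornerD.
rewrite pevZ pevXn pevX trZr -mulrA [tr _ / _](hm.2 i).
rewrite (@eq_cintegral _ _ _ _ (fun x => p`_i * (x ^+ i)%:C)); last first.
  by move=> x _; rewrite hornerZ hornerXn rmorphXn.
rewrite cintegralZ//; last first.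
  apply: law_cintegrable => x; split => /=; [exact: exprn_continuous|exact: cvg_cst].
by congr (_ * _); rewrite /cintegral /= Rintegral_cst// mul0r.
Qed.

Lemma law_support : m (~` `[0, 1]%classic) = 0%E.
Proof.
pose B (k : nat) : set (measurableTypeR R) := [set x | 1 + k.+1%:R^-1 <= `|2 * x - 1|].
have cabs : continuous (fun x : R => `|2 * x - 1|).
  move=> x; apply: (continuous_comp (f := fun x : R => 2 * x - 1)); last exact: norm_continuous.
  by apply: cvgB; [apply: cvgM; [exact: cvg_cst|exact: cvg_id]|exact: cvg_cst].
have mB k : measurable (B k).
  have := @measurable_fun_le _ _ _ setT (fun=> 1 + k.+1%:R^-1) (fun x : R => `|2 * x - 1|).
  rewrite (_ : [set x | _] = B k); last by apply/seteqP; split.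
  by rewrite setTI; apply => //; exact: continuous_measurable_fun.
have B0 k : m (B k) = 0%E.
  pose c : R := 1 + k.+1%:R^-1.
  have c1 : 1 < c by rewrite ltrDl invr_gt0.
  have c0 : 0 < c by exact: lt_trans c1.
  have bound n : fine (m (B k)) * (c ^+ n) ^+ 2 <= kappa^-1.
    pose p : {poly R[i]} := ((2%:R)%:P * 'X - 1) ^+ n ^+ 2.
    have pE x : p.[x%:C] = ((2 * x - 1) ^+ n ^+ 2)%:C.
      by rewrite /p !hornerE !rmorphXn rmorphB rmorphM rmorph1 rmorphMn rmorph1.
    have cp : continuous (fun x : R => (2 * x - 1) ^+ n ^+ 2).
      by move=> x; have [] := ccont_poly p x; rewrite pE /=; under eq_fun do rewrite pE.
    have -> : fine (m (B k)) * (c ^+ n) ^+ 2 = \int[m]_x ((c ^+ n) ^+ 2 * \1_(B k) x).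
      rewrite RintegralZl//; last exact: integrable_indic.
      by rewrite mulrC /Rintegral integral_indic// setIT.
    apply: (@le_trans _ _ (\int[m]_x ((2 * x - 1) ^+ n ^+ 2))).
      apply: le_Rintegral => //.
      - by rewrite (_ : _ \o _ = (fun x => ((c ^+ n) ^+ 2)%:E * (\1_(B k) x)%:E)%E)//;
          apply: integrableZl => //; exact: integrable_indic.
      - exact: law_integrable.
      move=> x _; rewrite indicE; case: (boolP (x \in B k)); rewrite ?mulr0 ?sqr_ge0//.
      rewrite inE /B /= mulr1 => cx; rewrite -[leRHS]real_normK ?num_real// normrX.
      have c0' := ltW c0.
      have q : c ^+ n <= `|2 * x - 1| ^+ n by apply: lerXn2r; rewrite ?nnegrE.
      by apply: lerXn2r; rewrite ?nnegrE ?exprn_ge0.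
    have := law_poly_setT p; rewrite (@eq_cintegral _ _ _ _ (fun x => ((2 * x - 1) ^+ n ^+ 2)%:C)) => [|x _]; last exact: pE.
    move=> /(congr1 (@complex.Re R)); rewrite /cintegral /= => <-.
    have -> : pev J p = (2%:R *: (J - (2^-1)%:C *: 1)) ^+ n ^+ 2.
      rewrite !pevXn pevB pevM pevC pevX pev1 scalerBr scalerA -scalerAl mul1r.
      congr ((_ - _) ^+ _ ^+ _); rewrite fmorphV rmorphMn rmorph1 divff ?scale1r//.
    have o1 : opb Phi 1 (2%:R *: (J - (2^-1)%:C *: 1)).
      have := opbZ st 2%:R hJ; rewrite (_ : cmod 2%:R = 2) ?divff//.
      by rewrite (_ : 2%:R = (2%:R : R)%:C) ?cmodR ?ger0_norm// rmorphMn.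
    have o2 : opb Phi 1 (P * (2%:R *: (J - (2^-1)%:C *: 1)) ^+ n ^+ 2).
      apply: opb1M; first exact: opb_projection.
      by have := opbX 2 (opbX n o1); rewrite !expr1n.
    rewrite mulrC -fmorphV ReZ ler_piMr ?invr_ge0 ?(ltW k0)//.
    rewrite (le_trans (ler_norm _))// (le_trans (Re_le_cmod _))//.
    by rewrite (le_trans (tr_le1 st _))// opb_nrm.
  have mfin : m (B k) = (fine (m (B k)))%:E by rewrite fineK// fin_num_measure.
  rewrite mfin; congr (_%:E); apply/eqP; rewrite eq_le fine_ge0// andbT leNgt.
  apply/negP => b0.
  have r0 : 0 <= (c ^+ 2)^-1 by rewrite invr_ge0 exprn_ge0// ltW.
  have r1 : (c ^+ 2)^-1 < 1 by rewrite invf_lt1 ?exprn_gt0// exprn_egt1.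
  have e0 : 0 < fine (m (B k)) * kappa by rewrite mulr_gt0.
  have [N hN] := geometric_small r0 r1 e0.
  have := hN N (leqnn N); rewrite exprVn -exprM mulnC exprM ltNge => /negP; apply.
  rewrite -[leRHS]mul1r ler_pdivlMr ?exprn_gt0// mulrAC -ler_pdivlMr// mul1r.
  exact: bound.
have : m.-negligible (\bigcup_k B k).
  apply: negligible_bigcup => k; exists (B k); split => //; exact: B0.
move=> [N [mN N0 BN]]; apply: (subset_measure0 _ _ _ N0) => //.
  by apply: measurableC.
apply: subset_trans BN => x /= /negP; rewrite in_itv /= negb_and -!ltNge => h.
have : 1 < `|2 * x - 1|.
  case/orP: h => h.
    rewrite ler0_norm; lra.
  rewrite ger0_norm; lra.
rewrite -subr_gt0 => d0; exists (Num.bound (`|2 * x - 1| - 1)^-1) => //.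
rewrite /B /= -lerBrDl; move: d0; set d := (`|2 * x - 1| - 1) => d0.
have di : 0 <= d^-1 by rewrite invr_ge0 ltW.
have := archi_boundP di; move: (Num.bound d^-1) => n dn.
have dS : d^-1 <= n.+1%:R by rewrite (le_trans (ltW dn))// ler_nat.
by rewrite -[leRHS]invrK lef_pV2 ?posrE ?invr_gt0.
Qed.

Lemma law_mass : m `[0, 1]%classic = 1%E.
Proof.
have := probability_setC m (measurableC (@measurable_itv R `[0, 1])).
by rewrite setCK law_support sube0.
Qed.

Lemma law_poly p : tr (P * pev J p) / kappa%:C = cintegral m `[0, 1] (fun x => p.[x%:C]).
Proof.
rewrite law_poly_setT; have [i1 i2] := law_cintegrable (ccont_poly p).
have e (h : R -> R) : m.-integrable setT (EFin \o h) ->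
    \int[m]_x h x = \int[m]_(x in `[0, 1]) h x.
  have mN : measurable (~` `[0, 1]%classic : set (measurableTypeR R)) by exact: measurableC.
  move=> ih; rewrite /Rintegral (negligible_integral mN measurableT ih law_support).
  by rewrite setTD setCK.
by rewrite /cintegral !e.
Qed.

End Law.

Section CauchyTransform.
Variables (R : realType) (m : probability (measurableTypeR R) R).
Implicit Types (z : R[i]).
Local Notation Im := complex.Im.

Definition cauchy_sqr z : R[i] := cintegral m `[0, 1]%classic (fun x => (z - x%:C)^-1 ^+ 2).

Lemma cauchy_kernel_neq0 z (x : R) : 0 < Im z -> z - x%:C != 0.
Proof.
move=> z0; apply/eqP => /(congr1 (@complex.Im R)); rewrite ImD ImN /= oppr0 addr0 => zz.
by rewrite zz ltxx in z0.
Qed.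

Lemma cauchy_kernel_le z (x y : R) : 0 < y -> y <= Im z -> cmod (z - x%:C)^-1 <= y^-1.
Proof.
move=> y0 yz; have z0 := lt_le_trans y0 yz.
have zx : y <= cmod (z - x%:C).
  rewrite (le_trans yz)// (le_trans (ler_norm _))//.
  by have := Im_le_cmod (z - x%:C); rewrite ImD ImN /= oppr0 addr0.
by rewrite cmodV lef_pV2 ?posrE// (lt_le_trans y0).
Qed.

Lemma ccont_cauchy_kernel z : 0 < Im z -> ccont (fun x : R => (z - x%:C)^-1).
Proof.
move=> z0; apply: ccontV; first by move=> x; exact: cauchy_kernel_neq0.
apply: ccontD; first exact: ccont_cst.
rewrite (_ : (fun x : R => _) = fun x => -1 * x%:C).
  by apply: ccontM; [exact: ccont_cst|exact: ccont_id].
by apply/funext => x; rewrite mulN1r.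
Qed.

Lemma ccontX (f : R -> R[i]) n : ccont f -> ccont (fun x => f x ^+ n).
Proof.
move=> hf; elim: n => [|n IH]; first exact: ccont_cst.
by under eq_fun do rewrite exprS; exact: ccontM.
Qed.

Lemma unit_itv_integrable f : ccont f -> cintegrable m `[0, 1] f.
Proof. exact: ccont_integrable. Qed.

Lemma unit_cintegral_le f (M : R) : ccont f ->
  (forall x, 0 <= x <= 1 -> cmod (f x) <= M) -> cmod (cintegral m `[0, 1] f) <= 2 * M.
Proof.
move=> cf fM.
have M0 : 0 <= M by rewrite (le_trans (cmod_ge0 _) (fM 0 _))// lexx ler01.
have m1 : (m `[0%R, 1%R]%classic <= 1)%E by exact: probability_le1.
have h : cmod (cintegral m `[0, 1] f) <= 2 * (M * fine (m `[0, 1]%classic)).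
  apply: cintegral_le => //.
    by rewrite (le_lt_trans m1)// ltry.
  exact: unit_itv_integrable.
rewrite (le_trans h)// ler_pM2l// ler_piMr//.
by rewrite -lee_fin fineK// fin_num_measure.
Qed.

Lemma cauchy_transform_expansion z h (y : R) : 0 < y -> y <= Im z -> y <= Im (h + z) ->
  cmod (cauchy_transform m (h + z) - cauchy_transform m z + h * cauchy_sqr z)
    <= 2 * cmod h ^+ 2 * y^-1 ^+ 3.
Proof.
move=> y0 yz yh; have z0 := lt_le_trans y0 yz; have h0 := lt_le_trans y0 yh.
have c1 := ccont_cauchy_kernel z0; have c2 := ccont_cauchy_kernel h0.
have cs := ccontX 2 c1; have cr := ccontM c2 cs.
have zi (c : R[i]) f : ccont f -> ccont (fun x => c * f x).
  by move=> cf; apply: ccontM => //; exact: ccont_cst.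
have E x : (h + z - x%:C)^-1 = (z - x%:C)^-1 + (- h * (z - x%:C)^-1 ^+ 2
    + h ^+ 2 * ((h + z - x%:C)^-1 * (z - x%:C)^-1 ^+ 2)).
  have n1 := cauchy_kernel_neq0 x z0; have n2 := cauchy_kernel_neq0 x h0.
  by field; rewrite n1 n2.
have -> : cauchy_transform m (h + z) - cauchy_transform m z + h * cauchy_sqr z
    = h ^+ 2 * cintegral m `[0, 1] (fun x => (h + z - x%:C)^-1 * (z - x%:C)^-1 ^+ 2).
  rewrite {1}/cauchy_transform (eq_cintegral _ (fun x _ => E x)).
  rewrite cintegralD//; try exact: unit_itv_integrable; last first.
    by apply: unit_itv_integrable; apply: ccontD; exact: zi.
  rewrite cintegralD//; try by apply: unit_itv_integrable; exact: zi.
  rewrite !cintegralZ//; try exact: unit_itv_integrable.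
  by rewrite /cauchy_transform /cauchy_sqr; ring.
rewrite cmodM cmodX -mulrA mulrCA ler_wpM2l ?exprn_ge0 ?cmod_ge0//.
apply: unit_cintegral_le => // x _; rewrite cmodM cmodX (exprS y^-1 2).
have yi : 0 <= y^-1 by rewrite invr_ge0 ltW.
rewrite ler_pM ?exprn_ge0 ?cmod_ge0 ?cauchy_kernel_le//.
by rewrite lerXn2r ?nnegrE ?cmod_ge0 ?cauchy_kernel_le.
Qed.

Lemma cderive_cauchy z : 0 < Im z -> cderive (cauchy_transform m) z = - cauchy_sqr z.
Proof.
move=> z0; rewrite /cderive /derive1; apply: (@cvg_lim (R[i] : numFieldType)^o (@norm_hausdorff _ (R[i] : numFieldType)^o)).
pose y := Im z / 2; have y0 : 0 < y by rewrite divr_gt0.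
apply/cvgrPdist_le => e e0.
have er : e = (complex.Re e)%:C by move/gtr0_real/RRe_real: e0.
have e0' : 0 < complex.Re e by rewrite -ltcR -er.
pose d := Num.min y (complex.Re e / (2 * y^-1 ^+ 3)).
have p0 : 0 < 2 * y^-1 ^+ 3 by rewrite mulr_gt0// exprn_gt0// invr_gt0.
have d0 : 0 < d by rewrite lt_min y0 divr_gt0.
have d0C : (0 : R[i]) < d%:C by rewrite ltcR.
near=> h.
have hd : cmod h <= d.
  by rewrite -lecR -cmodE; near: h; exact: dnbhs0_le.
have hn : h != 0 by near: h; exact: nbhs_dnbhs_neq.
move: hd; rewrite /d le_min => /andP[hy he].
have yh : y <= Im (h + z).
  rewrite ImD; have := le_trans (Im_le_cmod h) hy; rewrite ler_norml => /andP[+ _].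
  rewrite /y; lra.
have yz : y <= Im z by rewrite /y; lra.
have := cauchy_transform_expansion y0 yz yh.
set D := _ + h * _ => hD; rewrite er cmodE lecR.
rewrite (_ : _ - _ = - (h^-1 * D)); last first.
  by rewrite /D mulrDr mulKf// opprD addrC.
rewrite cmodN cmodM cmodV ler_pdivrMl; last first.
  by rewrite lt_neqAle cmod_ge0 andbT eq_sym; apply: contra hn => /eqP/cmod_eq0 ->.
rewrite (le_trans hD)//.
rewrite (_ : _ * _ ^+ 3 = cmod h * (cmod h * (2 * y^-1 ^+ 3))); last by move: (y^-1) => v; ring.
by rewrite ler_wpM2l ?cmod_ge0// -ler_pdivlMr.
Unshelve. all: by end_near.
Qed.

End CauchyTransform.

(* The disc around [1/2 - iM] through 0 and 1 omits [z] once [M] is large. *)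
Lemma disc_avoiding (R : realType) (z : R[i]) : 0 < complex.Im z ->
  exists (M : R) (w : R[i]), w * (z - (2^-1 +i* M)) = 1
    /\ cmod w * Num.sqrt (4^-1 + M ^+ 2) < 1.
Proof.
case: z => a b /= b0; pose M : R := - (8 * b)^-1.
have b8 : 0 < 8 * b by rewrite mulr_gt0.
have bM : b * M = - 8^-1 by rewrite /M mulrN invfM mulrCA divff ?mulr1// gt_eqF.
pose d : R[i] := (a +i* b) - (2^-1 +i* M).
have dE : cmod d = Num.sqrt ((a - 2^-1) ^+ 2 + (b - M) ^+ 2) by [].
have lt0 : 4^-1 + M ^+ 2 < (a - 2^-1) ^+ 2 + (b - M) ^+ 2.
  have := sqr_ge0 (a - 2^-1); have : 0 < b ^+ 2 by rewrite exprn_gt0.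
  rewrite (sqrrB b) bM; move: (_ ^+ 2) (_ ^+ 2) (_ ^+ 2) => u v w; lra.
have r0 : 0 <= 4^-1 + M ^+ 2 by rewrite addr_ge0 ?sqr_ge0// invr_ge0.
have lt1 : Num.sqrt (4^-1 + M ^+ 2) < cmod d by rewrite dE ltr_sqrt ?(le_lt_trans r0).
have d0 : 0 < cmod d by rewrite (le_lt_trans _ lt1)// sqrtr_ge0.
have dn : d != 0 by apply/eqP => d00; rewrite d00 cmod0 ltxx in d0.
exists M, d^-1; rewrite mulVf//; split=> //.
by rewrite cmodV mulrC ltr_pdivrMr// mul1r.
Qed.

Lemma disc_unit_itv (R : realType) (M x : R) : 0 <= x <= 1 ->
  cmod (x%:C - (2^-1 +i* M)) <= Num.sqrt (4^-1 + M ^+ 2).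
Proof.
move=> /andP[x0 x1]; rewrite /cmod /= ler_wsqrtr// sub0r sqrrN lerD2r.
have h : 0 <= x * (1 - x) by rewrite mulr_ge0 ?subr_ge0.
have -> : (x - 2^-1) ^+ 2 = 4^-1 - x * (1 - x) by field.
lra.
Qed.

Section JacobiCauchyTransform.
Variables (R : realType) (A : vonNeumannAlgebra R) (Phi : {scalar A}).
Hypothesis st : faithful_normal_tracial_state Phi.
Variables (F : R -> set A) (X Y : R -> A) (P Q : A) (theta kappa : R).
Hypothesis hF : filtration F.
Hypothesis hX : free_brownian_motion Phi F X.
Hypothesis hY : free_multiplicative_brownian_motion Phi F X Y.
Hypotheses (projQ : projection Q) (FQ : F 0 Q) (trQ : Phi Q = theta%:C).
Hypotheses (projP : projection P) (FP : F 0 P).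
Variable mu : R -> probability (measurableTypeR R) R.
Hypothesis k0 : 0 < kappa.
Hypothesis hmu : forall t, 0 <= t -> law_in_corner Phi kappa P (jacobi Y P Q t) (mu t).
Local Notation tr := (tr Phi).
Local Notation J := (jacobi Y P Q).
Local Notation Im := complex.Im.

Let k0C : kappa%:C != 0 :> R[i].
Proof. by rewrite eq_complex /= eqxx andbT gt_eqF. Qed.

Lemma jacobi_half_opb t : 0 <= t -> opb Phi 2^-1 (J t - (2^-1)%:C *: 1).
Proof.
move=> t0; have := jacobi_center_opb st hY projQ projP 0 t0.
rewrite expr0n addr0 (_ : 4^-1 = (2^-1) ^+ 2); last by field.
by rewrite sqrtr_sqr ger0_norm// invr_ge0.
Qed.

Lemma jacobi_law_poly t p : 0 <= t ->
  tr (P * pev (J t) p) = kappa%:C * cintegral (mu t) `[0, 1] (fun x => p.[x%:C]).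
Proof.
move=> t0; have hJ := jacobi_half_opb t0.
by rewrite -(law_poly st k0 projP (hmu t0) hJ) mulrC divfK.
Qed.

Variables (z w : R[i]) (M : R).
Hypothesis z0 : 0 < Im z.
Let c : R[i] := 2^-1 +i* M.
Let r : R := Num.sqrt (4^-1 + M ^+ 2).
Hypothesis hw : w * (z - c) = 1.
Hypothesis hr : cmod w * r < 1.
Let rho := cmod w * r.
Let L := cmod w / (1 - rho).
Let u (x : R) : R[i] := (z - x%:C)^-1.
Let p k := geom_poly c w k.
Let y := (Im z)^-1.

Let r0 : 0 <= r. Proof. exact: sqrtr_ge0. Qed.
Let rho0 : 0 <= rho. Proof. by rewrite mulr_ge0 ?cmod_ge0. Qed.
Let y0 : 0 <= y. Proof. by rewrite invr_ge0 ltW. Qed.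

Lemma geom_poly_kernel k x : 0 <= x <= 1 -> cmod ((p k).[x%:C] - u x) <= y * rho ^+ k.
Proof.
move=> x01; have n0 := cauchy_kernel_neq0 x z0.
have -> : (p k).[x%:C] - u x = - (u x * (1 - (z - x%:C) * (p k).[x%:C])).
  by rewrite mulrBr mulr1 mulrA /u mulVf// mul1r opprB.
rewrite cmodN cmodM ler_pM ?cmod_ge0//; first exact: cauchy_kernel_le.
by rewrite geom_poly_error// disc_unit_itv.
Qed.

Lemma geom_poly_kernel_sqr k x : 0 <= x <= 1 ->
  cmod ((p k * p k).[x%:C] - u x ^+ 2) <= y * (L + y) * rho ^+ k.
Proof.
move=> x01; rewrite hornerM -expr2 subr_sqr cmodM mulrAC.
rewrite ler_pM ?cmod_ge0 ?geom_poly_kernel// (le_trans (cmodD _ _))// lerD//.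
  by rewrite geom_poly_le// disc_unit_itv.
exact: cauchy_kernel_le.
Qed.

Lemma trace_poly_limit t (q : nat -> {poly R[i]}) (v : R -> R[i]) (C : R) : 0 <= t -> ccont v ->
  (forall k x, 0 <= x <= 1 -> cmod ((q k).[x%:C] - v x) <= C * rho ^+ k) ->
  cclim \oo (fun k => tr (P * pev (J t) (q k))) (kappa%:C * cintegral (mu t) `[0, 1] v).
Proof.
move=> t0 cv hq; apply: (@cclim_geometric _ _ _ (kappa * (2 * C)) rho) => // k.
have cq := ccont_poly (q k).
have cN : ccont (fun x => -1 * v x) by apply: ccontM => //; exact: ccont_cst.
rewrite jacobi_law_poly// -mulrBr cmodM cmodR gtr0_norm// -mulrA ler_pM2l//.
have -> : cintegral (mu t) `[0, 1] (fun x => (q k).[x%:C]) - cintegral (mu t) `[0, 1] v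
    = cintegral (mu t) `[0, 1] (fun x => (q k).[x%:C] + -1 * v x).
  by rewrite cintegralD ?cintegralZ ?mulN1r//; exact: unit_itv_integrable.
rewrite -mulrA unit_cintegral_le//; first exact: ccontD.
by move=> x x01; rewrite mulN1r hq.
Qed.

Lemma jacobi_law_one t : 0 <= t -> cintegral (mu t) `[0, 1] (fun=> 1) = 1.
Proof.
move=> t0; have m1 := law_mass st k0 projP (hmu t0) (jacobi_half_opb t0).
by rewrite /cintegral /= !Rintegral_cst// mul0r mul1r [fine _](_ : _ = 1)//; exact: (congr1 fine m1).
Qed.

Local Notation G t := (cauchy_transform (mu t) z).
Local Notation G2 t := (cauchy_sqr (mu t) z).
Local Notation S := (resolvent Y P Q c w).

Definition cauchy_generator t : R[i] := kappa%:C * (theta%:C * G2 t - (z * G2 t - G t)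
  + kappa%:C * ((z * G t - 1) * G2 t + G t * (z * G2 t - G t)
                - 2 * (z * G t - 1) * (z * G2 t - G t))).

Lemma resolvent_limit t : 0 <= t ->
  cclim \oo (fun k => tr (P * S k t)) (kappa%:C * G t).
Proof.
move=> t0; apply: (@trace_poly_limit _ p u y) => //; first exact: ccont_cauchy_kernel.
exact: geom_poly_kernel.
Qed.

Lemma resolvent_sqr_limit t : 0 <= t ->
  cclim \oo (fun k => tr (P * S k t * S k t)) (kappa%:C * G2 t).
Proof.
move=> t0; rewrite (_ : (fun k => _) = fun k => tr (P * pev (J t) (p k * p k))).
  apply: (@trace_poly_limit _ _ _ (y * (L + y))) => //.
    by apply: ccontX; exact: ccont_cauchy_kernel.
  exact: geom_poly_kernel_sqr.
by apply/funext => k; rewrite pevM mulrA.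
Qed.

Let uc : ccont u. Proof. exact: ccont_cauchy_kernel. Qed.

Let xu x : x%:C * u x = z * u x - 1.
Proof.
have n0 := cauchy_kernel_neq0 x z0.
by rewrite -[X in _ - X](mulfV n0) -/(u x) -mulrBl opprB addrC subrK.
Qed.

Let cmod_unit (x : R) : 0 <= x <= 1 -> cmod x%:C <= 1.
Proof. by move=> /andP[x0 x1]; rewrite cmodR ger0_norm. Qed.

Lemma jacobi_resolvent_limit t : 0 <= t ->
  cclim \oo (fun k => tr (J t * S k t)) (kappa%:C * (z * G t - 1)).
Proof.
move=> t0; rewrite (_ : (fun k => _) = fun k => tr (P * pev (J t) ('X * p k))); last first.
  by apply/funext => k; rewrite pevM pevX mulrA jacobi_Pl.
rewrite (_ : z * G t - 1 = cintegral (mu t) `[0, 1] (fun x => z * u x + -1 * 1)).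
  apply: (@trace_poly_limit _ _ _ y) => //.
    by apply: ccontD; apply: ccontM => //; exact: ccont_cst.
  move=> k x x01; rewrite hornerM hornerX mulr1 -xu -mulrBr cmodM -[leRHS]mul1r.
  by rewrite ler_pM ?cmod_ge0 ?cmod_unit ?geom_poly_kernel.
rewrite cintegralD//; last 2 first.
- by apply: unit_itv_integrable; apply: ccontM => //; exact: ccont_cst.
- by apply: unit_itv_integrable; exact: ccont_cst.
rewrite !cintegralZ ?jacobi_law_one ?mulr1//; apply: unit_itv_integrable => //.
exact: ccont_cst.
Qed.

Lemma jacobi_resolvent_sqr_limit t : 0 <= t ->
  cclim \oo (fun k => tr (J t * S k t * S k t)) (kappa%:C * (z * G2 t - G t)).
Proof.
move=> t0; rewrite (_ : (fun k => _) = fun k => tr (P * pev (J t) ('X * (p k * p k)))); last first.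
  apply/funext => k; rewrite !pevM pevX (mulrA P) jacobi_Pl//.
  by rewrite (mulrA (J t)).
have u2c : ccont (fun x => u x ^+ 2) by exact: ccontX.
rewrite (_ : z * G2 t - G t = cintegral (mu t) `[0, 1] (fun x => z * u x ^+ 2 + -1 * u x)).
  apply: (@trace_poly_limit _ _ _ (y * (L + y))) => //.
    by apply: ccontD; apply: ccontM => //; exact: ccont_cst.
  move=> k x x01; rewrite hornerM hornerX.
  have -> : z * u x ^+ 2 + -1 * u x = x%:C * u x ^+ 2.
    by rewrite mulN1r !expr2 [in RHS]mulrA xu mulrBl mul1r mulrA.
  rewrite -mulrBr cmodM -[leRHS]mul1r.
  by rewrite ler_pM ?cmod_ge0 ?cmod_unit ?geom_poly_kernel_sqr.
rewrite cintegralD//; try (by apply: unit_itv_integrable; apply: ccontM => //; exact: ccont_cst).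
by rewrite !cintegralZ ?mulN1r//; exact: unit_itv_integrable.
Qed.

Let hJ t : 0 <= t -> opb Phi r (J t - c *: 1).
Proof. exact: (jacobi_center_opb st hY projQ projP M). Qed.

Lemma gen_rhs_limit t : 0 <= t ->
  cclim \oo (fun k => gen_rhs Phi Y P Q theta c w k t) (cauchy_generator t).
Proof.
move=> t0; rewrite /gen_rhs /cauchy_generator.
have l1 := resolvent_limit t0; have l2 := resolvent_sqr_limit t0.
have l3 := jacobi_resolvent_limit t0; have l4 := jacobi_resolvent_sqr_limit t0.
rewrite (_ : kappa%:C * _ = theta%:C * (kappa%:C * G2 t) - kappa%:C * (z * G2 t - G t)
   + kappa%:C * (z * G t - 1) * (kappa%:C * G2 t)
   + kappa%:C * G t * (kappa%:C * (z * G2 t - G t))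
   - 2 * (kappa%:C * (z * G t - 1)) * (kappa%:C * (z * G2 t - G t))); last first.
  by move: (G t) (G2 t) (kappa%:C) (theta%:C) => a b e f; ring.
have cst (a : R[i]) : cclim \oo (fun _ : nat => a) a by exact: cclim_cst.
apply: cclimB; last by apply: cclimM => //; exact: cclimM.
by do 2!(apply: cclimD; last exact: cclimM); apply: cclimB => //; exact: cclimM.
Qed.

Let rho_lim (a b : R) : (a + b * rho ^+ k : R) @[k --> \oo] --> a.
Proof.
rewrite -[X in _ --> X]addr0 -[X in _ --> _ + X](mulr0 b).
apply: cvgD; first exact: cvg_cst.
by apply: cvgM; [exact: cvg_cst|apply: cvg_expr; rewrite ger0_norm].
Qed.

Lemma cauchy_step s t : 0 <= s -> s <= t -> t - s <= 1 ->
  cmod (kappa%:C * G t - kappa%:C * G s - (t - s)%:C * cauchy_generator s)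
    <= step_const w r * Num.sqrt (t - s) ^+ 3.
Proof.
move=> s0 st' ts; have t0 := le_trans s0 st'.
have step k := resolvent_step st hF hX hY projQ FQ trQ projP FP hw hr hJ k s0 st' ts.
apply: (@cclim_le _ _ \oo _ (fun k => tr (P * S k t) - tr (P * S k s)
  - (t - s)%:C * gen_rhs Phi Y P Q theta c w k s) _
  (fun k => step_const w r * Num.sqrt (t - s) ^+ 3 + step_const w r * rho ^+ k)).
- apply: cclimB; first by apply: cclimB; exact: resolvent_limit.
  by apply: cclimM; [exact: cclim_cst|exact: gen_rhs_limit].
- exact: rho_lim.
by apply: nearW => k; rewrite -mulrDr.
Qed.

Lemma resolvent_holder_limit s t : 0 <= s -> s <= t -> t - s <= 1 ->
  cmod (G t - G s) <= kappa^-1 * (28 * L ^+ 2) * Num.sqrt (t - s)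
  /\ cmod (G2 t - G2 s) <= kappa^-1 * (2 * L * (28 * L ^+ 2)) * Num.sqrt (t - s).
Proof.
move=> s0 st' ts; have t0 := le_trans s0 st'.
have red (a b : R[i]) C : cmod (kappa%:C * a - kappa%:C * b) <= C * Num.sqrt (t - s) ->
    cmod (a - b) <= kappa^-1 * C * Num.sqrt (t - s).
  by rewrite -mulrBr cmodM cmodR gtr0_norm// -mulrA ler_pdivlMl.
have PB a b : cmod (tr (P * a) - tr (P * b)) <= nrm Phi (a - b).
  rewrite -trB -mulrBr (le_trans (tr_le1 st _))//.
  by have := opbl (a - b) (opb_projection st projP); rewrite mul1r.
split; apply: red.
  apply: (@cclim_le _ _ \oo _ (fun k => tr (P * S k t) - tr (P * S k s)) _
    (fun k => 28 * L ^+ 2 * Num.sqrt (t - s) + 2 * L * rho ^+ k)).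
  - by apply: cclimB; exact: resolvent_limit.
  - exact: rho_lim.
  apply: nearW => k; rewrite (le_trans (PB _ _))//.
  exact: (resolvent_holder st hF hX hY projQ projP hw hr hJ k s0 st' ts).
apply: (@cclim_le _ _ \oo _ (fun k => tr (P * S k t * S k t) - tr (P * S k s * S k s)) _
  (fun k => 2 * L * (28 * L ^+ 2) * Num.sqrt (t - s) + 2 * L * (2 * L) * rho ^+ k)).
- by apply: cclimB; exact: resolvent_sqr_limit.
- exact: rho_lim.
apply: nearW => k; rewrite -!mulrA (le_trans (PB _ _))//.
rewrite (le_trans (resolvent_sqr_holder st hF hX hY projQ projP hw hr hJ k s0 st' ts))//.
by rewrite mulrDr !mulrA.
Qed.

Lemma cholder_cauchy : cholder (fun t => G t) /\ cholder (fun t => G2 t).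
Proof.
have ki : 0 <= kappa^-1 by rewrite invr_ge0 ltW.
have L0 : 0 <= L by rewrite divr_ge0 ?cmod_ge0 ?subr_ge0 ?ltW.
have K0 : 0 <= 28 * L ^+ 2 by apply: mulr_ge0 => //; exact: exprn_ge0.
split; split.
- exists (2 * y); first by rewrite mulr_ge0.
  move=> t _; apply: unit_cintegral_le => // x _; exact: cauchy_kernel_le.
- exists (kappa^-1 * (28 * L ^+ 2)); first exact: mulr_ge0.
  by move=> s t s0 st' ts; have [] := resolvent_holder_limit s0 st' ts.
- exists (2 * y ^+ 2); first by rewrite mulr_ge0 ?exprn_ge0.
  move=> t _; apply: unit_cintegral_le => [|x _]; first exact: ccontX.
  by rewrite cmodX lerXn2r ?nnegrE ?cmod_ge0 ?cauchy_kernel_le.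
exists (kappa^-1 * (2 * L * (28 * L ^+ 2))).
  by apply: mulr_ge0 => //; apply: mulr_ge0 => //; exact: mulr_ge0.
by move=> s t s0 st' ts; have [] := resolvent_holder_limit s0 st' ts.
Qed.

End JacobiCauchyTransform.

Lemma cintegral_itv0 (R : realType) (f : R -> R[i]) :
  cintegral lebesgue_measure `[0, 0]%classic f = 0.
Proof.
by rewrite /cintegral /Rintegral set_itv1 !integral_set1.
Qed.

Theorem proposition6 (R : realType) (A : vonNeumannAlgebra R)
  (Phi : {scalar A}) (F : R -> set A) (X Y : R -> A) (P Q : A)
  (lambda theta : R) (mu : R -> probability (measurableTypeR R) R)
  (hlambda : 0 < lambda <= 1) (htheta : 0 < theta < 1)
  (hlt : 1 + lambda <= 1 / theta)
  (hJ : free_jacobi_setting Phi F X Y P Q lambda theta)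
  (hJ0 : corner_invertible P (jacobi Y P Q 0))
  (hPJ0 : corner_invertible P (P - jacobi Y P Q 0))
  (hmu : forall t, 0 <= t ->
     law_in_corner Phi (lambda * theta) P (jacobi Y P Q t) (mu t)) :
  let G t : R[i] -> R[i] := cauchy_transform (mu t) in
  let G' t : R[i] -> R[i] := cderive (G t) in
  let int0 t (f : R -> R[i]) := cintegral lebesgue_measure `[0, t]%classic f in
  forall (t : R) (z : R[i]), 0 <= t -> 0 < complex.Im z ->
    G t z = G 0 z
      + (1 - 2 * lambda * theta)%:C * int0 t (fun s => G s z)
      + (lambda * theta)%:C * (2 * z - 1) * int0 t (fun s => G s z ^+ 2)
      + ((1 - 2 * lambda * theta)%:C * z - (theta * (1 - lambda))%:C)
          * int0 t (fun s => G' s z)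
      + (2 * lambda * theta)%:C * z * (z - 1) * int0 t (fun s => G s z * G' s z).
Proof.
move=> G G' int0 t z t0 z0.
have [st hF hX hY projP projQ FP FQ _ trQ _ _ _ _ _] := hJ.
have [l0 _] := andP hlambda; have [th0 _] := andP htheta.
have k0 : 0 < lambda * theta by rewrite mulr_gt0.
set kappa := lambda * theta in k0 hmu.
have [M [w [hw hr]]] := disc_avoiding z0.
pose g s := cauchy_transform (mu s) z; pose g2 s := cauchy_sqr (mu s) z.
have [cg cg2] : cholder g /\ cholder g2.
  exact: (cholder_cauchy st hF hX hY projQ projP k0 hmu z0 hw hr).
pose gen s : R[i] := (kappa%:C * (1 - 2 * kappa%:C)) * g s
  + ((kappa%:C * (kappa%:C * (2 * z - 1))) * g s ^+ 2
  + ((kappa%:C * ((1 - 2 * kappa%:C) * z - (theta%:C - kappa%:C))) * (-1 * g2 s)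
  + (kappa%:C * (2 * kappa%:C * z * (z - 1))) * (g s * (-1 * g2 s)))).
have genE s : gen s = cauchy_generator theta kappa mu z s.
  rewrite /gen /cauchy_generator -/(g s) -/(g2 s).
  by move: (g s) (g2 s) (kappa%:C) (theta%:C) => a b e f; ring.
have cgg : cholder (fun s => g s ^+ 2) by exact: cholderM.
have cd : cholder (fun s => -1 * g2 s) by exact: cholderZ.
have cgd : cholder (fun s => g s * (-1 * g2 s)) by exact: cholderM.
have cgen : cholder gen by do 3!(apply: cholderD; first exact: cholderZ); exact: cholderZ.
have [C C0 hC] := cholder_int_expansion cgen.
pose sc := step_const w (Num.sqrt (4^-1 + M ^+ 2)).
have main : kappa%:C * g t - int0 t gen = kappa%:C * g 0 - int0 0 gen.
  apply: (@superlinear_constant _ (fun s => kappa%:C * g s - int0 s gen) (`|sc| + C)) => //.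
    by apply: addr_ge0 => //; exact: normr_ge0.
  move=> s s' s0 ss' s1.
  have st1 := cauchy_step st hF hX hY projQ FQ trQ projP FP k0 hmu z0 hw hr s0 ss' s1.
  have st2 := hC s s' s0 ss' s1.
  rewrite -genE in st1.
  rewrite (_ : kappa%:C * g s' - int0 s' gen - (kappa%:C * g s - int0 s gen) =
    (kappa%:C * g s' - kappa%:C * g s - (s' - s)%:C * gen s)
    - (int0 s' gen - int0 s gen - (s' - s)%:C * gen s)); last by zmodule.
  rewrite (le_trans (cmodB _ _))// mulrDl lerD//.
  rewrite (_ : (s' - s) * _ = Num.sqrt (s' - s) ^+ 3); last first.
    by rewrite exprSr sqr_sqrtr// subr_ge0.
  apply: (le_trans st1); apply: ler_wpM2r; last exact: ler_norm.
  by apply: exprn_ge0; exact: sqrtr_ge0.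
have int00 : int0 0 gen = 0 by exact: cintegral_itv0.
have ci f (hf : cholder f) : cintegrable lebesgue_measure `[0, t] f by exact: cholder_integrable.
have cZ (c : R[i]) f (hf : cholder f) : cintegrable lebesgue_measure `[0, t] (fun s => c * f s).
  by apply: ci; exact: cholderZ.
have intgen : int0 t gen = kappa%:C * ((1 - 2 * kappa%:C) * int0 t g
  + kappa%:C * (2 * z - 1) * int0 t (fun s => g s ^+ 2)
  + ((1 - 2 * kappa%:C) * z - (theta%:C - kappa%:C)) * int0 t (fun s => -1 * g2 s)
  + 2 * kappa%:C * z * (z - 1) * int0 t (fun s => g s * (-1 * g2 s))).
  rewrite /int0 /gen cintegralD//; [|exact: cZ|]; last first.
    by apply: ci; do 2!(apply: cholderD; first exact: cholderZ); exact: cholderZ.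
  rewrite cintegralD//; [|exact: cZ|]; last first.
    by apply: ci; apply: cholderD; exact: cholderZ.
  rewrite cintegralD//; [|exact: cZ|exact: cZ].
  rewrite !cintegralZ//; try exact: ci.
  move: (kappa%:C) (theta%:C) (cintegral _ _ _) (cintegral _ _ _) (cintegral _ _ _) (cintegral _ _ _).
  by move=> k th i1 i2 i3 i4; ring.
have dE s : G' s z = -1 * g2 s by rewrite mulN1r; exact: cderive_cauchy.
have -> : (fun s => G' s z) = fun s => -1 * g2 s by apply/funext.
have -> : (fun s => G s z * G' s z) = fun s => g s * (-1 * g2 s).
  by apply/funext => s; rewrite dE.
have kC : kappa%:C != 0 :> R[i] by rewrite eq_complex /= eqxx andbT gt_eqF.
apply: (mulfI kC); rewrite -/(g t) -/(g 0).
move: main; rewrite int00 subr0 => /eqP; rewrite subr_eq => /eqP ->.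
rewrite intgen -mulrDr; congr (_ * _).
have e2 : (2 * lambda * theta)%:C = 2 * kappa%:C by rewrite -mulrA rmorphM rmorph_nat.
have e1 : (1 - 2 * lambda * theta)%:C = 1 - 2 * kappa%:C by rewrite -e2 rmorphB rmorph1.
have e3 : (theta * (1 - lambda))%:C = theta%:C - kappa%:C.
  by rewrite -rmorphB /kappa mulrBr mulr1 [lambda * theta]mulrC.
rewrite e1 e2 e3; move: (int0 _ _) (int0 _ _) (int0 _ _) (int0 _ _) => i1 i2 i3 i4.
by rewrite -!addrA.
Qed.
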